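(* Let $G$ be a connected linear real reductive Lie group with maximal compact subgroup $K$ and Cartan decomposition $\mathfrak g=\mathfrak k\oplus\mathfrak p$, and let $\mathcal G=\{G_t\}_{0\le t\le 1}$ be the deformation family with $G_0=K\ltimes\mathfrak p$ and $G_t\cong G$ for $t>0$. Suppose that $f$ is a smooth function on $\mathcal G$ with compact support and that $x\in K$ is a regular element. Then $$\lim_{t\to 0}\int_{G_t} f(g\cdot x\cdot g^{-1},t)\,d_tg=\int_K\int_{\mathfrak p} f\left(kxk^{-1},\,w-\mathrm{Ad}_{kxk^{-1}}w,\,0\right)\,dk\,dw .$$
   Context: Deformation family. For $t>0$, $G_t$ is the set $K\times\mathfrak p$ with the group structure transported from $G$ by the diffeomorphism $\varphi_t:K\times\mathfrak p\to G$, $\varphi_t(k,v)=k\exp_G(tv)$; via $\varphi_t$ elements of $G_t$ are written as elements of $G$. $G_0=K\ltimes\mathfrak p$ is the set $K\times\mathfrak p$ with product $(k_1,v_1)\cdot_0(k_2,v_2)=(k_1k_2,\mathrm{Ad}_{k_2}^{-1}v_1+v_2)$. The total space $\mathcal G=\bigsqcup_{t\in[0,1]}G_t$ has the smooth structure of $K\times\mathfrak p\times[0,1]$. Thus a smooth (compactly supported) function $f$ on $\mathcal G$ is given by a smooth (compactly supported) function $F$ on $K\times\mathfrak p\times[0,1]$ via $f(k,v,0)=F(k,v,0)$ and, for $t>0$ (writing elements of $G_t$ as elements of $G$), $f(k\exp(tv),t)=F(k,v,t)$. Measures. $dk$ is the Haar measure on $K$ of total mass $1$. Let $\mathfrak a\subset\mathfrak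 p$ be a maximal abelian subalgebra, $\mathfrak a^+$ the positive Weyl chamber, $\Delta(\mathfrak p,\mathfrak a)$ the set of positive restricted roots, with multiplicities $n_\alpha$, and fix a Lebesgue measure $dv$ on $\mathfrak a$. For $t>0$ the Haar measure $d_tg$ on $G_t$ is defined by $$\int_{G_t}f(g,t)\,d_tg=\frac1{t^{\dim\mathfrak p-\dim\mathfrak a}}\int_K\int_{\mathfrak a^+}\int_K f(k\exp(tv)k',t)\prod_{\alpha\in\Delta(\mathfrak p,\mathfrak a)}\big(\sinh\alpha(tv)\big)^{n_\alpha}\,dk\,dv\,dk'.$$ The Lebesgue measure $dw$ on $\mathfrak p$ is normalized compatibly: $\int_{\mathfrak p}h(w)\,dw=\int_K\int_{\mathfrak a^+}h(\mathrm{Ad}_kv)\prod_{\alpha}\alpha(v)^{n_\alpha}\,dv\,dk$. Regularity. $x\in K$ is called regular if it lies in a maximal torus $T$ of $K$ (with Lie algebra $\mathfrak t$) such that $\mathrm{id}-\mathrm{Ad}_x$ is invertible on $\mathfrak g/\mathfrak t$; in particular $\det_{\mathfrak p}(\mathrm{id}-\mathrm{Ad}_x)\neq0$. *)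

(* Defs.v *)
From HB Require Import structures.
From mathcomp Require Import all_boot all_order all_algebra complex.
From mathcomp Require Import all_classical all_reals all_analysis.
From mathcomp Require Import measurable_realfun.
Set Implicit Arguments.
Unset Strict Implicit.
Unset Printing Implicit Defensive.
Import Order.TTheory GRing.Theory Num.Theory.
Import numFieldNormedType.Exports.
Local Open Scope classical_set_scope.
Local Open Scope ring_scope.

Section LinearAlgebra.
Context {F : fieldType} {V : vectType F}.

(* [0] when [A] is not a linear subspace. *)
Definition subspace_of (A : set V) : {vspace V} :=
  xget 0%VS [set U : {vspace V} | forall X, (X \in U) <-> A X].

Lemma subspace_ofP (A : set V) :
  A 0 -> (forall (c : F) X Y, A X -> A Y -> A (c *: X + Y)) ->
  forall X, (X \in subspace_of A) <-> A X.
Proof.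
move=> A0 Alin; rewrite /subspace_of; case: xgetP => [U _ //|noU].
exfalso.
pose P d := `[< exists2 U : {vspace V},
                  (forall X, X \in U -> A X) & \dim U = d >].
have P0 : exists d, P d.
  exists 0%N; apply/asboolP; exists 0%VS; last by rewrite dimv0.
  by move=> X; rewrite memv0 => /eqP ->.
have Pmax d : P d -> (d <= \dim {:V})%N.
  by move=> /asboolP [U _ <-]; apply: dimvS; apply: subvf.
case: (ex_maxnP P0 Pmax) => d /asboolP [U UA dU] dmax.
apply: (noU U) => X; split; first exact: UA.
move=> AX; apply: contrapT => XU.
have : (\dim (<[X]> + U)%VS <= d)%N.
  apply: dmax; apply/asboolP; exists (<[X]> + U)%VS => // Y.
  by move=> /memv_addP [_ /vlineP [c ->] [Z /UA AZ ->]]; exact: Alin.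
rewrite -dU => le_dim.
have eqU : U = (<[X]> + U)%VS.
  apply/eqP; rewrite eqEdim le_dim andbT; exact: addvSr.
by apply: XU; rewrite eqU; apply: (subvP (addvSl _ _)); exact: memv_line.
Qed.

End LinearAlgebra.

Section Smooth.
Context {R : realType} {V : normedModType R}.

Fixpoint Ck (k : nat) (f : V -> R) : Prop :=
  match k with
  | 0 => continuous f
  | k'.+1 => continuous f /\
      forall v, (forall x, derivable f x v) /\ Ck k' (fun x => 'D_v f x)
  end.

Definition Cinfty (f : V -> R) : Prop := forall k, Ck k f.

(* Smoothness on an arbitrary subset [D]: local extendability to a smooth
   function on the ambient space; for [D] a closed submanifold, possibly with
   boundary, this is smoothness on [D]. *)
Definition smooth_on (D : set V) (f : V -> R) : Prop :=
  forall x, D x -> exists2 h : V -> R,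
    Cinfty h & \forall y \near x, D y -> f y = h y.

Definition csmooth_on (D : set V) (f : V -> R[i]) : Prop :=
  smooth_on D (fun x => complex.Re (f x)) /\
  smooth_on D (fun x => complex.Im (f x)).

Definition compactly_supported_on (D : set V) (f : V -> R[i]) : Prop :=
  compact (closure [set x | D x /\ f x != 0]).

End Smooth.

Definition cintegral {R : realType} {d : measure_display}
    {T : measurableType d} (mu : {measure set T -> \bar R}) (D : set T)
    (h : T -> R[i]) : R[i] :=
  Complex (Rintegral mu D (fun x => complex.Re (h x)))
          (Rintegral mu D (fun x => complex.Im (h x))).

Notation borel_matrix R n := (g_sigma_algebraType (@open 'M[R]_n.+1)).

Section Groups.
Context {R : realType} {n : nat}.
Local Notation M := 'M[R]_n.+1.
Local Notation borelM := (borel_matrix R n).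

Definition expmx (X : M) : M :=
  limn (series (fun k : nat => (k`!%:R : R)^-1 *: X ^+ k)).

Definition matrix_subgroup (G : set M) : Prop :=
  [/\ G `<=` [set y | y \is a GRing.unit], G 1,
      (forall y z, G y -> G z -> G (y * z)) & (forall y, G y -> G y^-1)].

(* A connected linear real reductive group: a connected group of invertible
   real matrices, closed in GL and stable under transpose.  (Complex matrices
   are covered through C^n = R^(2n), which turns the conjugate transpose into
   the transpose.) *)
Definition linear_reductive (G : set M) : Prop :=
  [/\ matrix_subgroup G,
      closure G `&` [set y | y \is a GRing.unit] `<=` G,
      connected G & forall y, G y -> G y^T].

Definition is_lie_algebra (G : set M) (g : {vspace M}) : Prop :=
  forall X, (X \in g) <-> (forall s : R, G (expmx (s *: X))).

Definition Ad (y X : M) : M := y * X * y^-1.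

(* G intersected with the orthogonal group O(n + 1). *)
Definition maximal_compact (G : set M) : set M :=
  [set k | G k /\ k^T * k = 1].

(* The (-1)-eigenspace in [g] of the Cartan involution X |-> - X^T. *)
Definition cartan_p (g : {vspace M}) : {vspace M} :=
  subspace_of [set X | X \in g /\ X^T = X].

Definition abelian_in (p b : {vspace M}) : Prop :=
  (b <= p)%VS /\ forall X Y, X \in b -> Y \in b -> X * Y = Y * X.

Definition maximal_abelian_in (p a : {vspace M}) : Prop :=
  abelian_in p a /\
  forall b, abelian_in p b -> (a <= b)%VS -> b = a.

Definition torus (T : set M) : Prop :=
  [/\ matrix_subgroup T, compact T, connected T &
      forall y z, T y -> T z -> y * z = z * y].

Definition maximal_torus (K T : set M) : Prop :=
  [/\ torus T, T `<=` K &
      forall T', torus T' -> T' `<=` K -> T `<=` T' -> T' = T].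

(* The last two clauses say that [id - Ad x] is injective, resp. surjective, on
   the quotient [g / t]. *)
Definition regular_element (K : set M) (g : {vspace M}) (x : M) : Prop :=
  exists (T : set M) (t : {vspace M}),
    [/\ maximal_torus K T, is_lie_algebra T t, T x,
        (forall X, X \in g -> X - Ad x X \in t -> X \in t) &
        (forall Y, Y \in g ->
           exists2 X, X \in g & Y - (X - Ad x X) \in t)].

Section Roots.
Variables (g a : {vspace M}).

Local Notation dual := 'Hom(subvs_of a, R^o).

Definition ev (alpha : dual) (v : M) : R :=
  alpha (vsproj a v).

Definition root_space (alpha : dual) : {vspace M} :=
  subspace_of [set X | X \in g /\
    forall H, H \in a -> H * X - X * H = ev alpha H *: X].

Definition multiplicity (alpha : dual) : nat := \dim (root_space alpha).

Definition restricted_root (alpha : dual) : Prop :=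
  (exists2 H, H \in a & ev alpha H != 0) /\ root_space alpha != 0%VS.

Definition chamber_point (H0 : M) : Prop :=
  H0 \in a /\ forall alpha, restricted_root alpha -> ev alpha H0 != 0.

(* The positive system and the chamber containing the regular vector [H0]. *)
Definition positive_roots (H0 : M) : set dual :=
  [set alpha | restricted_root alpha /\ 0 < ev alpha H0].

Definition weyl_chamber (H0 : M) : set M :=
  [set v | v \in a /\ forall alpha, positive_roots H0 alpha -> 0 < ev alpha v].

Definition root_product (H0 : M) (c : R -> R) (v : M) : R :=
  \big[*%R/1]_(alpha \in positive_roots H0)
     (c (ev alpha v)) ^+ multiplicity alpha.

End Roots.

Definition sinh (s : R) : R := (expR s - expR (- s)) / 2.

Definition haar_probability (K : set M)
    (mu : {measure set borelM -> \bar R}) : Prop :=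
  [/\ mu (~` K) = 0%E, mu K = 1%E &
      forall k (A : set borelM), K k -> measurable A ->
        mu [set y : M | A (k * y)] = mu A].

Definition lebesgue_on (V : {vspace M})
    (nu : {measure set borelM -> \bar R}) : Prop :=
  [/\ nu (~` [set v : M | v \in V]) = 0%E,
      nu [set v : M | v \in V] <> 0%E,
      (forall C : set M, compact C -> (nu C < +oo)%E) &
      forall u (A : set borelM), u \in V -> measurable A ->
        nu [set v : M | A (u + v)] = nu A].

Definition compatible_lebesgue (G : set M) (g a : {vspace M}) (H0 : M)
    (dk da dp : {measure set borelM -> \bar R}) : Prop :=
  forall h : borelM -> \bar R, measurable_fun setT h ->
    (forall w, (0 <= h w)%E) ->
    (\int[dp]_(w in [set w : M | w \in cartan_p g]) h w =
     \int[dk]_(k in maximal_compact G) \int[da]_(v in weyl_chamber g a H0)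
        (h (Ad k v) * (root_product g a H0 id v)%:E))%E.

(* The Haar integral over [G_t], t > 0, of a function on [G_t] written as a
   function on [G]. *)
Definition haar_integral (G : set M) (g a : {vspace M}) (H0 : M)
    (dk da : {measure set borelM -> \bar R}) (t : R) (h : M -> R[i]) : R[i] :=
  real_complex R (t ^+ (\dim (cartan_p g) - \dim a))^-1 *
  cintegral dk (maximal_compact G) (fun k' =>
    cintegral da (weyl_chamber g a H0) (fun v =>
      cintegral dk (maximal_compact G) (fun k =>
        h ((k : M) * expmx (t *: (v : M)) * (k' : M)) *
        real_complex R (root_product g a H0 sinh (t *: (v : M)))))).

(* A function on the total space of the deformation is a pair: [f0 k v] is its
   value at (k, v) in G_0, and [f t y] its value at the element of G_t written
   as [y] in G, for 0 < t <= 1. *)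
Definition smooth_compact_on_family (G : set M) (g : {vspace M})
    (f0 : M -> M -> R[i]) (f : R -> M -> R[i]) : Prop :=
  let D := [set q : M * M * R | [/\ maximal_compact G q.1.1,
              q.1.2 \in cartan_p g & 0 <= q.2 <= 1]] in
  exists F : M * M * R -> R[i],
    [/\ csmooth_on D F, compactly_supported_on D F,
        (forall k v, maximal_compact G k -> v \in cartan_p g ->
           f0 k v = F (k, v, 0)) &
        (forall k v t, maximal_compact G k -> v \in cartan_p g -> 0 < t <= 1 ->
           f t (k * expmx (t *: v)) = F (k, v, t))].

End Groups.

(* Main.v *)
(* For t > 0 and y = k e^(tv) k', put w = Ad_k v and z = Ad_(kk') x.  Then
   y x y^-1 = e^(tw) z e^(-tw) has a polar decomposition k_t e^(t u_t), and as
   t -> 0 one has k_t -> z and u_t -> Ad_z^-1 w - w.  The density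
   prod (sinh alpha(tv) / t)^(n_alpha) tends to prod alpha(v)^(n_alpha), where
   dim p - dim a = sum n_alpha follows by comparing the volume of large balls of
   p with the right-hand side of the compatibility formula.  Regularity of x
   gives |w| <= c |u_t| uniformly in t, so that all integrands are bounded with
   support in one ball and dominated convergence applies.  Left invariance of dk
   (k' -> k^-1 k', then k -> Ad_k'(x) k) and the compatibility of dk, da and dp
   turn the limit into the integral over K and p.

   The polar decomposition of e^w z e^(-w) is obtained by following
   e^(-sw) e^(2s Ad_z^-1 w) e^(-sw) for 0 <= s <= 1: the s for which it lies in
   exp p form a closed set by compactness, and an open one because exp p is open
   in the symmetric elements of G (a variational argument).  Estimates on
   logarithms come from one fact: for symmetric A and B, an operator bound
   |e^A e^B| <= e^b implies A + B <= b as quadratic forms. *)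
Require Import Defs.
From HB Require Import structures.
From mathcomp Require Import all_boot all_order all_algebra complex.
From mathcomp Require Import all_classical all_reals all_analysis.
From mathcomp Require Import measurable_realfun.
From mathcomp Require Import ring lra.
Set Implicit Arguments.
Unset Strict Implicit.
Unset Printing Implicit Defensive.
Import Order.TTheory GRing.Theory Num.Theory.
Import numFieldNormedType.Exports.
Local Open Scope classical_set_scope.
Local Open Scope ring_scope.

(** * The Frobenius scalar product and the matrix exponential *)

Section Frobenius.
Context {R : realType} {n : nat}.
Local Notation M := 'M[R]_n.+1.
Implicit Types X Y Z : M.

(** An operator bound on a matrix A is written [fnorm (A * Y) <= c * fnorm Y] for every square Y,
    because left multiplication by A on the Frobenius space has the operator norm of A. The free
    factor Y also avoids the constant [fnorm 1], which is sqrt (n + 1) and not 1. With w' = Ad_z^-1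
    w one has e^w z e^(-w) = z e^(w') e^(-w) = k e^u. Up to orthogonal factors e^(w') e^(-w) is thus
    e^u, and the fact on A + B compares w' - w with u in both directions. These comparisons are
    homogeneous in (w, u), which is why they are uniform in t after scaling. The function f is
    accessible only through F in polar coordinates, so k_t and u_t must depend continuously on the
    integration variables for the integrands to be measurable. The Gram matrix e^(2tu) determines u
    and supplies this continuity. The measures on a and p may be infinite. Once a common radius for
    the supports is known, all integrals are rewritten over finite measures, where bounded
    measurable functions suffice. The power of 1/t has to match the number of sinh factors exactly,
    hence the separate proof that dim p - dim a is the sum of the multiplicities. *)

Definition mxdot X Y : R := \tr (X^T * Y).
Definition fnorm X : R := Num.sqrt (mxdot X X).

Lemma mxdotE X Y : mxdot X Y = \sum_i \sum_j X j i * Y j i.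
Proof.
rewrite /mxdot /mxtrace; apply: eq_bigr => i _; rewrite mxE.
by apply: eq_bigr => j _; rewrite mxE.
Qed.

Lemma mxdotC X Y : mxdot X Y = mxdot Y X.
Proof. by rewrite !mxdotE; do 2!apply: eq_bigr => ? _; rewrite mulrC. Qed.

Lemma mxdotDr X Y Z : mxdot X (Y + Z) = mxdot X Y + mxdot X Z.
Proof. by rewrite /mxdot mulrDr mxtraceD. Qed.

Lemma mxdotZr c X Y : mxdot X (c *: Y) = c * mxdot X Y.
Proof. by rewrite /mxdot -scalerAr mxtraceZ. Qed.

Lemma mxdotNr X Y : mxdot X (- Y) = - mxdot X Y.
Proof. by rewrite -scaleN1r mxdotZr mulN1r. Qed.

Lemma mxdotBr X Y Z : mxdot X (Y - Z) = mxdot X Y - mxdot X Z.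
Proof. by rewrite mxdotDr mxdotNr. Qed.

Lemma mxdotDl X Y Z : mxdot (Y + Z) X = mxdot Y X + mxdot Z X.
Proof. by rewrite !(mxdotC _ X) mxdotDr. Qed.

Lemma mxdotZl c X Y : mxdot (c *: X) Y = c * mxdot X Y.
Proof. by rewrite !(mxdotC _ Y) mxdotZr. Qed.

Lemma mxdotNl X Y : mxdot (- X) Y = - mxdot X Y.
Proof. by rewrite !(mxdotC _ Y) mxdotNr. Qed.

Lemma mxdotBl X Y Z : mxdot (Y - Z) X = mxdot Y X - mxdot Z X.
Proof. by rewrite mxdotDl mxdotNl. Qed.

Definition mxdot_lin := (mxdotDr, mxdotDl, mxdotNr, mxdotNl, mxdotZr, mxdotZl).

Lemma mxdot_ge0 X : 0 <= mxdot X X.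
Proof. by rewrite mxdotE; do 2!apply: sumr_ge0 => ? _; rewrite -expr2 sqr_ge0. Qed.

Lemma sqr_entry_le X i j : X i j ^+ 2 <= mxdot X X.
Proof.
rewrite mxdotE (bigD1 j)//= (bigD1 i)//= -expr2 -addrA lerDl addr_ge0//.
  by apply: sumr_ge0 => ? _; rewrite -expr2 sqr_ge0.
by do 2!apply: sumr_ge0 => ? _; rewrite -expr2 sqr_ge0.
Qed.

Lemma mxdot_eq0 X : (mxdot X X == 0) = (X == 0).
Proof.
apply/eqP/eqP => [X0|->]; last by rewrite /mxdot mulr0 mxtrace0.
apply/matrixP => i j; rewrite mxE; apply/eqP; rewrite -sqrf_eq0.
by rewrite eq_le sqr_ge0 -X0 sqr_entry_le.
Qed.

Lemma fnorm_ge0 X : 0 <= fnorm X. Proof. exact: sqrtr_ge0. Qed.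
Hint Resolve fnorm_ge0 : core.

Lemma fnorm_sqr X : fnorm X ^+ 2 = mxdot X X.
Proof. by rewrite sqr_sqrtr// mxdot_ge0. Qed.

Lemma fnorm_eq0 X : (fnorm X == 0) = (X == 0).
Proof. by rewrite -sqrf_eq0 fnorm_sqr mxdot_eq0. Qed.

Lemma fnorm0 : fnorm 0 = 0.
Proof. by apply/eqP; rewrite fnorm_eq0. Qed.

Lemma mxdot_CS X Y : mxdot X Y <= fnorm X * fnorm Y.
Proof.
have [->|Y0] := eqVneq Y 0.
  by rewrite /mxdot mulr0 mxtrace0 fnorm0 mulr0.
have yy : 0 < mxdot Y Y by rewrite lt_neqAle eq_sym mxdot_eq0 Y0 mxdot_ge0.
rewrite (le_trans (ler_norm _))// -(@ler_pXn2r _ 2)// ?nnegrE// ?mulr_ge0//.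
rewrite real_normK ?num_real// exprMn !fnorm_sqr.
have := mxdot_ge0 (mxdot Y Y *: X - mxdot X Y *: Y).
rewrite !mxdot_lin (mxdotC Y X) => h.
have {}h : 0 <= mxdot Y Y * (mxdot X X * mxdot Y Y - mxdot X Y ^+ 2) by lra.
by rewrite -subr_ge0; rewrite pmulr_rge0 in h.
Qed.

Lemma mxdot_CSN X Y : - (fnorm X * fnorm Y) <= mxdot X Y.
Proof.
have := mxdot_CS (- X) Y; rewrite mxdotNl /fnorm mxdotNl mxdotNr opprK => h.
by rewrite lerNl.
Qed.

Lemma fnormN X : fnorm (- X) = fnorm X.
Proof. by rewrite /fnorm mxdotNl mxdotNr opprK. Qed.

Lemma fnormZ c X : fnorm (c *: X) = `|c| * fnorm X.
Proof.
rewrite /fnorm mxdotZl mxdotZr mulrA -expr2 sqrtrM ?sqr_ge0//.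
by rewrite sqrtr_sqr.
Qed.

Lemma ler_fnormD X Y : fnorm (X + Y) <= fnorm X + fnorm Y.
Proof.
rewrite -(@ler_pXn2r _ 2)// ?nnegrE ?addr_ge0// fnorm_sqr sqrrD !mxdot_lin.
by rewrite (mxdotC Y X) -!fnorm_sqr; have := mxdot_CS X Y; lra.
Qed.

Lemma ler_fnorm_sum I (r : seq I) (P : pred I) (F : I -> M) :
  fnorm (\sum_(i <- r | P i) F i) <= \sum_(i <- r | P i) fnorm (F i).
Proof.
elim/big_rec2: _ => [|i x X _ h]; first by rewrite fnorm0.
by rewrite (le_trans (ler_fnormD _ _))// lerD2l.
Qed.

End Frobenius.
#[global] Hint Extern 0 (is_true (0 <= fnorm _)) => exact: fnorm_ge0 : core.

(** * Norms, convergence and compactness in the space of matrices *)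

Section MatrixTopology.
Context {R : realType} {n : nat}.
Local Notation M := 'M[R]_n.+1.
Implicit Types X Y Z H : M.

(** Cauchy-Schwarz for vectors is read off from [mxdot_CS]: row i of X and column j of Y are
    repeated in every column of the square matrices P and Q, and the factors n + 1 cancel. *)
Lemma row_col_CS X Y i j :
  (X * Y) i j ^+ 2 <= (\sum_k X i k ^+ 2) * (\sum_k Y k j ^+ 2).
Proof.
pose P : M := \matrix_(k, l) X i k; pose Q : M := \matrix_(k, l) Y k j.
have sum_const (F : M -> M -> 'I_n.+1 -> 'I_n.+1 -> R) (c : R) :
    (forall l, \sum_k F P Q l k = c) -> \sum_l \sum_k F P Q l k = n.+1%:R * c.
  move=> Fc; under eq_bigr do rewrite Fc.
  by rewrite sumr_const card_ord mulr_natl.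
have PQ : mxdot P Q = n.+1%:R * (X * Y) i j.
  rewrite mxdotE (sum_const (fun P Q l k => P k l * Q k l) ((X * Y) i j))// => l.
  by rewrite mxE; apply: eq_bigr => k _; rewrite !mxE.
have PP : mxdot P P = n.+1%:R * (\sum_k X i k ^+ 2).
  rewrite mxdotE (sum_const (fun P Q l k => P k l * P k l) (\sum_k X i k ^+ 2))// => l.
  by apply: eq_bigr => k _; rewrite !mxE expr2.
have QQ : mxdot Q Q = n.+1%:R * (\sum_k Y k j ^+ 2).
  rewrite mxdotE (sum_const (fun P Q l k => Q k l * Q k l) (\sum_k Y k j ^+ 2))// => l.
  by apply: eq_bigr => k _; rewrite !mxE expr2.
have := mxdot_CS P Q; have := mxdot_CSN P Q => h1 h2.
have : mxdot P Q ^+ 2 <= (fnorm P * fnorm Q) ^+ 2.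
  by rewrite -real_normK ?num_real// ler_pXn2r ?nnegrE ?mulr_ge0// ler_norml h1.
rewrite exprMn !fnorm_sqr PP QQ PQ.
rewrite exprMn mulrACA -expr2 => h3; rewrite -(@ler_pM2l _ (n.+1%:R ^+ 2))//.
by rewrite -exprMn (le_trans h3)// expr2 mulrACA.
Qed.

Lemma fnormM X Y : fnorm (X * Y) <= fnorm X * fnorm Y.
Proof.
rewrite -(@ler_pXn2r _ 2)// ?nnegrE ?mulr_ge0// exprMn !fnorm_sqr.
have -> : mxdot X X = \sum_i \sum_k X i k ^+ 2.
  by rewrite mxdotE exchange_big; do 2! apply: eq_bigr => ? _; rewrite -expr2.
have -> : mxdot Y Y = \sum_j \sum_k Y k j ^+ 2.
  by rewrite mxdotE; do 2! apply: eq_bigr => ? _; rewrite -expr2.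
rewrite mxdotE mulr_sumr; apply: ler_sum => j _.
rewrite mulr_suml; apply: ler_sum => i _.
by rewrite -expr2; exact: row_col_CS.
Qed.

(** The factor Y keeps the case k = 0 free of a constant; for X ^+ k alone the constant [fnorm 1]
    cannot be avoided. *)
Lemma fnormXM X Y k : fnorm (X ^+ k * Y) <= fnorm X ^+ k * fnorm Y.
Proof.
elim: k => [|k IH]; first by rewrite !expr0 !mul1r.
rewrite !exprS -!mulrA (le_trans (fnormM _ _))// ler_wpM2l//.
Qed.

Lemma fnormX X k : fnorm (X ^+ k) <= fnorm (1 : M) * fnorm X ^+ k.
Proof. by rewrite -[X ^+ k]mulr1 mulrC; exact: fnormXM. Qed.

(** Here [|X|] is the largest absolute value of an entry, the norm that carries the topology.
    Estimates use [fnorm] instead, which is submultiplicative and invariant under orthogonal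
    factors. *)
Lemma ler_normr_fnorm X : `|X| <= fnorm X.
Proof.
rewrite [leLHS]/Num.norm /= mx_normrE; apply/bigmax_leP; split => // -[i j] _ /=.
rewrite -(@ler_pXn2r _ 2)// ?nnegrE// fnorm_sqr real_normK ?num_real//.
exact: sqr_entry_le.
Qed.

Lemma entry_le_normr X i j : `|X i j| <= `|X|.
Proof.
rewrite [leRHS]/Num.norm /= mx_normrE; apply/bigmax_geP; right.
by exists (i, j).
Qed.

Lemma cvg_mx_entries {T : Type} {F : set_system T} {FF : Filter F} (f : T -> M) (l : M) :
  (forall i j, (fun x => f x i j) @ F --> l i j) -> f @ F --> l.
Proof.
move=> fl; apply/cvgrPdist_lt => e e0.
have : \forall x \near F, forall ij : 'I_n.+1 * 'I_n.+1,
    `|l ij.1 ij.2 - f x ij.1 ij.2| < e.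
  apply: filter_forall => -[i j] /=.
  by have /cvgrPdist_lt /(_ _ e0) := fl i j.
apply: filterS => x h.
by rewrite [ltLHS]/Num.norm /= mx_normrE; apply/bigmax_ltP; split => // ij _; rewrite !mxE.
Qed.

Lemma cvg_entry {T : Type} {F : set_system T} {FF : Filter F} (f : T -> M) (l : M) i j :
  f @ F --> l -> (fun x => f x i j) @ F --> l i j.
Proof.
move=> fl; exact: (cvg_comp _ _ fl (@coord_continuous _ _ _ i j l)).
Qed.

Lemma cvg_bigsum {T : Type} {F : set_system T} {FF : Filter F} (I : Type)
    (r : seq I) (P : pred I) (f : I -> T -> R) (l : I -> R) :
  (forall i, P i -> f i @ F --> l i) ->
  (fun x => \sum_(i <- r | P i) f i x) @ F --> \sum_(i <- r | P i) l i.
Proof. by move=> fl; apply: cvg_big => //; exact: add_continuous. Qed.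

Lemma cvg_mulmx {T : Type} {F : set_system T} {FF : Filter F} (f g : T -> M) (l m : M) :
  f @ F --> l -> g @ F --> m -> (fun x => f x * g x) @ F --> l * m.
Proof.
move=> fl gm; apply: cvg_mx_entries => i j.
rewrite mxE; under eq_fun do rewrite mxE.
apply: cvg_bigsum => k _; apply: cvgM; exact: cvg_entry.
Qed.

Lemma cvg_trmx {T : Type} {F : set_system T} {FF : Filter F} (f : T -> M) (l : M) :
  f @ F --> l -> (fun x => (f x)^T) @ F --> l^T.
Proof.
move=> fl; apply: cvg_mx_entries => i j.
by rewrite mxE; under eq_fun do rewrite mxE; exact: cvg_entry.
Qed.

Lemma cvg_mxdot {T : Type} {F : set_system T} {FF : Filter F} (f g : T -> M) (l m : M) :
  f @ F --> l -> g @ F --> m -> (fun x => mxdot (f x) (g x)) @ F --> mxdot l m.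
Proof.
move=> fl gm; rewrite mxdotE; under eq_fun do rewrite mxdotE.
by apply: cvg_bigsum => i _; apply: cvg_bigsum => j _; apply: cvgM; exact: cvg_entry.
Qed.

Lemma cvg_mxtrace {T : Type} {F : set_system T} {FF : Filter F} (f : T -> M) (l : M) :
  f @ F --> l -> (fun x => \tr (f x)) @ F --> \tr l.
Proof.
by move=> fl; apply: cvg_bigsum => i _; exact: cvg_entry.
Qed.

Lemma cvg_fnorm {T : Type} {F : set_system T} {FF : Filter F} (f : T -> M) (l : M) :
  f @ F --> l -> (fun x => fnorm (f x)) @ F --> fnorm l.
Proof.
move=> fl; apply: (cvg_comp _ _ (cvg_mxdot fl fl)).
exact: sqrt_continuous.
Qed.

Lemma cvg_fnorm0 {T : Type} {F : set_system T} {FF : Filter F} (f : T -> M) (l : M) :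
  (fun x => fnorm (f x - l)) @ F --> 0 -> f @ F --> l.
Proof.
move=> /cvgrPdist_lt h; apply/cvgrPdist_lt => e e0.
near=> x; rewrite distrC; apply: le_lt_trans (ler_normr_fnorm _) _.
have : `|0 - fnorm (f x - l)| < e by near: x; exact: h.
by rewrite sub0r normrN ger0_norm.
Unshelve. all: by end_near. Qed.

Lemma cvg_mx_unique {T : Type} {F : set_system T} {FF : ProperFilter F} (f : T -> M) (l m : M) :
  f @ F --> l -> f @ F --> m -> l = m.
Proof. by move=> fl fm; apply: (cvg_unique _ fl fm). Qed.

(** Compactness is transported from row vectors along the continuous map [vec_mx]. *)
Lemma mx_bounded_closed_compact (A : set M) (C : R) :
  (forall X, A X -> fnorm X <= C) -> closed A -> compact A.
Proof.
move=> AC clA.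
pose B := [set v : 'rV[R]_(n.+1 * n.+1) | forall i, `|v 0 i| <= C].
have cB : compact B.
  apply: bounded_closed_compact.
    exists C; split; [exact: num_real|move=> r Cr v Bv].
    rewrite /= [leLHS]/Num.norm /= mx_normrE; apply/bigmax_leP; split => /=.
      rewrite (le_trans _ (ltW Cr))//; apply: le_trans (Bv (Ordinal (ltn0Sn _))) => //.
    by move=> [i j] _ /=; rewrite (ord1 i) (le_trans (Bv j))// ltW.
  rewrite [B](_ : _ = \bigcap_i ((fun v : 'rV[R]_(n.+1 * n.+1) => `|v 0 i|) @^-1` [set y | y <= C])).
    apply: closed_bigI => i _; apply: closed_comp; last exact: closed_le.
    move=> v _; apply: (@continuous_comp _ _ _ (fun v : 'rV[R]_(n.+1 * n.+1) => v 0 i)).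
      exact: coord_continuous.
    exact: norm_continuous.
  by apply/seteqP; split => [v Bv i _|v Bv i]; exact: Bv.
have cont : continuous (@vec_mx R n.+1 n.+1 : 'rV[R]_(n.+1 * n.+1) -> M).
  move=> v; suff : (fun w : 'rV[R]_(n.+1 * n.+1) => vec_mx w : M) @ nbhs v --> (vec_mx v : M) by [].
  apply: cvg_mx_entries => i j; rewrite mxE; under eq_fun do rewrite mxE.
  exact: coord_continuous.
apply: (subclosed_compact clA (continuous_compact (continuous_subspaceT cont) cB)).
move=> X AX; exists (mxvec X); last by rewrite mxvecK.
move=> k; case/mxvec_indexP: k => i j; rewrite mxvecE.
exact: le_trans (entry_le_normr _ _ _) (le_trans (ler_normr_fnorm _) (AC _ AX)).
Qed.
End MatrixTopology.

(** * The exponential series, its functional equation and its Taylor estimates *)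

Section ExponentialSeries.
Context {R : realType}.

(** The square of indices is cut into the triangle i + j < N, summed along antidiagonals, and the
    remainder of the Cauchy product. *)
Lemma cauchy_square_split (V : zmodType) (F : nat -> nat -> V) N :
  \sum_(i < N) \sum_(j < N) F i j =
  \sum_(m < N) \sum_(i < m.+1) F i (m - i)%N +
  \sum_(i < N) \sum_(j < N | (N <= i + j)%N) F i j.
Proof.
have -> : \sum_(m < N) \sum_(i < m.+1) F i (m - i)%N =
    \sum_(i < N) \sum_(j < N - i) F i j.
  elim: N => [|N IH]; first by rewrite !big_ord0.
  rewrite big_ord_recr /= IH [RHS]big_ord_recr /= subSnn big_ord1.
  rewrite big_ord_recr /= subnn addrA -big_split /=; congr (_ + _).
  by apply: eq_bigr => i _; rewrite subSn ?big_ord_recr//= ltnW.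
rewrite -big_split; apply: eq_bigr => i _.
rewrite (bigID (fun j : 'I_N => (i + j < N)%N)) /=; congr (_ + _).
  rewrite (big_ord_widen N) ?leq_subr//; apply: eq_bigl => j.
  by rewrite ltn_subRL.
by apply: eq_bigl => j; rewrite -leqNgt.
Qed.

(** An arbitrary algebra is allowed because [expmxD] uses the identity twice: for matrices, and for
    real numbers, where the remainder built from |a|, |b| and [fnorm X] dominates the matrix
    remainder. *)
Lemma exp_coeffMr (A : algType R) (X : A) (a b : R) N :
  let c k := (k`!%:R : R)^-1 in
  (\sum_(i < N) c i *: (a *: X) ^+ i) * (\sum_(j < N) c j *: (b *: X) ^+ j) =
  \sum_(m < N) c m *: ((a + b) *: X) ^+ m +
  \sum_(i < N) \sum_(j < N | (N <= i + j)%N)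
     (c i * c j * (a ^+ i * b ^+ j)) *: X ^+ (i + j).
Proof.
move=> c; rewrite mulr_suml.
under eq_bigr do rewrite mulr_sumr.
pose F i j := (c i * c j * (a ^+ i * b ^+ j)) *: X ^+ (i + j).
have FE i j : c i *: (a *: X) ^+ i * (c j *: (b *: X) ^+ j) = F i j.
  rewrite !exprZn !scalerA -scalerAl -scalerAr scalerA /F exprD; congr (_ *: _).
  by ring.
under eq_bigr do under eq_bigr do rewrite FE.
rewrite cauchy_square_split; congr (_ + _); apply: eq_bigr => m _.
rewrite exprZn addrC exprDn scaler_suml scaler_sumr; apply: eq_bigr => i _.
rewrite /F subnKC; last by rewrite -ltnS.
rewrite scalerA; congr (_ *: _).
have im : (i <= m)%N by rewrite -ltnS.
have := bin_fact im => /(congr1 (fun k => k%:R : R)); rewrite !natrM => h.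
rewrite -mulr_natr /c.
have p k : k`!%:R != 0 :> R by rewrite pnatr_eq0 -lt0n fact_gt0.
rewrite -h.
have bn : 'C(m, i)%:R != 0 :> R by rewrite pnatr_eq0 -lt0n bin_gt0.
by field; rewrite !p bn.
Qed.

End ExponentialSeries.

Section MatrixExponential.
Context {R : realType} {n : nat}.
Local Notation M := 'M[R]_n.+1.
Implicit Types X Y H A B : M.

Local Notation ec k := ((k`!%:R : R)^-1).
Local Notation eser X := (fun k : nat => ec k *: (X : M) ^+ k).

Lemma ec_ge0 k : 0 <= ec k. Proof. by rewrite invr_ge0. Qed.
Hint Resolve ec_ge0 : core.

Lemma cvg_expR_series (x : R) : series (fun k => ec k * x ^+ k) @ \oo --> expR x.
Proof. by rewrite -exp_coeffE; exact: is_cvg_series_exp_coeff. Qed.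

(** Since [expmx] is a [limn], it carries no information before convergence is known. Each entry is
    dominated by the exponential series of [fnorm X]. *)
Lemma cvg_expmx X : series (eser X) @ \oo --> expmx X.
Proof.
have cvgij i j : cvgn (series (fun k => eser X k i j)).
  apply: normed_cvg.
  apply: (series_le_cvg (v_ := fun k => (fnorm (1 : M)) * (ec k * fnorm X ^+ k))).
  - by move=> k /=.
  - by move=> k; rewrite mulr_ge0// mulr_ge0// exprn_ge0.
  - move=> k /=; apply: (le_trans (entry_le_normr _ _ _)).
    apply: (le_trans (ler_normr_fnorm _)).
    rewrite fnormZ ger0_norm// mulrCA ler_wpM2l//; exact: fnormX.
  - have := @is_cvg_seriesZ R (fun k => ec k * fnorm X ^+ k) (fnorm (1 : M)).
    apply; apply: cvgP; exact: cvg_expR_series.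
suff : cvgn (series (eser X : M ^nat)) by [].
apply/cvg_ex; exists (\matrix_(i, j) limn (series (fun k => eser X k i j))).
apply: cvg_mx_entries => i j; rewrite mxE.
rewrite (_ : (fun N => _) = series (fun k => eser X k i j)); last first.
  by apply/funext => N; rewrite /series /= summxE.
exact: cvgij.
Qed.

Lemma fnorm_series_le (u : nat -> M) (a : nat -> R) (U : M) (A : R) :
  (forall k, fnorm (u k) <= a k) -> series u @ \oo --> U -> series a @ \oo --> A ->
  fnorm U <= A.
Proof.
move=> ua uU aA; apply: (ler_cvg_to (cvg_fnorm uU) aA).
apply: nearW => N /=; apply: (le_trans (ler_fnorm_sum _ _ _)).
by apply: ler_sum => k _.
Qed.

Lemma fnorm_expmxM X Y : fnorm (expmx X * Y) <= expR (fnorm X) * fnorm Y.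
Proof.
apply: (@fnorm_series_le (fun k => ec k *: X ^+ k * Y)
  (fun k => ec k * fnorm X ^+ k * fnorm Y)).
- move=> k; rewrite -scalerAl fnormZ ger0_norm// -mulrA ler_wpM2l//.
  exact: fnormXM.
- rewrite [series _](_ : _ = fun N => series (eser X) N * Y).
    apply: cvg_mulmx; [exact: cvg_expmx|exact: cvg_cst].
  by apply/funext => N; rewrite /series /= mulr_suml.
- rewrite [series _](_ : _ = fun N => series (fun k => ec k * fnorm X ^+ k) N * fnorm Y).
    apply: cvgM; [exact: cvg_expR_series|exact: cvg_cst].
  by apply/funext => N; rewrite /series /= mulr_suml.
Qed.

Lemma expmxT X : (expmx X)^T = expmx X^T.
Proof.
have h : series (eser X^T) @ \oo --> (expmx X)^T.
  rewrite (_ : series _ = fun N => (series (eser X) N)^T).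
    by apply: cvg_trmx; exact: cvg_expmx.
  apply/funext => N; rewrite /series /= linear_sum; apply: eq_bigr => k _.
  rewrite linearZ /=; congr (_ *: _).
  elim: k => [|k IH]; first by rewrite !expr0 trmx1.
  by rewrite exprS exprSr trmx_mul IH.
by apply: (cvg_mx_unique h); exact: cvg_expmx.
Qed.

Lemma expmx_conj (P X : M) : P \is a GRing.unit -> expmx (P * X * P^-1) = P * expmx X * P^-1.
Proof.
move=> uP.
have h : series (eser (P * X * P^-1)) @ \oo --> P * expmx X * P^-1.
  rewrite (_ : series _ = fun N => P * series (eser X) N * P^-1).
    apply: cvg_mulmx; last exact: cvg_cst.
    by apply: cvg_mulmx; [exact: cvg_cst|exact: cvg_expmx].
  apply/funext => N; rewrite /series /= mulr_sumr mulr_suml; apply: eq_bigr => k _.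
  rewrite -scalerAr -scalerAl; congr (_ *: _).
  elim: k => [|k IH]; first by rewrite !expr0 mulr1 divrr.
  by rewrite !exprS IH !mulrA mulrVK.
by apply: (cvg_mx_unique _ h); exact: cvg_expmx.
Qed.

(** The remainder of the Cauchy product of partial sums is dominated by the same remainder for the
    real series, which tends to 0 because expR is already multiplicative. *)
Lemma expmxD (X : M) (a b : R) : expmx (a *: X) * expmx (b *: X) = expmx ((a + b) *: X).
Proof.
pose S Y N := series (eser Y) N.
pose s (x : R) N := series (fun k => ec k * x ^+ k) N.
have SE Y N : S Y N = \sum_(i < N) ec i *: Y ^+ i by rewrite /S /series /= big_mkord.
have sE y N : s y N = \sum_(i < N) ec i * y ^+ i by rewrite /s /series /= big_mkord.
have cS Y : S Y @ \oo --> expmx Y by exact: cvg_expmx.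
have cs y : s y @ \oo --> expR y by exact: cvg_expR_series.
have h1 : (fun N => S (a *: X) N * S (b *: X) N - S ((a + b) *: X) N) @ \oo -->
    expmx (a *: X) * expmx (b *: X) - expmx ((a + b) *: X).
  by apply: cvgB; [exact: cvg_mulmx|].
set x := fnorm X.
have h2 : (fun N => fnorm (1 : M) * (s (`|a| * x) N * s (`|b| * x) N - s ((`|a| + `|b|) * x) N)) @ \oo --> 0.
  rewrite -(mulr0 (fnorm (1 : M))) -(subrr (expR ((`|a| + `|b|) * x))).
  apply: cvgM; first exact: cvg_cst.
  by apply: cvgB => //; rewrite mulrDl expRD; apply: cvgM.
have h3 : (fun N => S (a *: X) N * S (b *: X) N - S ((a + b) *: X) N) @ \oo --> (0 : M).
  apply: cvg_fnorm0; under eq_fun do rewrite subr0.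
  apply: (squeeze_cvgr _ (cvg_cst 0) h2); apply: nearW => N; rewrite fnorm_ge0/=.
  rewrite !SE !sE exp_coeffMr addrAC subrr add0r.
  have := @exp_coeffMr R R^o x `|a| `|b| N; rewrite /GRing.scale /= => ->.
  rewrite addrAC subrr add0r mulr_sumr.
  apply: (le_trans (ler_fnorm_sum _ _ _)); apply: ler_sum => i _.
  rewrite mulr_sumr.
  apply: (le_trans (ler_fnorm_sum _ _ _)); apply: ler_sum => j _.
  rewrite fnormZ !normrM !normrX !(ger0_norm (ec_ge0 _)) [leRHS]mulrCA; apply: ler_wpM2l.
    by rewrite !mulr_ge0// exprn_ge0.
  exact: fnormX.
by apply/eqP; rewrite -subr_eq0; apply/eqP; exact: (cvg_mx_unique h1 h3).
Qed.

Lemma expmx0 : expmx (0 : M) = 1.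
Proof.
have h : series (eser (0 : M)) @ \oo --> (1 : M).
  apply: (@cvg_trans _ ((fun=> (1 : M)) @ \oo)); last exact: cvg_cst.
  apply: near_eq_cvg; exists 1%N => // -[//|N] _.
  rewrite /series /= big_nat_recl//= fact0 invr1 scale1r big1 ?addr0// => i _.
  by rewrite expr0n scaler0.
by apply: (cvg_mx_unique _ h); exact: cvg_expmx.
Qed.

Lemma expmxNr X : expmx X * expmx (- X) = 1.
Proof.
by rewrite -[X in expmx X * _]scale1r -scaleN1r expmxD subrr scale0r expmx0.
Qed.

Lemma expmxNl X : expmx (- X) * expmx X = 1.
Proof. by have := expmxNr (- X); rewrite opprK. Qed.

Lemma expmx_unit X : expmx X \is a GRing.unit.
Proof. by apply/unitrP; exists (expmx (- X)); rewrite expmxNl expmxNr. Qed.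

Lemma expmxV X : (expmx X)^-1 = expmx (- X).
Proof.
by apply: (mulrI (expmx_unit X)); rewrite divrr ?expmx_unit// expmxNr.
Qed.

Lemma expmxMn X k : expmx (k%:R *: X) = expmx X ^+ k.
Proof.
elim: k => [|k IH]; first by rewrite scale0r expmx0 expr0.
by rewrite exprS -IH -[X in expmx X * _]scale1r expmxD -natr1 addrC.
Qed.

Lemma expmx_half X : expmx (2^-1 *: X) * expmx (2^-1 *: X) = expmx X.
Proof. by rewrite expmxD -[2^-1]mul1r -splitr scale1r. Qed.

(** The difference is a sum of words in X and H with at least one letter H; the commutative
    expansion on the right bounds it word by word. The induction peels off the leftmost letter. *)
Lemma fnormX_sub X H k :
  fnorm ((X + H) ^+ k - X ^+ k) <=
  fnorm (1 : M) * ((fnorm X + fnorm H) ^+ k - fnorm X ^+ k).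
Proof.
elim: k => [|k IH]; first by rewrite !expr0 !subrr fnorm0 mulr0.
have -> : (X + H) ^+ k.+1 - X ^+ k.+1 = (X + H) * ((X + H) ^+ k - X ^+ k) + H * X ^+ k.
  by rewrite !exprS mulrBr [(X + H) * X ^+ k]mulrDl opprD addrA subrK.
apply: (le_trans (ler_fnormD _ _)).
apply: (@le_trans _ _ ((fnorm X + fnorm H) * (fnorm (1 : M) * ((fnorm X + fnorm H) ^+ k - fnorm X ^+ k)) +
   fnorm H * (fnorm (1 : M) * fnorm X ^+ k))).
  apply: lerD; apply: (le_trans (fnormM _ _)).
    by apply: ler_pM => //; exact: ler_fnormD.
  by rewrite ler_wpM2l//; exact: fnormX.
by rewrite le_eqVlt; apply/orP; left; apply/eqP; rewrite !exprS; ring.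
Qed.

Lemma fnorm_expmx_sub X H :
  fnorm (expmx (X + H) - expmx X) <=
  fnorm (1 : M) * (expR (fnorm X + fnorm H) - expR (fnorm X)).
Proof.
pose x := fnorm X; pose h := fnorm H.
apply: (@fnorm_series_le (fun k => ec k *: (X + H) ^+ k - ec k *: X ^+ k)
  (fun k => fnorm (1 : M) * (ec k * (x + h) ^+ k - ec k * x ^+ k))).
- move=> k; rewrite -scalerBr -mulrBr fnormZ ger0_norm// mulrCA ler_wpM2l//.
  exact: fnormX_sub.
- rewrite [series _](_ : _ = fun N => series (eser (X + H)) N - series (eser X) N).
    by apply: cvgB; exact: cvg_expmx.
  by apply/funext => N; rewrite /series /= sumrB.
- rewrite [series _](_ : _ = fun N => fnorm (1 : M) * (series (fun k => ec k * (x + h) ^+ k) N - series (fun k => ec k * x ^+ k) N)).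
    apply: cvgM; first exact: cvg_cst.
    by apply: cvgB; exact: cvg_expR_series.
  by apply/funext => N; rewrite /series /= -sumrB mulr_sumr.
Qed.

Lemma continuous_expmx : continuous (expmx : M -> M).
Proof.
move=> X; suff : (fun Y : M => fnorm (expmx Y - expmx X)) @ nbhs X --> 0.
  by move/cvg_fnorm0; exact.
have d0 : (fun Y : M => fnorm X + fnorm (Y - X)) @ nbhs X --> fnorm X.
  suff : (fun Y : M => fnorm X + fnorm (Y - X)) @ nbhs X --> fnorm X + fnorm (X - X).
    by rewrite subrr fnorm0 addr0.
  apply: cvgD; first exact: cvg_cst.
  by apply: cvg_fnorm; apply: cvgB; [exact: cvg_id|exact: cvg_cst].
have h : (fun Y : M => fnorm (1 : M) * (expR (fnorm X + fnorm (Y - X)) - expR (fnorm X))) @ nbhs X --> 0.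
  rewrite -(mulr0 (fnorm (1 : M))) -(subrr (expR (fnorm X))).
  apply: cvgM; first exact: cvg_cst.
  apply: cvgB; last exact: cvg_cst.
  exact: (cvg_comp _ _ d0 (@continuous_expR _ _)).
apply: (squeeze_cvgr _ (cvg_cst 0) h); apply: nearW => Y; rewrite fnorm_ge0/=.
by have := fnorm_expmx_sub X (Y - X); rewrite [X + (Y - X)]addrC subrK.
Qed.

Lemma cvg_expmx_comp {T : Type} {F : set_system T} {FF : Filter F} (f : T -> M) X :
  f @ F --> X -> (fun y => expmx (f y)) @ F --> expmx X.
Proof. by move=> fX; apply: continuous_cvg; [exact: continuous_expmx|exact: fX]. Qed.

Lemma fnorm_expmx_sub1 X :
  fnorm (expmx X - 1 - X) <= fnorm (1 : M) * (expR (fnorm X) - 1 - fnorm X).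
Proof.
pose x := fnorm X.
(* A series with a single nonzero term, so that subtracting 1 and X becomes a termwise operation on
   the exponential series. *)
have c1 : forall (V : normedModType R) (v : V) (m : nat),
    series (fun k => if k == m then v else 0) @ \oo --> v.
  move=> V v m; apply: (@cvg_trans _ ((fun=> v) @ \oo)); last exact: cvg_cst.
  apply: near_eq_cvg; exists m.+1 => // N /= mN.
  rewrite /series /= big_mkord (bigD1 (Ordinal mN))//= eqxx big1 ?addr0// => i.
  by rewrite -val_eqE /= => /negPf ->.
apply: (@fnorm_series_le
  (fun k => ec k *: X ^+ k - (if k == 0%N then 1 else 0) - (if k == 1%N then X else 0))
  (fun k => fnorm (1 : M) * (ec k * x ^+ k - (if k == 0%N then 1 else 0) - (if k == 1%N then x else 0)))).
- move=> [|[|k]] /=.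
  + by rewrite fact0 invr1 scale1r !expr0 subrr subr0 fnorm0 mul1r subrr subr0 mulr0.
  + by rewrite factS fact0 invr1 scale1r !expr1 subr0 subrr fnorm0 mul1r subr0 subrr mulr0.
  + rewrite !subr0 fnormZ ger0_norm// mulrCA ler_wpM2l//; exact: fnormX.
- rewrite [series _](_ : _ = fun N => series (eser X) N -
     series (fun k => if k == 0%N then 1 else 0) N - series (fun k => if k == 1%N then X else 0) N).
    by apply: cvgB; [apply: cvgB; [exact: cvg_expmx|exact: c1]|exact: c1].
  by apply/funext => N; rewrite /series /= !sumrB.
- rewrite [series _](_ : _ = fun N => fnorm (1 : M) * (series (fun k => ec k * x ^+ k) N -
     series (fun k => if k == 0%N then 1 else 0) N - series (fun k => if k == 1%N then x else 0) N)).
    apply: cvgM; first exact: cvg_cst.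
    by apply: cvgB; [apply: cvgB; [exact: cvg_expR_series|exact: (c1 R^o)]|exact: (c1 R^o)].
  by apply/funext => N; rewrite /series /= -!sumrB mulr_sumr.
Qed.

(** From 1 - h <= e^(-h) one gets e^h <= 1 / (1 - h), and 1 / (1 - h) <= 1 + h + 2 h^2 as long as h
    <= 1/2. *)
Lemma expR_sub1_le (h : R) : 0 <= h <= 2^-1 -> expR h - 1 - h <= 2 * h ^+ 2.
Proof.
move=> /andP[h0 h1].
have e1 : 1 - h <= expR (- h) by exact: expR_ge1Dx.
have e2 : expR h * (1 - h) <= 1.
  by rewrite -[leRHS](@expRxMexpNx_1 _ h) ler_wpM2l// expR_ge0.
have e3 : 1 <= (1 + h + 2 * h ^+ 2) * (1 - h).
  have : 0 <= h ^+ 2 * (1 - 2 * h) by rewrite mulr_ge0 ?sqr_ge0//; lra.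
  by nra.
have p : 0 < 1 - h by lra.
have : expR h * (1 - h) <= (1 + h + 2 * h ^+ 2) * (1 - h) by lra.
by rewrite ler_pM2r// => ?; lra.
Qed.

Lemma fnorm_expmx_sub1_le X : fnorm X <= 2^-1 ->
  fnorm (expmx X - 1 - X) <= 2 * fnorm (1 : M) * fnorm X ^+ 2.
Proof.
move=> X1; apply: (le_trans (fnorm_expmx_sub1 X)).
by rewrite -mulrA mulrCA ler_wpM2l// expR_sub1_le// fnorm_ge0.
Qed.

Lemma norm_series_le (u a : nat -> R) (U A : R) :
  (forall k, `|u k| <= a k) -> series u @ \oo --> U -> series a @ \oo --> A ->
  `|U| <= A.
Proof.
move=> ua uU aA; apply: (ler_cvg_to (cvg_norm uU) aA).
apply: nearW => N /=; apply: (le_trans (ler_norm_sum _ _ _)).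
by apply: ler_sum => k _.
Qed.

Lemma cvg_series_shift (b : nat -> R) (B : R) : series b @ \oo --> B ->
  series (fun k => if k is k'.+1 then b k' else 0) @ \oo --> B.
Proof.
move=> bB; rewrite -cvg_shiftS /= (_ : (fun N => _) = series b)//.
by apply/funext => N; rewrite /series /= big_nat_recl// add0r.
Qed.

(** The derivative at X of the k-th power map in the direction H. *)
Let dpow X H k := \sum_(i < k) X ^+ i * H * X ^+ (k - i.+1).

Let dpowS X H k : dpow X H k.+1 = H * X ^+ k + X * dpow X H k.
Proof.
rewrite /dpow big_ord_recl /= expr0 mul1r subn1 /= mulr_sumr; congr (_ + _).
by apply: eq_bigr => i _; rewrite /bump /= add1n subSS exprS !mulrA.
Qed.

(** Cyclicity of the trace makes all summands of the derivative equal, which removes the effect of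
    noncommutativity. *)
Let tr_dpow X H k : \tr (dpow X H k.+1) = k.+1%:R * \tr (X ^+ k * H).
Proof.
rewrite /dpow raddf_sum /= (eq_bigr (fun=> \tr (X ^+ k * H))).
  by rewrite sumr_const card_ord mulr_natl.
have trC (A B : M) : \tr (A * B) = \tr (B * A) := mxtrace_mulC A B.
move=> i _; rewrite -mulrA trC -mulrA trC; congr (\tr (_ * _)).
by rewrite -exprD subSS subnK// -ltnS.
Qed.

Let fnorm_dpow X H k :
  fnorm (dpow X H k) <= fnorm (1 : M) * (k%:R * (fnorm H * fnorm X ^+ k.-1)).
Proof.
apply: (le_trans (ler_fnorm_sum _ _ _)).
rewrite mulrCA mulr_natl -[k in leRHS]card_ord -sumr_const; apply: ler_sum => i _.
rewrite -mulrA (le_trans (fnormXM _ _ _))//.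
apply: (@le_trans _ _ (fnorm X ^+ i * (fnorm H * (fnorm (1 : M) * fnorm X ^+ (k - i.+1))))).
  rewrite ler_wpM2l ?exprn_ge0// (le_trans (fnormM _ _))// ler_wpM2l//.
  exact: fnormX.
rewrite card_ord; have -> : k.-1 = (i + (k - i.+1))%N.
  by case: k i => [[]//|k i]; rewrite subSS subnKC// -ltnS.
by rewrite exprD le_eqVlt; apply/orP; left; apply/eqP; ring.
Qed.

(** What remains after subtracting the linear part are the words with at least two letters H, again
    bounded by the commutative expansion. *)
Let fnorm_dpow_sub X H k :
  fnorm ((X + H) ^+ k - X ^+ k - dpow X H k) <= fnorm (1 : M) *
    ((fnorm X + fnorm H) ^+ k - fnorm X ^+ k - k%:R * (fnorm H * fnorm X ^+ k.-1)).
Proof.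
elim: k => [|k IH].
  by rewrite !expr0 /dpow big_ord0 mulr0n mul0r !subrr fnorm0 mulr0.
have -> : (X + H) ^+ k.+1 - X ^+ k.+1 - dpow X H k.+1 =
   (X + H) * ((X + H) ^+ k - X ^+ k - dpow X H k) + H * dpow X H k.
  rewrite dpowS !exprS !mulrBr [(X + H) * X ^+ k]mulrDl [(X + H) * dpow _ _ _]mulrDl.
  by rewrite !opprD !addrA subrK.
apply: (le_trans (ler_fnormD _ _)).
apply: (@le_trans _ _ ((fnorm X + fnorm H) * (fnorm (1 : M) *
    ((fnorm X + fnorm H) ^+ k - fnorm X ^+ k - k%:R * (fnorm H * fnorm X ^+ k.-1))) +
   fnorm H * (fnorm (1 : M) * (k%:R * (fnorm H * fnorm X ^+ k.-1))))).
  apply: lerD; apply: (le_trans (fnormM _ _)).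
    by apply: ler_pM => //; exact: ler_fnormD.
  by rewrite ler_wpM2l//; exact: fnorm_dpow.
rewrite le_eqVlt; apply/orP; left; apply/eqP.
case: k {IH} => [|k] /=; first by rewrite !expr1 !expr0; ring.
by rewrite !exprS -[k.+2]addn2 -[k.+1]addn1 !natrD; ring.
Qed.

(** The gradient of X -> tr e^X is e^X even though X and H do not commute. One factor [fnorm 1]
    comes from the power estimates, the other from \tr Z = <1, Z> and Cauchy-Schwarz. *)
Lemma tr_expmx_taylor X H :
  `|\tr (expmx (X + H)) - \tr (expmx X) - \tr (expmx X * H)| <=
  fnorm (1 : M) ^+ 2 * (expR (fnorm X + fnorm H) - expR (fnorm X) - expR (fnorm X) * fnorm H).
Proof.
pose x := fnorm X; pose h := fnorm H.
(* The trace of the derivative of X^k / k! is the term of index k - 1 of \tr (e^X H), hence the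
   shift by one. *)
pose sh (b : nat -> R) k := if k is k'.+1 then b k' else 0.
pose u k := ec k * \tr ((X + H) ^+ k) - ec k * \tr (X ^+ k) - sh (fun k => ec k * \tr (X ^+ k * H)) k.
pose a k := fnorm (1 : M) ^+ 2 * (ec k * (x + h) ^+ k - ec k * x ^+ k - sh (fun k => ec k * x ^+ k * h) k).
have ecS k : ec k.+1 * k.+1%:R = ec k.
  by rewrite factS natrM invfM mulrC mulrA mulfV ?mul1r// pnatr_eq0.
have cvg_tr Y (Z : M) : series (fun k => ec k * \tr (Y ^+ k * Z)) @ \oo --> \tr (expmx Y * Z).
  rewrite (_ : series _ = fun N => \tr (series (eser Y) N * Z)).
    apply: cvg_mxtrace; apply: cvg_mulmx; [exact: cvg_expmx|exact: cvg_cst].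
  apply/funext => N; rewrite /series /= mulr_suml raddf_sum /=.
  by apply: eq_bigr => k _; rewrite -scalerAl mxtraceZ.
have cvg_tr1 Y : series (fun k => ec k * \tr (Y ^+ k)) @ \oo --> \tr (expmx Y).
  have := cvg_tr Y 1; rewrite mulr1.
  by under [in X in series X]eq_fun do rewrite mulr1.
apply: (@norm_series_le u a).
- move=> k; pose Rk := (X + H) ^+ k - X ^+ k - dpow X H k.
  have -> : u k = ec k * mxdot 1 Rk.
    rewrite /mxdot trmx1 mul1r /Rk !raddfB /= !mulrBr; congr (_ - _ - _).
    case: k {Rk} => [|k] /=; first by rewrite /dpow big_ord0 mxtrace0 mulr0.
    by rewrite tr_dpow mulrA ecS.
  rewrite normrM ger0_norm//.
  have -> : a k = ec k * (fnorm (1 : M) * (fnorm (1 : M) * ((x + h) ^+ k - x ^+ k - k%:R * (h * x ^+ k.-1)))).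
    rewrite /a; case: k {Rk} => [|k] /=; first by rewrite !expr0 !mulr1; ring.
    by rewrite -(ecS k); ring.
  rewrite ler_wpM2l//; apply: (@le_trans _ _ (fnorm (1 : M) * fnorm Rk)).
    by rewrite ler_norml mxdot_CSN mxdot_CS.
  by rewrite ler_wpM2l//; exact: fnorm_dpow_sub.
- rewrite [series _](_ : _ = fun N => series (fun k => ec k * \tr ((X + H) ^+ k)) N -
     series (fun k => ec k * \tr (X ^+ k)) N - series (sh (fun k => ec k * \tr (X ^+ k * H))) N).
    by apply: cvgB; [apply: cvgB|apply: cvg_series_shift].
  by apply/funext => N; rewrite /series /= !sumrB.
- rewrite [series _](_ : _ = fun N => fnorm (1 : M) ^+ 2 * (series (fun k => ec k * (x + h) ^+ k) N -
     series (fun k => ec k * x ^+ k) N - series (sh (fun k => ec k * x ^+ k * h)) N)).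
    apply: cvgM; first exact: cvg_cst.
    apply: cvgB; first by apply: cvgB; exact: cvg_expR_series.
    apply: cvg_series_shift.
    rewrite [series _](_ : _ = fun N => series (fun k => ec k * x ^+ k) N * h).
      by apply: cvgM; [exact: cvg_expR_series|exact: cvg_cst].
    by apply/funext => N; rewrite /series /= mulr_suml.
  by apply/funext => N; rewrite /series /= -!sumrB mulr_sumr.
Qed.

Lemma tr_expmx_taylor_le X H : fnorm H <= 2^-1 ->
  `|\tr (expmx (X + H)) - \tr (expmx X) - \tr (expmx X * H)| <=
  fnorm (1 : M) ^+ 2 * expR (fnorm X) * 2 * fnorm H ^+ 2.
Proof.
move=> H1; apply: (le_trans (tr_expmx_taylor X H)).
rewrite -(mulrA _ 2) -mulrA ler_wpM2l ?sqr_ge0// expRD.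
apply: (@le_trans _ _ (expR (fnorm X) * (expR (fnorm H) - 1 - fnorm H))).
  by rewrite le_eqVlt; apply/orP; left; apply/eqP; ring.
by rewrite ler_wpM2l ?expR_ge0// expR_sub1_le// fnorm_ge0.
Qed.

End MatrixExponential.

#[local] Opaque expmx.

(** * Exponentials of symmetric matrices *)

Section SymmetricExponential.
Context {R : realType} {n : nat}.
Local Notation M := 'M[R]_n.+1.
Implicit Types X Y H A B S T W : M.

Definition symmx : set M := [set X | X^T = X].

Lemma symmxD X Y : symmx X -> symmx Y -> symmx (X + Y).
Proof. by rewrite /symmx /= linearD /= => -> ->. Qed.

Lemma symmxZ (c : R) X : symmx X -> symmx (c *: X).
Proof. by rewrite /symmx /= linearZ /= => ->. Qed.

Lemma symmxN X : symmx X -> symmx (- X).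
Proof. by rewrite -scaleN1r; exact: symmxZ. Qed.

Lemma symmxB X Y : symmx X -> symmx Y -> symmx (X - Y).
Proof. by move=> sX sY; apply: symmxD => //; exact: symmxN. Qed.

Lemma symmx_exp X : symmx X -> symmx (expmx X).
Proof. by rewrite /symmx /= expmxT => ->. Qed.

Lemma trmxM X Y : (X * Y)^T = Y^T * X^T.
Proof. exact: trmx_mul. Qed.

Lemma symmx_cong (P X : M) : symmx X -> symmx (P^T * X * P).
Proof. by rewrite /symmx /= => sX; rewrite !trmxM trmxK sX mulrA. Qed.

Lemma mxdot_mulL A X Y : mxdot (A * X) Y = mxdot X (A^T * Y).
Proof. by rewrite /mxdot trmxM mulrA. Qed.

Lemma mxtrMC X Y : \tr (X * Y) = \tr (Y * X).
Proof. exact: mxtrace_mulC. Qed.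

Lemma mxdot_mulR A X Y : mxdot (X * A) Y = mxdot X (Y * A^T).
Proof. by rewrite /mxdot trmxM -mulrA mxtrMC mulrA. Qed.

Lemma fnormT X : fnorm X^T = fnorm X.
Proof. by rewrite /fnorm /mxdot trmxK mxtrMC. Qed.

Lemma mxdot_sqr S Y : symmx S -> mxdot Y (S * S * Y) = fnorm (S * Y) ^+ 2.
Proof. by move=> sS; rewrite fnorm_sqr mxdot_mulL sS mulrA. Qed.

(** By Bernoulli's inequality r^(2^m) >= 1 + 2^m (r - 1), which is unbounded in m if r > 1. *)
Lemma pow2_bounded_le1 (r K : R) : 0 <= r -> (forall j, r ^+ (2 ^ j) <= K) -> r <= 1.
Proof.
move=> r0 rK; rewrite leNgt; apply/negP => r1.
have bern m : 1 + m%:R * (r - 1) <= r ^+ m.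
  elim: m => [|m IH]; first by rewrite mul0r addr0 expr0.
  have e : 0 <= m%:R * (r - 1) ^+ 2 by rewrite mulr_ge0 ?sqr_ge0.
  rewrite exprS; apply: (@le_trans _ _ (r * (1 + m%:R * (r - 1)))); last by rewrite ler_wpM2l.
  by rewrite -natr1; lra.
have r1' : 0 < r - 1 by lra.
have := archi_boundP (_ : 0 <= `|K / (r - 1)|) => /(_ (normr_ge0 _)).
set m := Num.bound _ => hm.
have := rK m; apply/negP; rewrite -ltNge; apply: lt_le_trans (bern _).
have h2 : K / (r - 1) < (2 ^ m)%:R.
  apply: (le_lt_trans (ler_norm _)); apply: (lt_le_trans hm).
  by rewrite ler_nat ltnW// ltn_expl.
by rewrite ltr_pdivrMr// in h2; lra.
Qed.

(* With N = T S^2 T, Cauchy-Schwarz gives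
   <Y, N Y>^(2^j) |Y|^2 <= |Y|^(2 * 2^j) <Y, N^(2^j) Y>, while
   N^(m+1) = T (S^2 T^2)^m S^2 T is O(c^m); let j tend to infinity. *)
Lemma opnorm_half S T (c : R) : symmx S -> symmx T -> 0 < c ->
  (forall Y, fnorm (S * S * (T * T) * Y) <= c * fnorm Y) ->
  forall Y, fnorm (S * T * Y) ^+ 2 <= c * fnorm Y ^+ 2.
Proof.
move=> sS sT c0 bST Y.
have [->|Y0] := eqVneq Y 0; first by rewrite mulr0 fnorm0 expr0n mulr0.
pose N := T * (S * S) * T.
pose y := fnorm Y.
have y0 : 0 < y by rewrite lt_neqAle eq_sym fnorm_eq0 Y0 fnorm_ge0.
have sN : symmx N by rewrite /symmx /N /= !trmxM sS sT !mulrA.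
have sNk k : symmx (N ^+ k).
  elim: k => [|k IH]; first by rewrite /symmx /= expr0 trmx1.
  by rewrite /symmx /= exprS trmxM sN IH -exprSr exprS.
pose a j := mxdot Y (N ^+ (2 ^ j) * Y).
have a0 : a 0%N = fnorm (S * T * Y) ^+ 2.
  by rewrite /a expn0 expr1 /N fnorm_sqr mxdot_mulL trmxM sS sT !mulrA.
have aS j : a j.+1 = fnorm (N ^+ (2 ^ j) * Y) ^+ 2.
  by rewrite -mxdot_sqr// -exprD addnn -mul2n -expnS.
have a_ge0 j : 0 <= a j by case: j => [|j]; rewrite ?a0 ?aS sqr_ge0.
have a_pow j : a 0%N ^+ (2 ^ j) * y ^+ 2 <= y ^+ 2 ^+ (2 ^ j) * a j.
  elim: j => [|j IH]; first by rewrite expn0 !expr1 mulrC.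
  have h : a j ^+ 2 <= y ^+ 2 * a j.+1.
    rewrite aS -exprMn ler_pXn2r ?nnegrE ?mulr_ge0 ?fnorm_ge0//.
    exact: mxdot_CS.
  rewrite -(@ler_pM2r _ (y ^+ 2)) ?exprn_gt0// expnS mulnC !(exprM _ (2 ^ j)).
  move: IH; set P := a 0%N ^+ _; set Q := y ^+ 2 ^+ _ => IH.
  have P0 : 0 <= P by rewrite exprn_ge0.
  have Q0 : 0 <= Q by rewrite !exprn_ge0// ltW.
  apply: (@le_trans _ _ ((P * y ^+ 2) ^+ 2)).
    by rewrite le_eqVlt; apply/orP; left; apply/eqP; ring.
  apply: (@le_trans _ _ ((Q * a j) ^+ 2)).
    by rewrite ler_pXn2r ?nnegrE ?mulr_ge0// ltW// exprn_gt0.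
  rewrite exprMn -[leRHS]mulrA; apply: ler_wpM2l; first exact: exprn_ge0.
  by rewrite mulrC in h.
pose K := fnorm T * fnorm (S * S * T).
have NE m : N ^+ m.+1 = T * (S * S * (T * T)) ^+ m * (S * S * T).
  elim: m => [|m IH]; first by rewrite expr1 expr0 mulr1 /N !mulrA.
  by rewrite exprSr IH /N [in RHS]exprSr !mulrA.
have opm m Z : fnorm ((S * S * (T * T)) ^+ m * Z) <= c ^+ m * fnorm Z.
  elim: m Z => [|m IH] Z; first by rewrite !expr0 !mul1r.
  rewrite exprS -[_ * _ ^+ m * Z]mulrA; apply: (le_trans (bST _)).
  rewrite [c ^+ _]exprS -[c * _ * _]mulrA; apply: ler_wpM2l; [exact: ltW|exact: IH].
have a_le m : mxdot Y (N ^+ m.+1 * Y) <= y ^+ 2 * (K * c ^+ m).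
  apply: (le_trans (mxdot_CS _ _)).
  have -> : N ^+ m.+1 * Y = T * ((S * S * (T * T)) ^+ m * (S * S * T * Y)).
    by rewrite NE -[LHS]mulrA -[LHS]mulrA.
  apply: (@le_trans _ _ (y * (fnorm T * (c ^+ m * (fnorm (S * S * T) * y))))).
    apply: ler_wpM2l; first exact: fnorm_ge0.
    apply: (le_trans (fnormM _ _)); apply: ler_wpM2l; first exact: fnorm_ge0.
    apply: (le_trans (opm _ _)); apply: ler_wpM2l; first by rewrite exprn_ge0// ltW.
    exact: fnormM.
  by rewrite /K le_eqVlt; apply/orP; left; apply/eqP; ring.
have r1 : a 0%N / (y ^+ 2 * c) <= 1.
  apply: (@pow2_bounded_le1 _ (K / c)).
    by rewrite divr_ge0// mulr_ge0 ?exprn_ge0 ?ltW.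
  move=> j; rewrite expr_div_n ler_pdivrMr ?exprn_gt0 ?mulr_gt0 ?exprn_gt0//.
  rewrite -(@ler_pM2r _ (y ^+ 2)) ?exprn_gt0//.
  apply: (le_trans (a_pow j)); rewrite [(y ^+ 2 * c) ^+ _]exprMn.
  have := a_le (2 ^ j).-1; rewrite prednK ?expn_gt0// => h.
  apply: (@le_trans _ _ (y ^+ 2 ^+ (2 ^ j) * (y ^+ 2 * (K * c ^+ (2 ^ j).-1)))).
    by apply: ler_wpM2l => //; rewrite !exprn_ge0// ltW.
  have -> : c ^+ (2 ^ j) = c * c ^+ (2 ^ j).-1 by rewrite -exprS prednK ?expn_gt0.
  set u := c ^+ _; set v := _ ^+ (2 ^ j).
  by rewrite le_eqVlt; apply/orP; left; apply/eqP; field; rewrite gt_eqF.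
move: r1; rewrite ler_pdivrMr ?mulr_gt0 ?exprn_gt0// mul1r a0.
by rewrite mulrC.
Qed.

(** The remainder of e^(hX) is quadratic in h. The filter is arbitrary because the lemma serves for
    the sequences 2^-j and 1/(j + 1) and for the deformation parameter. *)
Lemma cvg_expmx_diff {T : Type} {F : set_system T} {FF : Filter F} (h : T -> R) X :
  h @ F --> 0 -> (\forall x \near F, 0 < h x) ->
  (fun x => (h x)^-1 *: (expmx (h x *: X) - 1)) @ F --> X.
Proof.
move=> h0 hpos; apply: cvg_fnorm0.
have g0 : (fun x => 2 * fnorm (1 : M) * fnorm X ^+ 2 * h x) @ F --> 0.
  by rewrite -(mulr0 (2 * fnorm (1 : M) * fnorm X ^+ 2)); apply: cvgM => //; exact: cvg_cst.
have k0 : (fun x => fnorm X * h x) @ F --> 0.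
  by rewrite -(mulr0 (fnorm X)); apply: cvgM => //; exact: cvg_cst.
have half0 : 0 < 2^-1 :> R by [].
apply: (squeeze_cvgr _ (cvg_cst 0) g0); near=> x; rewrite fnorm_ge0/=.
have hx : 0 < h x by near: x.
have kx : fnorm X * h x <= 2^-1.
  rewrite ltW//; near: x.
  have /cvgrPdist_lt/(_ _ half0) := k0; apply: filterS => x.
  by rewrite sub0r normrN => /(le_lt_trans (ler_norm _)).
have e : (h x)^-1 *: (expmx (h x *: X) - 1) - X =
    (h x)^-1 *: (expmx (h x *: X) - 1 - h x *: X).
  by rewrite [RHS]scalerBr scalerA mulVf ?gt_eqF// scale1r.
rewrite e fnormZ gtr0_norm ?invr_gt0// mulrC ler_pdivrMr//.
have := @fnorm_expmx_sub1_le R n (h x *: X).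
rewrite !fnormZ gtr0_norm// mulrC kx => /(_ isT) /le_trans; apply.
by rewrite le_eqVlt; apply/orP; left; apply/eqP; ring.
Unshelve. all: by end_near. Qed.

(* By opnorm_half the hypothesis passes from (A, B, b) to (A, B, b) / 2^j;
   differentiate at 0. *)
Lemma exp_op_le A B (b : R) : symmx A -> symmx B ->
  (forall Y, fnorm (expmx A * expmx B * Y) <= expR b * fnorm Y) ->
  forall Y, mxdot Y ((A + B) * Y) <= b * fnorm Y ^+ 2.
Proof.
move=> sA sB hAB Y.
pose h j : R := 2^-1 ^+ j.
have h_gt0 j : 0 < h j by rewrite exprn_gt0.
have hS j : h j = h j.+1 + h j.+1 by rewrite /h exprS; field.
have hop j Z : fnorm (expmx (h j *: A) * expmx (h j *: B) * Z) <= expR (h j * b) * fnorm Z.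
  elim: j Z => [|j IH] Z; first by rewrite /h expr0 !scale1r mul1r.
  rewrite -(@ler_pXn2r _ 2) ?nnegrE ?mulr_ge0 ?fnorm_ge0 ?expR_ge0//.
  rewrite exprMn -expRM_natl mulr2n mulrDl mul1r -mulrDl -hS.
  apply: opnorm_half; rewrite ?expR_gt0//; try by apply: symmx_exp; exact: symmxZ.
  by move=> W; rewrite 2!expmxD -(hS j); exact: IH.
have h0 : h @ \oo --> 0 by apply: cvg_expr; rewrite ger0_norm// invf_lt1// ltr1n.
have hn : \forall j \near \oo, 0 < h j by apply: nearW.
pose D j : M := (h j)^-1 *: (expmx (h j *: A) - 1) * expmx (h j *: B) +
                (h j)^-1 *: (expmx (h j *: B) - 1).
have DE j : D j = (h j)^-1 *: (expmx (h j *: A) * expmx (h j *: B) - 1).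
  by rewrite /D -scalerAl -scalerDr mulrBl mul1r addrA subrK.
have eB : (fun j => expmx (h j *: B)) @ \oo --> (1 : M).
  rewrite -(@expmx0 R n); apply: continuous_cvg; first exact: continuous_expmx.
  by rewrite -(scale0r B); apply: cvgZl.
have DAB : D @ \oo --> A + B.
  rewrite -[X in X + B]mulr1; apply: cvgD; last exact: cvg_expmx_diff.
  by apply: cvg_mulmx => //; exact: cvg_expmx_diff.
have lim1 : (fun j => mxdot Y (D j * Y)) @ \oo --> mxdot Y ((A + B) * Y).
  by apply: cvg_mxdot; [exact: cvg_cst|apply: cvg_mulmx; [|exact: cvg_cst]].
have lim2 : (fun j => b * expR (h j * b) * fnorm Y ^+ 2) @ \oo --> b * expR (0 * b) * fnorm Y ^+ 2.
  apply: cvgM; last exact: cvg_cst.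
  apply: cvgM; first exact: cvg_cst.
  apply: continuous_cvg; first exact: continuous_expR.
  by apply: cvgM => //; exact: cvg_cst.
rewrite mul0r expR0 mulr1 in lim2.
apply: (ler_cvg_to lim1 lim2); apply: nearW => j.
rewrite DE -scalerAl mxdotZr mulrC ler_pdivrMr//.
rewrite mulrBl mul1r mxdotBr -[mxdot Y Y]fnorm_sqr.
have h1 := le_trans (mxdot_CS Y (expmx (h j *: A) * expmx (h j *: B) * Y))
  (ler_wpM2l (fnorm_ge0 Y) (hop j Y)).
have e1 : 1 - h j * b <= expR (- (h j * b)) by exact: expR_ge1Dx.
have e2 : expR (h j * b) * (1 - h j * b) <= 1.
  by rewrite -[leRHS](@expRxMexpNx_1 _ (h j * b)) ler_wpM2l// expR_ge0.
have e3 : (expR (h j * b) * (1 - h j * b)) * fnorm Y ^+ 2 <= 1 * fnorm Y ^+ 2.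
  by rewrite ler_wpM2r// sqr_ge0.
by move: h1 e3; set E := expR _; set y := fnorm Y; set z := mxdot Y _; lra.
Qed.

(* The factor fnorm 1 = sqrt (n + 1) compares the Frobenius norm with the
   operator norm. *)
Lemma fnorm_le_numrange W (b : R) : symmx W ->
  (forall Y, `|mxdot Y (W * Y)| <= b * fnorm Y ^+ 2) -> fnorm W <= b * fnorm (1 : M).
Proof.
move=> sW hW.
pose v := fnorm (1 : M); pose w := fnorm W.
have v0 : 0 < v by rewrite lt_neqAle eq_sym fnorm_eq0 oner_eq0 fnorm_ge0.
have b0 : 0 <= b.
  by have := le_trans (normr_ge0 _) (hW 1); rewrite pmulr_lge0// exprn_gt0.
have [w0|w0] := eqVneq w 0; first by rewrite -/w w0 mulr_ge0// ltW.
have {}w0 : 0 < w by rewrite lt_neqAle eq_sym w0 fnorm_ge0.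
(* The hypothesis is tested at W + s and W - s. Subtracting removes <W, W W> and <1, W> and leaves 2
   s w^2 <= b (w^2 + s^2 v^2). The choice s = w / v makes s^2 v^2 = w^2, so that s <= b. *)
pose s := w / v.
have s0 : 0 < s by rewrite divr_gt0.
have e1 : mxdot 1 (W * W) = w ^+ 2.
  by rewrite /w fnorm_sqr /mxdot sW trmx1 mul1r.
have E (c : R) : mxdot (W + c *: 1) (W * (W + c *: 1)) =
    mxdot W (W * W) + 2 * c * w ^+ 2 + c ^+ 2 * mxdot 1 W.
  rewrite mulrDr -scalerAr mulr1 !mxdot_lin e1 -[mxdot W W]fnorm_sqr -/w; ring.
have N (c : R) : fnorm (W + c *: 1) ^+ 2 = w ^+ 2 + 2 * c * mxdot 1 W + c ^+ 2 * v ^+ 2.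
  rewrite fnorm_sqr !mxdot_lin (mxdotC W 1) -[mxdot W W]fnorm_sqr -[mxdot 1 1]fnorm_sqr -/v -/w; ring.
have := hW (W + s *: 1); rewrite E N ler_norml => /andP[_ h1].
have := hW (W + (- s) *: 1); rewrite E N ler_norml => /andP[h2 _].
move: h1 h2; set x := mxdot W (W * W); set q := mxdot 1 W => h1 h2.
have h3 : s * w ^+ 2 * 2 <= b * (w ^+ 2 + s ^+ 2 * v ^+ 2) by lra.
have sv : s * v = w by rewrite /s divfK// gt_eqF.
rewrite -exprMn sv in h3.
have h4 : s <= b by rewrite -(@ler_pM2r _ (w ^+ 2)) ?exprn_gt0//; lra.
by rewrite -/w -sv ler_wpM2r// ltW.
Qed.

(** The case B = 0 of [exp_op_le]: an operator bound on an exponential becomes a bound on its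
    logarithm as a quadratic form. *)
Lemma numrange_exp_le (W : M) (b : R) : symmx W ->
  (forall Y, fnorm (expmx W * Y) <= expR b * fnorm Y) ->
  forall Y, mxdot Y (W * Y) <= b * fnorm Y ^+ 2.
Proof.
move=> sW hW Y; have := @exp_op_le W 0 b sW _ _ Y; rewrite addr0; apply.
  by rewrite /symmx /= trmx0.
by move=> Z; rewrite expmx0 mulr1.
Qed.

(** Quantitative injectivity of exp on symmetric matrices. The matrix e^X e^(-Y) has operator norm
    at most 1 + e, and its inverse e^Y e^(-X) at most 1 / (1 - e) <= 1 + 2e because e <= 1/2;
    [exp_op_le] then bounds X - Y and Y - X by 2e as quadratic forms. *)
Lemma symmx_exp_close X Y (e : R) : symmx X -> symmx Y -> 0 <= e <= 2^-1 ->
  fnorm (expmx X * expmx (- Y) - 1) <= e -> fnorm (X - Y) <= 2 * e * fnorm (1 : M).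
Proof.
move=> sX sY /andP[e0 e1] hN; set N := expmx X * expmx (- Y) in hN.
have h1 Z : fnorm (N * Z) <= (1 + e) * fnorm Z.
  have -> : N * Z = Z + (N - 1) * Z by rewrite mulrBl mul1r addrCA subrr addr0.
  rewrite (le_trans (ler_fnormD _ _))// [leRHS]mulrDl mul1r lerD2l.
  by rewrite (le_trans (fnormM _ _))// ler_wpM2r// fnorm_ge0.
pose N' := expmx Y * expmx (- X).
have NN' : N * N' = 1 by rewrite /N /N' mulrA -(mulrA (expmx X)) expmxNl mulr1 expmxNr.
have h2 Z : (1 - e) * fnorm (N' * Z) <= fnorm Z.
  have -> : fnorm Z = fnorm (N' * Z + (N - 1) * (N' * Z)).
    by rewrite mulrBl mul1r addrCA subrr addr0 mulrA NN' mul1r.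
  have h3 : fnorm ((N - 1) * (N' * Z)) <= e * fnorm (N' * Z).
    by rewrite (le_trans (fnormM _ _))// ler_wpM2r// fnorm_ge0.
  have := ler_fnormD (N' * Z + (N - 1) * (N' * Z)) (- ((N - 1) * (N' * Z))).
  by rewrite addrK fnormN; lra.
have h3 Z : fnorm (N' * Z) <= (1 + 2 * e) * fnorm Z.
  have p : 0 < 1 - e by lra.
  rewrite -(ler_pM2l p) (le_trans (h2 Z))//.
  have : 0 <= (e - 2 * e ^+ 2) * fnorm Z by rewrite mulr_ge0 ?fnorm_ge0//; nra.
  by lra.
have sW := symmxB sX sY.
apply: fnorm_le_numrange => // Z; rewrite ler_norml; apply/andP; split.
  have := @exp_op_le Y (- X) (2 * e) sY (symmxN sX) _ Z.
  rewrite -[Y - X]opprB mulNr mxdotNr lerNl; apply => Z'.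
  by rewrite (le_trans (h3 _))// ler_wpM2r ?fnorm_ge0// expR_ge1Dx.
apply: (@exp_op_le X (- Y) (2 * e) sX (symmxN sY)) => Z'.
rewrite (le_trans (h1 _))// ler_wpM2r ?fnorm_ge0// (le_trans _ (expR_ge1Dx _))//.
by lra.
Qed.

Lemma expmx_symm_inj X Y : symmx X -> symmx Y -> expmx X = expmx Y -> X = Y.
Proof.
move=> sX sY XY; apply/eqP; rewrite -subr_eq0 -fnorm_eq0 eq_le fnorm_ge0 andbT.
have := @symmx_exp_close X Y 0 sX sY; rewrite mulr0 mul0r lexx invr_ge0 ler0n; apply => //.
by rewrite XY expmxNr subrr fnorm0.
Qed.

(** Continuity of the symmetric logarithm, formulated without introducing the logarithm as a
    function. *)
Lemma cvg_symm_exp {T : Type} {F : set_system T} {FF : Filter F} (f : T -> M) X :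
  (\forall x \near F, symmx (f x)) -> symmx X ->
  (fun x => expmx (f x)) @ F --> expmx X -> f @ F --> X.
Proof.
move=> sf sX fX; apply: cvg_fnorm0.
have h : (fun x => fnorm (expmx (f x) * expmx (- X) - 1)) @ F --> 0.
  rewrite -(@fnorm0 R n) -(subrr (1 : M)) -{2}(expmxNr X); apply: cvg_fnorm.
  apply: cvgB; last exact: cvg_cst.
  by apply: cvg_mulmx; [exact: fX|exact: cvg_cst].
have h' : (fun x => 2 * fnorm (expmx (f x) * expmx (- X) - 1) * fnorm (1 : M)) @ F --> 0.
  rewrite -(mul0r (fnorm (1 : M))) -(mulr0 2); apply: cvgM; last exact: cvg_cst.
  by apply: cvgM => //; exact: cvg_cst.
have half0 : 0 < 2^-1 :> R by [].
apply: (squeeze_cvgr _ (cvg_cst 0) h'); near=> x; rewrite fnorm_ge0/=.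
apply: symmx_exp_close => //; first by near: x.
rewrite fnorm_ge0/= ltW//; near: x.
have /cvgrPdist_lt/(_ _ half0) := h; apply: filterS => x.
by rewrite sub0r normrN => /(le_lt_trans (ler_norm _)).
Unshelve. all: by end_near. Qed.

Lemma subrX_noncomm (P Q : M) k :
  P ^+ k - Q ^+ k = \sum_(i < k) P ^+ i * (P - Q) * Q ^+ (k - i.+1).
Proof.
elim: k => [|k IH]; first by rewrite big_ord0 subrr.
rewrite big_ord_recr /= subnn expr0 mulr1.
under eq_bigr => i _ do rewrite subSn// exprSr mulrA.
by rewrite -mulr_suml -IH !exprSr mulrBl mulrBr [RHS]addrC addrA subrK.
Qed.

Lemma fnorm_expmxMr X Y : fnorm (Y * expmx X) <= expR (fnorm X) * fnorm Y.
Proof.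
rewrite -[fnorm (Y * _)]fnormT trmxM expmxT -(fnormT X) -(fnormT Y).
exact: fnorm_expmxM.
Qed.

(* With P = e^(X/N) and Q = e^(Y/N), expand P^N - Q^N as the telescoping sum of
   P^i (P - Q) Q^(N-1-i) and let N tend to infinity. *)
Lemma expmx_strong_mono X Y (C : R) : symmx X -> symmx Y -> fnorm X <= C -> fnorm Y <= C ->
  expR (- (2 * C)) * fnorm (X - Y) ^+ 2 <= mxdot (expmx X - expmx Y) (X - Y).
Proof.
move=> sX sY XC YC.
have C0 : 0 <= C := le_trans (fnorm_ge0 X) XC.
pose N (j : nat) : R := j.+1%:R.
have N0 j : 0 < N j by [].
pose h j := (N j)^-1.
have h_gt0 j : 0 < h j by rewrite invr_gt0.
pose H j := (h j)^-1 *: (expmx (h j *: X) - 1) - (h j)^-1 *: (expmx (h j *: Y) - 1).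
have h0 : h @ \oo --> 0 by exact: cvg_harmonic.
have Hlim : H @ \oo --> X - Y.
  by apply: cvgB; apply: cvg_expmx_diff => //; exact: nearW.
have lim1 : (fun j => expR (- (2 * C)) * fnorm (H j) ^+ 2) @ \oo -->
    expR (- (2 * C)) * fnorm (X - Y) ^+ 2.
  by apply: cvgM; [exact: cvg_cst|apply: cvgM; exact: cvg_fnorm].
have lim2 : (fun j => mxdot (expmx X - expmx Y) (H j)) @ \oo -->
    mxdot (expmx X - expmx Y) (X - Y).
  by apply: cvg_mxdot; [exact: cvg_cst|exact: Hlim].
apply: (ler_cvg_to lim1 lim2); apply: nearW => j.
(* [p Z i] is a symmetric square root of the i-th power of e^(hZ). It turns each term <P^i D
   Q^(j-i), D> of the telescoping sum into the square of |p D p'|. Undoing both factors costs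
   e^(C/2) twice, which after squaring gives the constant e^(-2C). *)
pose p Z i : M := expmx ((i%:R * (h j / 2)) *: Z).
pose P := expmx (h j *: X); pose Q := expmx (h j *: Y).
have PX Z k : expmx (h j *: Z) ^+ k = p Z k * p Z k.
  by rewrite -(expmxMn (h j *: Z) k) /p expmxD scalerA -mulrDr -splitr.
have HE : H j = N j *: (P - Q).
  by rewrite /H /h invrK -scalerBr; congr (_ *: _); rewrite opprB addrA subrK.
have XP : expmx X = P ^+ j.+1 by rewrite -expmxMn scalerA mulfV ?gt_eqF// scale1r.
have YQ : expmx Y = Q ^+ j.+1 by rewrite -expmxMn scalerA mulfV ?gt_eqF// scale1r.
rewrite XP YQ HE subrX_noncomm mxdotZr fnormZ (gtr0_norm (N0 j)) exprMn.
set D := P - Q.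
have pinv Z i : p Z i * expmx (- ((i%:R * (h j / 2)) *: Z)) = 1 by exact: expmxNr.
have pinv' Z i : expmx (- ((i%:R * (h j / 2)) *: Z)) * p Z i = 1 by exact: expmxNl.
have sandwich (u v u' v' d : M) : u' * u = 1 -> v * v' = 1 -> d = u' * (u * d * v * v').
  by move=> h1 h2; rewrite -!mulrA h2 mulr1 mulrA h1 mul1r.
have psym Z i : symmx Z -> (p Z i)^T = p Z i.
  by move=> sZ; apply: symmx_exp; exact: symmxZ.
have pnorm Z i : (i <= j)%N -> fnorm Z <= C ->
    expR (fnorm (- ((i%:R * (h j / 2)) *: Z))) <= expR (C / 2).
  move=> ij ZC; rewrite ler_expR fnormN fnormZ ger0_norm; last first.
    by rewrite mulr_ge0// divr_ge0// ltW.
  rewrite mulrA mulrAC ler_pM2r// (le_trans _ ZC)// ler_piMl ?fnorm_ge0//.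
  by rewrite ler_pdivrMr// mul1r ler_nat ltnW.
have term i : (i <= j)%N ->
    expR (- (2 * C)) * fnorm D ^+ 2 <= mxdot (P ^+ i * D * Q ^+ (j.+1 - i.+1)) D.
  move=> ij; rewrite !PX subSS.
  have -> : mxdot (p X i * p X i * D * (p Y (j - i)%N * p Y (j - i)%N)) D =
      fnorm (p X i * D * p Y (j - i)%N) ^+ 2.
    rewrite fnorm_sqr !mulrA mxdot_mulR psym// -!mulrA mxdot_mulL psym//.
  set E := p X i * D * _.
  have DE : fnorm D <= expR (C / 2) * (expR (C / 2) * fnorm E).
    have -> : D = expmx (- ((i%:R * (h j / 2)) *: X)) * (E * expmx (- (((j - i)%N%:R * (h j / 2)) *: Y))).
      exact: sandwich (pinv' X i) (pinv Y (j - i)%N).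
    apply: (le_trans (fnorm_expmxM _ _)); apply: ler_pM; rewrite ?fnorm_ge0 ?expR_ge0//.
      exact: pnorm.
    apply: (le_trans (fnorm_expmxMr _ _)); rewrite ler_wpM2r ?fnorm_ge0//.
    by apply: pnorm => //; exact: leq_subr.
  rewrite mulrA -expRD -splitr in DE.
  rewrite expRN ler_pdivrMl ?expR_gt0//.
  have -> : 2 * C = C + C by ring.
  rewrite expRD -expr2 -exprMn ler_pXn2r ?nnegrE ?mulr_ge0 ?expR_ge0 ?fnorm_ge0//.
have msum (I : Type) (r : seq I) (f : I -> M) Z :
    mxdot (\sum_(i <- r) f i) Z = \sum_(i <- r) mxdot (f i) Z.
  elim/big_rec2: _ => [|i x W _ <-]; first by rewrite mxdotC /mxdot mulr0 mxtrace0.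
  by rewrite mxdotDl.
rewrite msum.
apply: (@le_trans _ _ (N j * \sum_(i < j.+1) (expR (- (2 * C)) * fnorm D ^+ 2))).
  by rewrite sumr_const card_ord -mulr_natl -/(N j) le_eqVlt; apply/orP; left; apply/eqP; ring.
rewrite ler_wpM2l ?(ltW (N0 _))//; apply: ler_sum => i _; apply: term.
by rewrite -ltnS.
Qed.

End SymmetricExponential.

(** * Polar decomposition *)

Section LinearContinuity.
Context {R : realType} {n : nat}.
Local Notation M := 'M[R]_n.+1.

Lemma linear_mx_continuous (f : M -> M) : linear f -> continuous f.
Proof.
move=> lf.
pose f' := GRing.isLinear.Build R M M *:%R f lf.
pose F : {linear M -> M} := HB.pack f f'.
have fE X : f X = \sum_i \sum_j X i j *: f (delta_mx i j).
  rewrite [in LHS](matrix_sum_delta X) -[f]/(F : M -> M) linear_sum /=.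
  apply: eq_bigr => i _; rewrite -[LHS]/(F _) linear_sum; apply: eq_bigr => j _.
  by rewrite linearZ.
move=> X; suff : (fun Y => f Y) @ nbhs X --> f X by [].
apply: cvg_mx_entries => k l; rewrite fE summxE.
under eq_fun do rewrite fE summxE.
apply: cvg_bigsum => i _; rewrite summxE; under eq_fun do rewrite summxE.
apply: cvg_bigsum => j _; rewrite mxE; under eq_fun do rewrite mxE.
by apply: cvgM; [exact: coord_continuous|exact: cvg_cst].
Qed.

(** V is the zero set of X - [projv V X], which is linear in X and hence continuous. *)
Lemma vspace_closed (V : {vspace M}) : closed [set X : M | X \in V].
Proof.
have -> : [set X : M | X \in V] = (fun X => X - projv V X) @^-1` [set 0].
  apply/seteqP; split => X /=; first by move=> XV; rewrite projv_id// subrr.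
  by move/eqP; rewrite subr_eq0 => /eqP ->; exact: memv_proj.
apply: closed_comp.
  move=> X _; suff : (fun Y : M => Y - projv V Y) @ nbhs X --> X - projv V X by [].
  apply: cvgB; first exact: cvg_id.
  by apply: linear_mx_continuous => a u v; rewrite linearP.
exact: (@accessible_closed_set1 M (hausdorff_accessible (@norm_hausdorff R M))).
Qed.

Lemma fnorm_continuous : continuous (fnorm : M -> R).
Proof.
move=> X; suff : (fun Y : M => fnorm Y) @ nbhs X --> fnorm X by [].
by apply: cvg_fnorm; exact: cvg_id.
Qed.

Lemma vspace_ball_compact (V : {vspace M}) (C : R) (Y : M) :
  compact [set X : M | X \in V /\ fnorm (X - Y) <= C].
Proof.
apply: (@mx_bounded_closed_compact _ _ _ (C + fnorm Y)).
  move=> X [_ XC]; rewrite -[X](subrK Y) (le_trans (ler_fnormD _ _))//.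
  by rewrite lerD2r.
have -> : [set X : M | X \in V /\ fnorm (X - Y) <= C] =
    [set X : M | X \in V] `&` (fun X => fnorm (X - Y)) @^-1` [set r | r <= C] by [].
apply: closedI; first exact: vspace_closed.
apply: closed_comp; last exact: closed_le.
move=> X _; suff : (fun Z : M => fnorm (Z - Y)) @ nbhs X --> fnorm (X - Y) by [].
by apply: cvg_fnorm; apply: cvgB; [exact: cvg_id|exact: cvg_cst].
Qed.

Lemma fnorm_nbhsP (X : M) (P : set M) :
  nbhs X P <-> exists2 e : R, 0 < e & forall Y, fnorm (Y - X) < e -> P Y.
Proof.
split.
  move=> /nbhs_ballP[e /= e0 eP]; exists e => // Y YX; apply: eP.
  by rewrite -ball_normE /= distrC (le_lt_trans (ler_normr_fnorm _)).
move=> [e e0 eP].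
have h : (fun Y : M => fnorm (Y - X)) @ nbhs X --> 0.
  rewrite -(@fnorm0 R n) -(subrr X); apply: cvg_fnorm.
  by apply: cvgB; [exact: cvg_id|exact: cvg_cst].
have /cvgrPdist_lt/(_ _ e0) := h; apply: filterS => Y.
by rewrite sub0r normrN ger0_norm ?fnorm_ge0//; exact: eP.
Qed.

End LinearContinuity.

(** * Polar decomposition of conjugates of elements of K, with two-sided bounds *)

Section Polar.
Context {R : realType} {n : nat}.
Local Notation M := 'M[R]_n.+1.
Variables (G : set M) (g : {vspace M}).
Hypotheses (hG : linear_reductive G) (hg : is_lie_algebra G g).
Local Notation K := (maximal_compact G).
Local Notation p := (cartan_p g).
Implicit Types X Y Z W k w z u : M.

Lemma G_sub : matrix_subgroup G. Proof. by case: hG. Qed.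
Lemma G_unit X : G X -> X \is a GRing.unit. Proof. by case: G_sub => + _ _ _; exact. Qed.
Lemma G_1 : G 1. Proof. by case: G_sub. Qed.
Lemma G_mul X Y : G X -> G Y -> G (X * Y). Proof. by case: G_sub => _ _ + _; exact. Qed.
Lemma G_inv X : G X -> G X^-1. Proof. by case: G_sub => _ _ _; exact. Qed.
Lemma G_tr X : G X -> G X^T. Proof. by case: hG => _ _ _; exact. Qed.
Lemma G_pow X (k : nat) : G X -> G (X ^+ k).
Proof. by move=> GX; elim: k => [|k IH]; rewrite ?expr0 ?exprS; [exact: G_1|exact: G_mul]. Qed.

Lemma g_exp X (s : R) : X \in g -> G (expmx (s *: X)).
Proof. by move=> Xg; exact: ((hg X).1 Xg). Qed.

Lemma g_exp1 X : X \in g -> G (expmx X).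
Proof. by move=> Xg; rewrite -[X]scale1r; exact: g_exp. Qed.

Lemma g_tr X : X \in g -> X^T \in g.
Proof.
move=> Xg; apply/hg => s; rewrite (_ : s *: X^T = (s *: X)^T).
  by rewrite -expmxT; apply: G_tr; exact: g_exp.
by rewrite linearZ.
Qed.

(** The set in the definition of p is a linear subspace, so [subspace_of] does not take its default
    value 0. *)
Lemma cartan_pP X : X \in p <-> X \in g /\ symmx X.
Proof.
apply: subspace_ofP; first by rewrite /= mem0v trmx0.
move=> c A B [Ag sA] [Bg sB]; split; first by rewrite memvD// memvZ.
by rewrite linearP /= sA sB.
Qed.

Lemma p_sym X : X \in p -> symmx X. Proof. by move=> /cartan_pP[]. Qed.
Lemma p_g X : X \in p -> X \in g. Proof. by move=> /cartan_pP[]. Qed.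

Lemma K_G k : K k -> G k. Proof. by case. Qed.
Lemma K_trl k : K k -> k^T * k = 1. Proof. by case. Qed.
Lemma K_unit k : K k -> k \is a GRing.unit. Proof. by move=> /K_G /G_unit. Qed.
Lemma K_inv k : K k -> k^-1 = k^T.
Proof.
by move=> Kk; apply: (mulIr (K_unit Kk)); rewrite mulVr ?K_unit// K_trl.
Qed.
Lemma K_trr k : K k -> k * k^T = 1.
Proof. by move=> Kk; rewrite -K_inv// divrr// K_unit. Qed.
Lemma K_mul k z : K k -> K z -> K (k * z).
Proof.
move=> Kk Kz; split; first by apply: G_mul; exact: K_G.
by rewrite trmxM mulrA -(mulrA _ k^T) K_trl// mulr1 K_trl.
Qed.
Lemma K_tr k : K k -> K k^T.
Proof. by move=> Kk; split; [apply: G_tr; exact: K_G|rewrite trmxK K_trr]. Qed.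

Lemma K_Ad k X : K k -> Ad k X = k * X * k^T.
Proof. by move=> Kk; rewrite /Ad K_inv. Qed.

Lemma K_conj k z : K k -> K z -> K (k * z * k^T).
Proof. by move=> Kk Kz; apply: K_mul; [exact: K_mul|exact: K_tr]. Qed.

Lemma exp_conjK k X : K k -> expmx (k * X * k^T) = k * expmx X * k^T.
Proof. by move=> Kk; rewrite -(K_inv Kk) expmx_conj// K_unit. Qed.

Lemma p_conj k X : K k -> X \in p -> k * X * k^T \in p.
Proof.
move=> Kk /cartan_pP[Xg sX]; apply/cartan_pP; split.
  apply/hg => s; rewrite (_ : s *: _ = k * (s *: X) * k^T).
    rewrite exp_conjK//; apply: G_mul; last by apply: K_G; exact: K_tr.
    by apply: G_mul; [exact: K_G|exact: g_exp].
  by rewrite -scalerAr -scalerAl.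
by rewrite -[X in symmx (X * _ * _)]trmxK; exact: symmx_cong.
Qed.

Lemma p_conjT k X : K k -> X \in p -> k^T * X * k \in p.
Proof. by move=> Kk Xp; have := p_conj (K_tr Kk) Xp; rewrite trmxK. Qed.

Lemma fnorm_orthl k X : k^T * k = 1 -> fnorm (k * X) = fnorm X.
Proof.
move=> kk; rewrite /fnorm; congr Num.sqrt.
by rewrite mxdot_mulL mulrA kk mul1r.
Qed.

Lemma fnorm_orthr k X : k * k^T = 1 -> fnorm (X * k) = fnorm X.
Proof.
move=> kk; rewrite /fnorm; congr Num.sqrt.
by rewrite mxdot_mulR -mulrA kk mulr1.
Qed.

Lemma fnorm_conjK k X : K k -> fnorm (k * X * k^T) = fnorm X.
Proof.
by move=> Kk; rewrite fnorm_orthr ?trmxK ?K_trl// fnorm_orthl// K_trl.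
Qed.

(** G is closed only relative to the invertible matrices, hence the invertibility of X. *)
Lemma G_closed_at X : X \is a GRing.unit -> ~ G X ->
  exists2 e : R, 0 < e & forall Y, fnorm (Y - X) < e -> ~ G Y.
Proof.
move=> uX nX.
have : ~ closure G X by case: hG => _ clG _ _ cX; apply: nX; exact: clG.
rewrite /closure /= => /existsNP[B /not_implyP[/fnorm_nbhsP[e e0 eB] nGB]].
exists e => // Y YX GY; apply: nGB; exists Y; split => //; exact: eB.
Qed.

(** Euler's approximation with a perturbed direction. In the telescoping sum for (1 + d Z')^m -
    (e^(dZ))^m the outer powers contribute at most e^(3md), and one step has the error d (|Z' - Z| +
    O(d)). *)
Lemma pow_exp_close Z Z' (d : R) m : 0 < d -> fnorm Z <= 1 -> fnorm Z' <= 2 -> d <= 2^-1 ->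
  fnorm ((1 + d *: Z') ^+ m - expmx ((m%:R * d) *: Z)) <=
  expR (3 * (m%:R * d)) * (m%:R * d) * (fnorm (Z' - Z) + 2 * fnorm (1 : M) * d).
Proof.
move=> d0 Z1 Z2 d1.
pose P := 1 + d *: Z'; pose Q := expmx (d *: Z).
have -> : expmx ((m%:R * d) *: Z) = Q ^+ m by rewrite -(expmxMn (d *: Z)) scalerA.
have Pop W i : fnorm (P ^+ i * W) <= expR (2 * d) ^+ i * fnorm W.
  elim: i => [|i IH]; first by rewrite !expr0 !mul1r.
  rewrite exprS -mulrA; set W' := P ^+ i * W in IH *.
  apply: (@le_trans _ _ (expR (2 * d) * fnorm W')); last first.
    by rewrite exprS -mulrA; apply: ler_wpM2l => //; exact: expR_ge0.
  rewrite /P mulrDl mul1r (le_trans (ler_fnormD _ _))//.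
  apply: (@le_trans _ _ ((1 + 2 * d) * fnorm W')); last first.
    by apply: ler_wpM2r; [exact: fnorm_ge0|exact: expR_ge1Dx].
  rewrite [leRHS]mulrDl mul1r lerD2l (le_trans (fnormM _ _))//.
  apply: ler_wpM2r; first exact: fnorm_ge0.
  by rewrite fnormZ gtr0_norm// mulrC ler_pM2r.
have Qop W i : fnorm (W * Q ^+ i) <= expR d ^+ i * fnorm W.
  elim: i => [|i IH]; first by rewrite !expr0 mulr1 mul1r.
  rewrite exprSr mulrA; apply: (le_trans (fnorm_expmxMr _ _)).
  rewrite exprS -mulrA; apply: ler_pM; rewrite ?expR_ge0 ?fnorm_ge0// ler_expR.
  by rewrite fnormZ gtr0_norm// ler_piMr// ltW.
have PQ : fnorm (P - Q) <= d * (fnorm (Z' - Z) + 2 * fnorm (1 : M) * d).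
  have -> : P - Q = d *: (Z' - Z) - (Q - 1 - d *: Z).
    rewrite scalerBr !opprD !opprK (addrC (- Q + 1)) addrA subrK (addrC (- Q)) addrA.
    by rewrite (addrC _ 1).
  rewrite (le_trans (ler_fnormD _ _))// fnormN fnormZ gtr0_norm// mulrDr lerD2l.
  have dZ : fnorm (d *: Z) <= d by rewrite fnormZ gtr0_norm// ler_piMr// ltW.
  apply: (le_trans (fnorm_expmx_sub1_le (le_trans dZ d1))).
  rewrite [leRHS]mulrCA; apply: ler_wpM2l; first by rewrite mulr_ge0// fnorm_ge0.
  by rewrite -expr2 ler_pXn2r ?nnegrE ?fnorm_ge0// ltW.
rewrite -/P subrX_noncomm (le_trans (ler_fnorm_sum _ _ _))//.
apply: (@le_trans _ _ (\sum_(i < m) expR (3 * (m%:R * d)) * (d * (fnorm (Z' - Z) + 2 * fnorm (1 : M) * d)))).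
  apply: ler_sum => i _; apply: (le_trans (Qop _ _)).
  apply: (@le_trans _ _ (expR d ^+ (m - i.+1) * (expR (2 * d) ^+ i * fnorm (P - Q)))).
    by apply: ler_wpM2l; [rewrite exprn_ge0// expR_ge0|exact: Pop].
  rewrite mulrA; apply: ler_pM => //; rewrite ?mulr_ge0 ?exprn_ge0 ?expR_ge0 ?fnorm_ge0//.
  rewrite -!expRM_natl -expRD ler_expR.
  have im : i%:R <= m%:R :> R by rewrite ler_nat ltnW.
  have mi : (m - i.+1)%:R <= m%:R :> R by rewrite ler_nat leq_subr.
  have := ler_wpM2r (ltW d0) im; have := ler_wpM2r (ltW d0) mi; lra.
by rewrite sumr_const card_ord -mulr_natl le_eqVlt; apply/orP; left; apply/eqP; ring.
Qed.

(* If elements D of G tend to 1 in the direction Z, suitable powers of D tend to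
   e^(sZ), so that Z lies in the Lie algebra of the closed group G. *)
Lemma tangent_direction (e : R) : 0 < e -> exists2 d : R, 0 < d &
  forall D, G D -> 0 < fnorm (D - 1) < d ->
    exists2 Z, Z \in g & fnorm ((fnorm (D - 1))^-1 *: (D - 1) - Z) < e.
Proof.
move=> e0.
have quarter (r : R) : 0 < r -> r / 4 + r / 2 <= r by move=> ?; lra.
(* The directions to be excluded: unit vectors at distance at least e from g. They form a compact
   set, so it suffices to treat a neighbourhood of each of them. *)
pose Q : set M := [set Z : M | fnorm Z = 1 /\ forall Y, Y \in g -> e <= fnorm (Z - Y)].
have cont Y : continuous (fun Z : M => fnorm (Z - Y)).
  move=> Z; suff : (fun W : M => fnorm (W - Y)) @ nbhs Z --> fnorm (Z - Y) by [].
  by apply: cvg_fnorm; apply: cvgB; [exact: cvg_id|exact: cvg_cst].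
have cQ : compact Q.
  apply: (@mx_bounded_closed_compact _ _ _ 1); first by move=> X [->].
  have -> : Q = (fnorm @^-1` [set 1]) `&`
     \bigcap_(Y in [set Y : M | Y \in g]) ((fun Z => fnorm (Z - Y)) @^-1` [set r | e <= r]).
    by apply/seteqP; split => [Z [Z1 ZY]|Z [Z1 ZY]]; split => //= Y; exact: ZY.
  apply: closedI.
    apply: closed_comp; first by move=> X _; exact: fnorm_continuous.
    exact: (@accessible_closed_set1 R (hausdorff_accessible (@norm_hausdorff R R))).
  apply: closed_bigI => Y _; apply: closed_comp; last exact: closed_ge.
  by move=> X _; exact: cont.
have local Z : Q Z -> \forall Z' \near Z & d \near (0 : R)^'+, ~ G (1 + d *: Z').
  move=> [Z1 ZQ].
  have nZ : ~ (Z \in g).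
    by move=> Zg; have := ZQ _ Zg; rewrite subrr fnorm0 leNgt e0.
  have [s s0 nGs] : exists2 s : R, 0 < s & ~ G (expmx (s *: Z)).
    have [s nGs] : exists s : R, ~ G (expmx (s *: Z)).
      apply: contrapT => h; apply: nZ; apply/hg => s; apply: contrapT => h'.
      by apply: h; exists s.
    have [s0|s0|s0] := ltgtP 0 s.
    - by exists s.
    - exists (- s); first by rewrite oppr_gt0.
      move=> /G_inv; rewrite expmxV -scaleNr opprK; exact: nGs.
    - by case: nGs; rewrite -s0 scale0r expmx0; exact: G_1.
  have [r r0 rG] := G_closed_at (expmx_unit (s *: Z)) nGs.
  have contexp : (fun s' : R => expmx (s' *: Z)) @ nbhs s --> expmx (s *: Z).
    apply: continuous_cvg; first exact: continuous_expmx.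
    by apply: cvgZl; exact: cvg_id.
  have r2 : 0 < r / 2 by rewrite divr_gt0.
  have /fnorm_nbhsP/contexp/nbhs_ballP[q /= q0 hq] :
    exists2 e : R, 0 < e & forall Y, fnorm (Y - expmx (s *: Z)) < e -> fnorm (Y - expmx (s *: Z)) < r / 2.
    by exists (r / 2).
  (* With m d <= s the error in [pow_exp_close] is at most C (|Z' - Z| + 2 |1| d). Each of the two
     summands is kept below r / (8 C), for a total of r / 4. *)
  pose C := expR (3 * s) * s.
  have C0 : 0 < C by rewrite mulr_gt0// expR_gt0.
  pose v := fnorm (1 : M).
  have v0 : 0 < v by rewrite lt_neqAle eq_sym fnorm_eq0 oner_eq0 fnorm_ge0.
  have r8 : 0 < r / (8 * C) by rewrite divr_gt0// mulr_gt0.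
  have d1 : 0 < Num.min (Num.min q 2^-1) (r / (8 * C) / (2 * v)).
    by rewrite !lt_min q0 invr_gt0 ltr0n/= divr_gt0// mulr_gt0.
  exists ([set Z' : M | fnorm (Z' - Z) < Num.min 1 (r / (8 * C))],
     [set d : R | 0 < d < Num.min (Num.min q 2^-1) (r / (8 * C) / (2 * v))]).
    split => /=.
      by apply/fnorm_nbhsP; exists (Num.min 1 (r / (8 * C))) => //; rewrite lt_min ltr01.
    near=> d; apply/andP; split; first by near: d; exact: nbhs_right_gt.
    by near: d; exact: nbhs_right_lt.
  move=> [Z' d] /= [+ /andP[d0]]; rewrite !lt_min => /andP[Z'1 Z'2] /andP[/andP[dq dh] dv].
  (* The number of steps of length d that fit into s; then m d differs from s by less than d, and (1
     + d Z')^m is close to e^(sZ), which has a neighbourhood disjoint from G. *)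
  move=> GZ; pose m := Num.truncn (s / d).
  have sd0 : 0 <= s / d by rewrite divr_ge0 ?ltW.
  have /andP[m1 m2] := truncn_itv sd0; rewrite -/m in m1 m2.
  rewrite ler_pdivlMr// in m1; rewrite ltr_pdivrMr// -natr1 mulrDl mul1r in m2.
  apply: (rG ((1 + d *: Z') ^+ m)); last exact: G_pow.
  have Z2 : fnorm Z' <= 2.
    rewrite -[Z'](subrK Z) (le_trans (ler_fnormD _ _))// Z1; lra.
  have h1 := pow_exp_close m d0 (_ : fnorm Z <= 1) Z2 (ltW dh).
  rewrite Z1 lexx in h1; have {}h1 := h1 isT.
  have h2 : fnorm (expmx ((m%:R * d) *: Z) - expmx (s *: Z)) < r / 2.
    by apply: hq; rewrite /ball /= ltr_norml; apply/andP; split; lra.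
  have h3 : fnorm ((1 + d *: Z') ^+ m - expmx ((m%:R * d) *: Z)) <= r / 4.
    apply: (le_trans h1); apply: (@le_trans _ _ (C * (r / (8 * C) + r / (8 * C)))); last first.
      by rewrite le_eqVlt; apply/orP; left; apply/eqP; field; rewrite gt_eqF.
    have md0 : 0 <= m%:R * d by rewrite mulr_ge0// ltW.
    apply: ler_pM.
    - by rewrite mulr_ge0// expR_ge0.
    - by rewrite addr_ge0 ?fnorm_ge0// !mulr_ge0 ?fnorm_ge0 ?ltW.
    - apply: (ler_pM (expR_ge0 _) md0 _ m1).
      by rewrite ler_expR ler_pM2l.
    - apply: lerD; first exact: ltW.
      by rewrite mulrC -ler_pdivlMr ?mulr_gt0// ltW.
  have -> : (1 + d *: Z') ^+ m - expmx (s *: Z) = ((1 + d *: Z') ^+ m - expmx ((m%:R * d) *: Z)) +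
     (expmx ((m%:R * d) *: Z) - expmx (s *: Z)) by rewrite addrA subrK.
  apply: (le_lt_trans (ler_fnormD _ _)); apply: (lt_le_trans (ler_ltD h3 h2)).
  exact: quarter.
(* Compactness of Q merges the local thresholds into one d. It is applied to D = 1 + c Z with c = |D
   - 1|. *)
have /compact_near_coveringP hcov := cQ.
have F0 : Filter ((0 : R)^'+) by exact: _.
have := hcov R ((0 : R)^'+) (fun d Z => ~ G (1 + d *: Z)) F0 local.
move=> [d /= d0 hd].
exists d => // D GD /andP[D0 Dd].
apply: contrapT => h.
set c := fnorm (D - 1) in D0 Dd h.
have := hd c; rewrite /ball /= sub0r normrN gtr0_norm// => /(_ Dd D0 (c^-1 *: (D - 1))) /=.
apply.
  split; first by rewrite fnormZ gtr0_norm ?invr_gt0// mulVf// gt_eqF.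
  by move=> Y Yg; rewrite leNgt; apply/negP => hY; apply: h; exists Y.
by rewrite scalerA mulfV ?gt_eqF// scale1r addrC subrK.
Unshelve. all: by end_near. Qed.

Lemma mxdot_symm A X : symmx A -> mxdot A X = \tr (A * X).
Proof. by rewrite /mxdot => ->. Qed.

(** The derivative of W -> tr e^W - tr (A W) at Y in the direction H is <e^Y - A, H>. Only t > 0 is
    used, so the lemma applies at a boundary point of the ball along inward directions. *)
Lemma tr_exp_min_var (A Y H : M) (e : R) : symmx A -> symmx Y -> 0 < e ->
  (forall t : R, 0 < t < e ->
     \tr (expmx Y) - \tr (A * Y) <= \tr (expmx (Y + t *: H)) - \tr (A * (Y + t *: H))) ->
  0 <= mxdot (expmx Y - A) H.
Proof.
move=> sA sY e0 hmin.
have ar (t a b d f l k : R) : d - l - t * a <= k -> l - f <= d - (f + t * b) ->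
    0 <= t * (a - b) + k by move=> *; lra.
rewrite mxdot_symm; last by apply: symmxB => //; exact: symmx_exp.
pose C := fnorm (1 : M) ^+ 2 * expR (fnorm Y) * 2 * fnorm H ^+ 2.
have C0 : 0 <= C by rewrite !mulr_ge0 ?exprn_ge0 ?fnorm_ge0 ?expR_ge0.
rewrite mulrBl raddfB /=; set x := \tr (expmx Y * H) - _.
have lim : (fun t : R => x + C * t) @ (0 : R)^'+ --> x.
  rewrite -[in X in _ --> X](addr0 x) -[in X in _ --> X](mulr0 C).
  apply: cvgD; first exact: cvg_cst.
  apply: cvgM; first exact: cvg_cst.
  exact: cvg_at_right_filter cvg_id.
apply: (ler_cvg_to (cvg_cst 0) lim).
have h1 : 0 < (2 * (fnorm H + 1))^-1.
  by rewrite invr_gt0 mulr_gt0// ltr_wpDl// fnorm_ge0.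
near=> t.
have t0 : 0 < t by near: t; exact: nbhs_right_gt.
have te : t < e by near: t; exact: nbhs_right_lt.
have tH : t < (2 * (fnorm H + 1))^-1 by near: t; exact: nbhs_right_lt.
have tH2 : fnorm (t *: H) <= 2^-1.
  rewrite fnormZ gtr0_norm// (@le_trans _ _ (t * (fnorm H + 1)))//.
    by rewrite ler_wpM2l ?(ltW t0)// lerDl.
  rewrite -ler_pdivlMr ?ltr_wpDl ?fnorm_ge0// ltW// (lt_le_trans tH)//.
  by rewrite invfM.
have := hmin t; rewrite t0 te => /(_ isT).
have := tr_expmx_taylor_le Y tH2; rewrite ler_norml => /andP[_].
rewrite (mulrDr A) mxtraceD -(scalerAr t A H) -(scalerAr t (expmx Y) H) !mxtraceZ (fnormZ t H) (gtr0_norm t0).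
rewrite (exprMn _ t) => h2 h3.
rewrite -(ler_pM2l t0) mulr0 mulrDr.
rewrite (_ : t * (C * t) = fnorm (1 : M) ^+ 2 * expR (fnorm Y) * 2 * (t ^+ 2 * fnorm H ^+ 2)).
  exact: ar h2 h3.
by rewrite /C; ring.
Unshelve. all: by end_near. Qed.

(* A minimiser Y' of tr e^W - tr (A W) over W in p near Y makes e^Y' - A
   orthogonal to p.  If D = e^(-Y'/2) A e^(-Y'/2) were not 1, then
   Z = (D - 1) / |D - 1| would be close to p by tangent_direction, hence
   <e^(Y'/2) Z e^(Y'/2), Z> small, which it is not. *)
Lemma polar_open Y : Y \in p -> exists2 r : R, 0 < r &
  forall A, G A -> symmx A -> fnorm (A - expmx Y) < r -> exists2 Y', Y' \in p & A = expmx Y'.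
Proof.
move=> Yp; have sY := p_sym Yp.
pose C := fnorm Y + 1.
have C0 : 0 < C by rewrite ltr_wpDl// fnorm_ge0.
pose c := expR (- (2 * C)).
have c0 : 0 < c by exact: expR_gt0.
(* Chosen for the final contradiction, where the estimates combine to 1 <= e^(2C) e = 1/2. *)
pose e := expR (- (2 * C)) / 2.
have e0 : 0 < e by rewrite divr_gt0// expR_gt0.
have [d d0 hd] := tangent_direction e0.
(* If A and e^Y' are both within q of e^Y, conjugation by e^(-Y'/2) costs at most e^C, so |D - 1| <
   e^C 2q = d. *)
pose q := d * expR (- C) / 2.
have q0 : 0 < q by rewrite divr_gt0// mulr_gt0// expR_gt0.
have [a a0 ha] : exists2 a : R, 0 < a & forall Y', fnorm (Y' - Y) < a -> fnorm (expmx Y' - expmx Y) < q.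
  have : nbhs (expmx Y) [set W | fnorm (W - expmx Y) < q] by apply/fnorm_nbhsP; exists q.
  by move=> /(@continuous_expmx R n Y) /fnorm_nbhsP.
(* The bound q serves |D - 1| < d; the bounds c a and c will give |Y' - Y| < a and |Y' - Y| < 1. *)
exists (Num.min q (Num.min (c * a) c)).
  by rewrite !lt_min q0 mulr_gt0.
move=> A GA sA; rewrite !lt_min => /and3P[Aq Aca Ac].
pose B : set M := [set X : M | X \in p /\ fnorm (X - Y) <= 1].
have cB : compact B by exact: vspace_ball_compact.
have BY : B Y by split => //; rewrite subrr fnorm0.
have [Y' /set_mem [Y'p Y'1] Y'min] : exists2 Y', Y' \in B & forall W, W \in B ->
    \tr (expmx Y') - \tr (A * Y') <= \tr (expmx W) - \tr (A * W).
  apply: (@compact_EVT_min _ R (fun W : M => \tr (expmx W) - \tr (A * W)) B _ cB).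
    by exists Y.
  apply: continuous_subspaceT => W.
  suff : (fun W : M => \tr (expmx W) - \tr (A * W)) @ nbhs W --> \tr (expmx W) - \tr (A * W) by [].
  apply: cvgB; apply: cvg_mxtrace; first exact: continuous_expmx.
  by apply: cvg_mulmx; [exact: cvg_cst|exact: cvg_id].
have sY' := p_sym Y'p.
have Y'C : fnorm Y' <= C.
  by rewrite -[Y'](subrK Y) (le_trans (ler_fnormD _ _))// addrC lerD2l.
have YC : fnorm Y <= C by rewrite lerDl.
(* The minimiser is interior. Varying it towards Y gives <e^Y' - A, Y - Y'> >= 0, and strong
   monotonicity of exp turns this into c |Y' - Y| <= |A - e^Y|. *)
have near : fnorm (Y' - Y) < 1 /\ fnorm (Y' - Y) < a.
  have [->|YY'] := eqVneq Y' Y; first by rewrite subrr fnorm0.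
  have y0 : 0 < fnorm (Y' - Y).
    by rewrite lt_neqAle eq_sym fnorm_eq0 subr_eq0 YY' fnorm_ge0.
  have h1 : 0 <= mxdot (expmx Y' - A) (Y - Y').
    apply: (@tr_exp_min_var _ _ _ 1 sA sY') => // t /andP[t0 t1].
    apply: Y'min; apply/mem_set; split; first by rewrite memvD// memvZ// memvB.
    have -> : Y' + t *: (Y - Y') - Y = (1 - t) *: (Y' - Y).
      by rewrite scalerBl scale1r -(opprB Y' Y) scalerN addrAC.
    rewrite fnormZ gtr0_norm ?subr_gt0//; apply: mulr_ile1; rewrite ?fnorm_ge0//.
      by rewrite subr_ge0 ltW.
    by rewrite gerBl ltW.
  have h2 := expmx_strong_mono sY' sY Y'C YC.
  have h3 : c * fnorm (Y' - Y) ^+ 2 <= fnorm (A - expmx Y) * fnorm (Y' - Y).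
    apply: le_trans (mxdot_CS _ _).
    move: h1 h2; rewrite -/c -(opprB Y' Y) mxdotNr oppr_ge0 !mxdotBl subr_le0 => uv h2.
    by apply: (le_trans h2); rewrite lerD2r.
  have h4 : c * fnorm (Y' - Y) <= fnorm (A - expmx Y).
    by rewrite -(ler_pM2r y0) -mulrA -expr2.
  split; rewrite -(ltr_pM2l c0) (le_lt_trans h4)//.
  by rewrite mulr1.
have orth W : W \in p -> mxdot (expmx Y' - A) W = 0.
  have half W' : W' \in p -> 0 <= mxdot (expmx Y' - A) W'.
    move=> W'p.
    have w0 : 0 < fnorm W' + 1 by rewrite ltr_wpDl// fnorm_ge0.
    have b0 : 0 < (1 - fnorm (Y' - Y)) / (fnorm W' + 1).
      by rewrite divr_gt0// subr_gt0; case: near.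
    apply: (tr_exp_min_var sA sY' b0) => t /andP[t0 t1].
    apply: Y'min; apply/mem_set; split; first by rewrite memvD// memvZ.
    rewrite addrAC (le_trans (ler_fnormD _ _))// fnormZ gtr0_norm//.
    rewrite ltr_pdivlMr// in t1.
    rewrite -lerBrDl (le_trans _ (ltW t1))// ler_wpM2l ?(ltW t0)// lerDl//.
  move=> Wp; apply/eqP; rewrite eq_le half// andbT.
  have := half (- W); rewrite memvN mxdotNr oppr_ge0; exact.
pose S := expmx (2^-1 *: Y').
pose S' := expmx (- (2^-1 *: Y')).
have SS : S * S = expmx Y' by exact: expmx_half.
have S'S : S' * S = 1 by exact: expmxNl.
have SS' : S * S' = 1 by exact: expmxNr.
have sS : symmx S by apply: symmx_exp; exact: symmxZ.
have sS' : symmx S' by apply: symmx_exp; apply: symmxN; exact: symmxZ.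
pose D := S' * A * S'.
have DE : D - 1 = S' * (A - expmx Y') * S'.
  rewrite mulrBr mulrBl -/D; congr (_ - _).
  by rewrite -SS mulrA S'S mul1r SS'.
have AE : A - expmx Y' = S * (D - 1) * S.
  rewrite DE -!mulrA S'S mulr1 !mulrA SS' mul1r //.
have [D1|D1] := eqVneq D 1.
  exists Y' => //; apply/eqP; rewrite -subr_eq0 AE D1 subrr mulr0 mul0r.
  by [].
have GD : G D.
  have GS' : G S' by apply: g_exp1; rewrite memvN memvZ// p_g.
  by apply: G_mul => //; exact: G_mul.
have sD : symmx (D - 1).
  by apply: symmxB; [rewrite /D -{1}sS'; exact: symmx_cong|rewrite /symmx /= trmx1].
have f0 : 0 < fnorm (D - 1) by rewrite lt_neqAle eq_sym fnorm_eq0 subr_eq0 D1 fnorm_ge0.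
have halfC : fnorm (2^-1 *: Y') <= C / 2.
  by rewrite fnormZ ger0_norm// mulrC ler_pM2r.
have fd : fnorm (D - 1) < d.
  rewrite DE; apply: (le_lt_trans (fnorm_expmxMr _ _)).
  have hS : expR (fnorm (- (2^-1 *: Y'))) <= expR (C / 2) by rewrite ler_expR fnormN.
  have h1 : fnorm (S' * (A - expmx Y')) <= expR (C / 2) * fnorm (A - expmx Y').
    by apply: (le_trans (fnorm_expmxM _ _)); rewrite ler_wpM2r// fnorm_ge0.
  have h2 : fnorm (A - expmx Y') < q + q.
    have -> : A - expmx Y' = (A - expmx Y) - (expmx Y' - expmx Y).
      by rewrite opprB addrA subrK.
    rewrite (le_lt_trans (ler_fnormD _ _))// fnormN ltrD//; apply: ha.
    by case: near.
  apply: (@le_lt_trans _ _ (expR (C / 2) * (expR (C / 2) * fnorm (A - expmx Y')))).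
    by apply: ler_pM => //; rewrite ?expR_ge0 ?fnorm_ge0.
  rewrite mulrA -expRD -splitr.
  have -> : d = expR C * (q + q).
    by rewrite /q -splitr mulrCA expRxMexpNx_1 mulr1.
  by rewrite ltr_pM2l// expR_gt0.
have [] := hd D GD; first by rewrite f0 fd.
move=> Z0 Z0g; set Z := (fnorm (D - 1))^-1 *: (D - 1) => hZ.
have Z1 : fnorm Z = 1 by rewrite fnormZ gtr0_norm ?invr_gt0// mulVf// gt_eqF.
have sZ : symmx Z by exact: symmxZ.
(* The symmetric part of Z0 lies in p and is as close to Z as Z0 is, because Z is symmetric. *)
pose W := 2^-1 *: (Z0 + Z0^T).
have Wp : W \in p.
  apply/cartan_pP; split; first by rewrite memvZ// memvD// g_tr.
  by apply: symmxZ; rewrite /symmx /= linearD /= trmxK addrC.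
have ZW : fnorm (Z - W) <= e.
  have -> : Z - W = 2^-1 *: ((Z - Z0) + (Z - Z0)^T).
    rewrite linearB /= sZ /W -[in LHS](scale1r Z) {1}(splitr 1) mul1r scalerDl -scalerDr -scalerBr.
    by rewrite opprD addrACA.
  rewrite fnormZ ger0_norm// mulrC ler_pdivrMr// (le_trans (ler_fnormD _ _))//.
  by rewrite fnormT mulr2n mulrDr mulr1 lerD// ltW.
have h1 : mxdot (S * Z * S) W = 0.
  have -> : S * Z * S = (fnorm (D - 1))^-1 *: (- (expmx Y' - A)).
    by rewrite opprB AE /Z -scalerAr -scalerAl.
  by rewrite mxdotZl mxdotNl orth// oppr0 mulr0.
have h2 : mxdot (S * Z * S) Z <= expR C * e.
  have -> : mxdot (S * Z * S) Z = mxdot (S * Z * S) (Z - W) by rewrite mxdotBr h1 subr0.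
  apply: (le_trans (mxdot_CS _ _)); apply: ler_pM; rewrite ?fnorm_ge0//.
  have hS : expR (fnorm (2^-1 *: Y')) <= expR (C / 2) by rewrite ler_expR.
  rewrite (splitr C) expRD; apply: (le_trans (fnorm_expmxMr _ _)).
  apply: ler_pM; rewrite ?expR_ge0 ?fnorm_ge0//.
  by apply: (le_trans (fnorm_expmxM _ _)); rewrite Z1 mulr1.
(* With S = s s one has <S Z S, Z> = |s Z s|^2, which is at least e^(-C) since |Z| = 1, whereas
   orthogonality to W makes it at most e^C e. *)
pose s := expmx (2^-1 *: (2^-1 *: Y')).
pose s' := expmx (- (2^-1 *: (2^-1 *: Y'))).
have ss : s * s = S by exact: expmx_half.
have symm_s : symmx s by apply: symmx_exp; do 2 apply: symmxZ.
have h3 : mxdot (S * Z * S) Z = fnorm (s * Z * s) ^+ 2.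
  by rewrite -ss fnorm_sqr !mulrA mxdot_mulR symm_s -!mulrA mxdot_mulL symm_s.
have h4 : 1 <= expR (C / 2) * fnorm (s * Z * s).
  have ZE : Z = s' * (s * Z * s * s').
    by rewrite -!mulrA expmxNr mulr1 mulrA expmxNl mul1r.
  suff : fnorm Z <= expR (C / 2) * fnorm (s * Z * s) by rewrite Z1.
  rewrite {1}ZE.
  have hs : expR (fnorm (- (2^-1 *: (2^-1 *: Y')))) <= expR (C / 2 / 2).
    by rewrite ler_expR fnormN fnormZ ger0_norm// mulrC ler_pM2r.
  apply: (le_trans (fnorm_expmxM _ _)).
  rewrite (splitr (C / 2)) expRD -[leRHS]mulrA; apply: ler_pM; rewrite ?expR_ge0 ?fnorm_ge0//.
  by apply: (le_trans (fnorm_expmxMr _ _)); rewrite ler_wpM2r ?fnorm_ge0.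
have h5 : 1 <= expR C * fnorm (s * Z * s) ^+ 2.
  rewrite {1}(splitr C) expRD -expr2 -exprMn -[leLHS](expr1n _ 2).
  by rewrite ler_pXn2r// ?nnegrE ?mulr_ge0 ?expR_ge0 ?fnorm_ge0.
rewrite -h3 in h5.
have h6 : 1 <= expR C * (expR C * e).
  by apply: (le_trans h5); rewrite ler_wpM2l// expR_ge0.
exfalso; move: h6; rewrite /e mulrA -expRD mulrA.
have -> : C + C = 2 * C by ring.
by rewrite expRxMexpNx_1 mul1r leNgt invf_lt1// ltr1n.
Qed.

(** Up to the orthogonal factor z the conjugate is a product of two exponentials of symmetric
    matrices, the form in which [exp_op_le] applies. *)
Lemma exp_conj_trl z w : K z -> expmx w * z * expmx (- w) =
  z * (expmx (z^T * w * z) * expmx (- w)).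
Proof.
move=> Kz; have := exp_conjK w (K_tr Kz); rewrite trmxK => ->.
by rewrite !mulrA K_trr// mul1r.
Qed.

Lemma cartan_conj z w : K z -> w \in p ->
  exists k u, [/\ K k, u \in p & expmx w * z * expmx (- w) = k * expmx u].
Proof.
move=> Kz wp.
pose w' := z^T * w * z.
have w'p : w' \in p by exact: p_conjT.
(* A path of symmetric elements of G from A 0 = 1 to A 1, the Gram matrix of e^w z e^(-w). If A 1 =
   e^Y, the radial part is Y / 2. *)
pose A (s : R) : M := expmx ((- s) *: w) * expmx ((2 * s) *: w') * expmx ((- s) *: w).
have GA s : G (A s) by apply: G_mul; [apply: G_mul|]; apply: g_exp; exact: p_g.
have sA s : symmx (A s).
  rewrite /A -{1}(symmx_exp (symmxZ (- s) (p_sym wp))).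
  by apply: symmx_cong; apply: symmx_exp; apply: symmxZ; exact: p_sym.
have contA : continuous A.
  move=> s; suff : A r @[r --> s] --> A s by [].
  have cE (h : R -> R) (X : M) : h r @[r --> s] --> h s ->
      expmx (h r *: X) @[r --> s] --> expmx (h s *: X).
    by move=> hs; apply: continuous_cvg; [exact: continuous_expmx|apply: cvgZl].
  have cN : (- r) @[r --> s] --> - s by apply: cvgN; exact: cvg_id.
  apply: cvg_mulmx; last exact: cE.
  apply: cvg_mulmx; first exact: cE.
  by apply: (cE (fun r => 2 * r)); apply: cvgM; [exact: cvg_cst|exact: cvg_id].
pose b := fnorm w + 2 * fnorm w' + fnorm w.
pose C := b * fnorm (1 : M).
(* An a priori bound, independent of s, on every logarithm in p of A s. It allows T to be replaced
   on [0, 1] by T', the preimage of a compact set. *)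
have bound s Y : 0 <= s <= 1 -> Y \in p -> A s = expmx Y -> fnorm Y <= C.
  move=> /andP[s0 s1] Yp AY; have sY := p_sym Yp.
  have e3 a1 a2 a3 (X1 X2 X3 : M) Z : fnorm X1 <= a1 -> fnorm X2 <= a2 -> fnorm X3 <= a3 ->
      fnorm (expmx X1 * expmx X2 * expmx X3 * Z) <= expR (a1 + a2 + a3) * fnorm Z.
    move=> h1 h2 h3; rewrite !expRD -!mulrA.
    have step a (X : M) : fnorm X <= a -> forall W, fnorm (expmx X * W) <= expR a * fnorm W.
      move=> Xa W; apply: (le_trans (fnorm_expmxM _ _)).
      by rewrite ler_wpM2r ?fnorm_ge0// ler_expR.
    apply: (le_trans (step _ _ h1 _)); rewrite ler_wpM2l ?expR_ge0//.
    apply: (le_trans (step _ _ h2 _)); rewrite ler_wpM2l ?expR_ge0//.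
    exact: step.
  have sc (a : R) (X : M) : `|a| <= 1 -> fnorm (a *: X) <= fnorm X.
    by move=> a1; rewrite fnormZ ler_piMl// fnorm_ge0.
  have sc2 (a : R) (X : M) : `|a| <= 2 -> fnorm (a *: X) <= 2 * fnorm X.
    by move=> a1; rewrite fnormZ ler_wpM2r// fnorm_ge0.
  have s2 : `|2 * s| <= 2 by rewrite normrM !ger0_norm// -[leRHS]mulr1 ler_pM2l.
  apply: fnorm_le_numrange => // Z; rewrite ler_norml; apply/andP; split.
    rewrite lerNl -mxdotNr -mulNr; apply: numrange_exp_le; first exact: symmxN.
    move=> W; have -> : expmx (- Y) = expmx (s *: w) * expmx ((- (2 * s)) *: w') * expmx (s *: w).
      rewrite -expmxV -AY /A; apply: (mulrI (_ : A s \is a GRing.unit)); first exact: G_unit.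
      rewrite divrr; last exact: G_unit.
      have cancel (a a' c c' : M) : a' * a = 1 -> c' * c = 1 -> a' * c' * a' * (a * c * a) = 1.
        by move=> h1 h2; rewrite -!mulrA (mulrA a' a) h1 mul1r (mulrA c') h2 mul1r h1.
      by apply/esym/cancel; rewrite expmxD ?addNr ?subrr scale0r expmx0.
    by apply: e3; [apply: sc; rewrite ger0_norm|apply: sc2; rewrite normrN|apply: sc; rewrite ger0_norm].
  apply: numrange_exp_le => // W; rewrite -AY /A.
  by apply: e3; [apply: sc; rewrite normrN ger0_norm|exact: sc2|apply: sc; rewrite normrN ger0_norm].
pose T : set R := [set s | exists2 Y, Y \in p & A s = expmx Y].
have openT : open T.
  rewrite openE => s [Y Yp AY]; have [r r0 hr] := polar_open Yp.
  have : nbhs (A s) [set B | fnorm (B - expmx Y) < r].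
    by rewrite AY; apply/fnorm_nbhsP; exists r.
  move=> /contA h; apply: (@filterS _ (nbhs s) _ _ _ _ h) => q /= Aq.
  exact: hr.
pose T' : set R := A @^-1` (expmx @` [set Y : M | Y \in p /\ fnorm (Y - 0) <= C]).
have closedT' : closed T'.
  apply: closed_comp; first by move=> s _; exact: contA.
  apply: compact_closed; first exact: norm_hausdorff.
  apply: continuous_compact; last exact: vspace_ball_compact.
  by apply: continuous_subspaceT; exact: continuous_expmx.
have TT' : `[0, 1] `&` T = `[0, 1] `&` T'.
  apply/seteqP; split => s /= [s01].
    move=> [Y Yp AY]; split => //; exists Y => //; split => //.
    by rewrite subr0; apply: (bound s) => //; rewrite in_itv in s01.
  by move=> [Y [Yp _] AY]; split => //; exists Y.
have : `[0, 1] `&` T = `[(0 : R), 1]%classic.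
  apply: segment_connected.
  - exists 0; split; first by rewrite /= in_itv /= lexx ler01.
    exists 0; first exact: mem0v.
    by rewrite /A oppr0 mulr0 !scale0r expmx0 !mulr1.
  - by exists T.
  - by exists T'.
move=> /seteqP[_ /(_ 1)] /=; rewrite in_itv /= lexx ler01 => /(_ isT)[_ [Y Yp AY]].
pose u := 2^-1 *: Y.
have up : u \in p by exact: memvZ.
pose k := expmx w * z * expmx (- w) * expmx (- u).
have Gy : G (expmx w * z * expmx (- w)).
  apply: G_mul; last by apply: g_exp1; rewrite memvN p_g.
  by apply: G_mul; [apply: g_exp1; exact: p_g|exact: K_G].
have kE : expmx w * z * expmx (- w) = k * expmx u.
  have cancel (a c d : M) : c * d = 1 -> a = a * c * d.
    by move=> h; rewrite -mulrA h mulr1.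
  exact: cancel (expmxNl u).
exists k, u; split; [|exact: up|exact: kE].
split; first by apply: G_mul; [exact: Gy|apply: g_exp1; rewrite memvN p_g].
have sx X : X \in p -> (expmx X)^T = expmx X by move=> /p_sym/symmx_exp.
have AE : A 1 = expmx (- w) * (z^T * (expmx w * expmx w) * z) * expmx (- w).
  rewrite /A scaleN1r mulr1; congr (_ * _ * _).
  have -> : expmx w * expmx w = expmx (2 *: w).
    by rewrite -{1 2}(scale1r w) expmxD.
  have := exp_conjK (2 *: w) (K_tr Kz); rewrite trmxK => <-.
  by rewrite /w' -scalerAr -scalerAl.
have -> : k^T * k = expmx (- u) * A 1 * expmx (- u).
  have gram (a c d e m : M) : a^T = a -> d^T = d -> e^T = e ->
      m = d * (c^T * (a * a) * c) * d -> (a * c * d * e)^T * (a * c * d * e) = e * m * e.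
    by move=> ha hd he ->; rewrite !trmxM ha hd he !mulrA.
  by apply: (gram _ _ _ _ _ _ _ _ AE); apply: sx; rewrite ?memvN.
have cancel (a c : M) : c * a = 1 -> a * c = 1 -> c * (a * a) * c = 1.
  by move=> h1 h2; rewrite mulrA h1 mul1r.
by rewrite AY -(expmx_half Y); exact: cancel (expmxNl u) (expmxNr u).
Qed.

(** Up to orthogonal factors e^u is e^(w') e^(-w) and e^(-u) is e^w e^(-w') with |w'| = |w|; both
    have operator norm at most e^(2|w|). *)
Lemma polar_radial_bound z w k u : K z -> w \in p -> K k -> u \in p ->
  expmx w * z * expmx (- w) = k * expmx u -> fnorm u <= 2 * fnorm w * fnorm (1 : M).
Proof.
move=> Kz wp Kk up E.
have w'w : fnorm (z^T * w * z) = fnorm w.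
  by have := fnorm_conjK w (K_tr Kz); rewrite trmxK.
have su := p_sym up.
have e2 (X1 X2 : M) Z : fnorm X1 <= fnorm w -> fnorm X2 <= fnorm w ->
    fnorm (expmx X1 * expmx X2 * Z) <= expR (2 * fnorm w) * fnorm Z.
  move=> h1 h2; rewrite mulr2n mulrDl mul1r expRD -!mulrA.
  have step (X : M) : fnorm X <= fnorm w -> forall W, fnorm (expmx X * W) <= expR (fnorm w) * fnorm W.
    move=> Xa W; apply: (le_trans (fnorm_expmxM _ _)).
    by rewrite ler_wpM2r ?fnorm_ge0// ler_expR.
  apply: (le_trans (step _ h1 _)); rewrite ler_wpM2l ?expR_ge0//.
  exact: step.
rewrite exp_conj_trl// in E; set w' := z^T * w * z in E w'w.
apply: fnorm_le_numrange => // Z; rewrite ler_norml; apply/andP; split.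
  rewrite lerNl -mxdotNr -mulNr; apply: numrange_exp_le; first exact: symmxN.
  move=> W; have -> : expmx (- u) = expmx w * expmx (- w') * (z^T * k).
    have E1 : expmx u = k^T * (z * (expmx w' * expmx (- w))).
      by rewrite E mulrA K_trl// mul1r.
    have E2 : expmx u * (expmx w * expmx (- w') * (z^T * k)) = 1.
      rewrite E1 -!mulrA (mulrA (expmx (- w))) expmxNl mul1r (mulrA (expmx w')) expmxNr mul1r.
      by rewrite (mulrA z) K_trr// mul1r K_trl.
    by apply: (mulrI (expmx_unit u)); rewrite E2 expmxNr.
  rewrite -mulrA; apply: (le_trans (e2 _ _ _ _ _)); rewrite ?fnormN ?w'w//.
  by rewrite -mulrA fnorm_orthl ?trmxK ?K_trr// fnorm_orthl// K_trl.
apply: numrange_exp_le => // W.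
have -> : fnorm (expmx u * W) = fnorm (expmx w' * expmx (- w) * W).
  have <- : fnorm (k * (expmx u * W)) = fnorm (expmx u * W) by rewrite fnorm_orthl// K_trl.
  by rewrite mulrA -E -mulrA fnorm_orthl// K_trl.
by apply: e2; rewrite ?fnormN ?w'w.
Qed.

(** Here [exp_op_le] is applied to the noncommuting pairs (w', -w) and (w, -w'), whose products of
    exponentials have the operator norms of e^u and e^(-u). The left side is what regularity bounds
    below in terms of |w|. *)
Lemma polar_displacement z w k u : K z -> w \in p -> K k -> u \in p ->
  expmx w * z * expmx (- w) = k * expmx u ->
  fnorm (z^T * w * z - w) <= fnorm u * fnorm (1 : M).
Proof.
move=> Kz wp Kk up E; rewrite exp_conj_trl// in E.
set w' := z^T * w * z in E *.
have w'p : w' \in p by exact: p_conjT.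
have [sw sw'] := (p_sym wp, p_sym w'p).
apply: fnorm_le_numrange; first exact: symmxB.
move=> Z; rewrite ler_norml; apply/andP; split.
  rewrite lerNl -mxdotNr -mulNr opprB.
  apply: exp_op_le => // [|W]; first exact: symmxN.
  have -> : expmx w * expmx (- w') = expmx (- u) * (k^T * z).
    have E1 : expmx w' * expmx (- w) = z^T * (k * expmx u).
      by rewrite -E mulrA (K_trl Kz) mul1r.
    have U : expmx w' * expmx (- w) \is a GRing.unit by rewrite unitrMl expmx_unit.
    apply: (mulrI U).
    rewrite -mulrA (mulrA (expmx (- w))) expmxNl mul1r expmxNr E1.
    by rewrite -!mulrA (mulrA (expmx u)) expmxNr mul1r (mulrA k) (K_trr Kk) mul1r (K_trl Kz).
  rewrite -mulrA (le_trans (fnorm_expmxM _ _))// fnormN.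
  by rewrite -mulrA fnorm_orthl ?trmxK ?K_trr// fnorm_orthl// K_trl.
apply: exp_op_le => // [|W]; first exact: symmxN.
have -> : fnorm (expmx w' * expmx (- w) * W) = fnorm (expmx u * W).
  have <- : fnorm (z * (expmx w' * expmx (- w) * W)) = fnorm (expmx w' * expmx (- w) * W).
    by rewrite fnorm_orthl// K_trl.
  by rewrite mulrA E -mulrA fnorm_orthl// K_trl.
exact: fnorm_expmxM.
Qed.

End Polar.

(** * Uniform properness, continuity and the limit of the polar factors as t tends to 0 *)

Section PolarFamily.
Context {R : realType} {n : nat}.
Local Notation M := 'M[R]_n.+1.
Variables (G : set M) (g : {vspace M}).
Hypotheses (hG : linear_reductive G) (hg : is_lie_algebra G g).
Local Notation K := (maximal_compact G).
Local Notation p := (cartan_p g).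
Implicit Types X Y Z W k w z u : M.

Section Regular.
Variable x : M.
Hypotheses (hxK : K x) (hx : regular_element K g x).

(** A fixed w lies in the Lie algebra of a torus in K, so e^w is orthogonal as well as symmetric;
    then e^w = e^(-w) and w = 0. *)
Lemma regular_fixed w : w \in p -> x * w * x^T = w -> w = 0.
Proof.
move=> wp xw; have sw := p_sym wp.
case: hx => T [t [[_ TK _] ht Tx inj _]].
have wt : w \in t.
  apply: inj; first exact: p_g.
  by rewrite (K_Ad hG)// xw subrr mem0v.
have /TK /(K_trl) := (ht w).1 wt 1.
have -> : (expmx (1 *: w))^T = expmx w by rewrite scale1r; exact: symmx_exp.
rewrite scale1r => h.
have : w = - w.
  apply: expmx_symm_inj => //; first exact: symmxN.
  by apply: (mulrI (expmx_unit w)); rewrite h expmxNr.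
move/eqP; rewrite -subr_eq0 opprK -mulr2n -scaler_nat scaler_eq0 pnatr_eq0 /=.
by move/eqP.
Qed.

Lemma regular_lower_bound :
  exists2 c : R, 0 < c & forall w, w \in p -> c * fnorm w <= fnorm (w - x * w * x^T).
Proof.
pose S : set M := [set w : M | w \in p /\ fnorm w = 1].
have cS : compact S.
  apply: (@mx_bounded_closed_compact _ _ _ 1); first by move=> X [_ ->].
  have -> : S = [set w : M | w \in p] `&` fnorm @^-1` [set 1] by [].
  apply: closedI; first exact: vspace_closed.
  apply: closed_comp; first by move=> X _; exact: fnorm_continuous.
  exact: (@accessible_closed_set1 R (hausdorff_accessible (@norm_hausdorff R R))).
have scal c w : w \in p -> (forall w', S w' -> c <= fnorm (w' - x * w' * x^T)) ->
    c * fnorm w <= fnorm (w - x * w * x^T).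
  move=> wp hc; have [->|w0] := eqVneq w 0; first by rewrite fnorm0 mulr0 fnorm_ge0.
  have f0 : 0 < fnorm w by rewrite lt_neqAle eq_sym fnorm_eq0 w0 fnorm_ge0.
  rewrite -ler_pdivlMr//.
  have : S ((fnorm w)^-1 *: w).
    split; first exact: memvZ.
    by rewrite fnormZ gtr0_norm ?invr_gt0// mulVf// gt_eqF.
  move=> /hc; rewrite -scalerAr -scalerAl -scalerBr fnormZ gtr0_norm ?invr_gt0//.
  by rewrite mulrC.
have [S0|S0] := pselect (S !=set0); last first.
  (* If p = 0 the unit sphere is empty and any positive constant serves. *)
  exists 1 => // w wp; apply: scal => // w' Sw'; exfalso; apply: S0.
  by exists w'.
have [w0 /set_mem [w0p w01] hmin] : exists2 c, c \in S &
    forall w, w \in S -> fnorm (c - x * c * x^T) <= fnorm (w - x * w * x^T).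
  apply: (@compact_EVT_min _ R (fun w : M => fnorm (w - x * w * x^T)) S S0 cS).
  apply: continuous_subspaceT => w.
  suff : (fun w : M => fnorm (w - x * w * x^T)) @ nbhs w --> fnorm (w - x * w * x^T) by [].
  apply: cvg_fnorm; apply: cvgB; first exact: cvg_id.
  apply: cvg_mulmx; last exact: cvg_cst.
  by apply: cvg_mulmx; [exact: cvg_cst|exact: cvg_id].
exists (fnorm (w0 - x * w0 * x^T)).
  rewrite lt_neqAle eq_sym fnorm_ge0 andbT fnorm_eq0 subr_eq0; apply/eqP => h.
  have := regular_fixed w0p (esym h) => h0.
  by move: w01; rewrite h0 fnorm0 => /eqP; rewrite eq_sym oner_eq0.
by move=> w wp; apply: scal => // w' Sw'; apply: hmin; exact/mem_set.
Qed.

(** Scaling w and u by t multiplies both sides of [polar_displacement] by t, so the constant does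
    not depend on t. Conjugating by y reduces Ad_y x to x, whence it does not depend on y either. *)
Lemma polar_proper : exists2 c : R, 0 < c & forall y w k u (t : R),
  K y -> w \in p -> K k -> u \in p -> 0 < t ->
  expmx (t *: w) * (y * x * y^T) * expmx (- (t *: w)) = k * expmx (t *: u) ->
  fnorm w <= c * fnorm u.
Proof.
have [c0 c0_gt0 hc0] := regular_lower_bound.
have v0 : 0 < fnorm (1 : M) by rewrite lt_neqAle eq_sym fnorm_eq0 oner_eq0 fnorm_ge0.
exists (fnorm (1 : M) / c0); first by rewrite divr_gt0.
move=> y w k u t Ky wp Kk up t0 E.
set z := y * x * y^T in E.
have Kz : K z by exact: (K_conj hG).
have := polar_displacement hG hg Kz (memvZ t wp) Kk (memvZ t up) E.
have -> : z^T * (t *: w) * z - t *: w = t *: (z^T * w * z - w).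
  by rewrite -scalerAr -scalerAl -scalerBr.
rewrite (fnormZ t (_ - _)) (fnormZ t u) (gtr0_norm t0) -[leRHS]mulrA (ler_pM2l t0) => h.
pose w0 := y^T * w * y.
have w0p : w0 \in p by exact: (p_conjT hG hg).
have w0w : fnorm w0 = fnorm w.
  by have := fnorm_conjK w (K_tr hG Ky); rewrite trmxK.
have e1 : fnorm (z^T * w * z - w) = fnorm (w0 - x * w0 * x^T).
  rewrite -(fnorm_conjK _ Kz) -(fnorm_conjK (w0 - _) Ky); congr fnorm.
  have ww0 : w = y * w0 * y^T.
    by rewrite /w0 !mulrA (K_trr hG)// mul1r -mulrA (K_trr hG)// mulr1.
  have conj3 (a b c d : M) : a * b = 1 -> c * d = 1 -> a * (b * w * c) * d = w.
    by move=> ab cd; rewrite !mulrA ab mul1r -mulrA cd mulr1.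
  rewrite !mulrBr !mulrBl conj3 ?(K_trr hG)//; congr (_ - _) => //.
  by rewrite /z /w0 !trmxM trmxK !mulrA.
rewrite mulrAC ler_pdivlMr// mulrC -w0w.
by apply: (le_trans (hc0 _ w0p)); rewrite -e1 mulrC.
Qed.
End Regular.

(* k e^(tu) is the polar decomposition of e^(tw) z e^(-tw); upolar and kpolar
   pick out u and k. *)
Definition polar_rel (t : R) z w u := u \in p /\ exists2 k, K k &
  expmx (t *: w) * z * expmx (- (t *: w)) = k * expmx (t *: u).

Definition upolar (t : R) z w : M := xget 0 (polar_rel t z w).

Definition kpolar (t : R) z w : M :=
  expmx (t *: w) * z * expmx (- (t *: w)) * expmx (- (t *: upolar t z w)).

Lemma upolarP (t : R) z w : 0 < t -> K z -> w \in p -> polar_rel t z w (upolar t z w).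
Proof.
move=> t0 Kz wp.
have [k [u [Kk up E]]] := cartan_conj hG hg Kz (memvZ t wp).
apply: (@xgetPex _ 0 (polar_rel t z w)).
exists (t^-1 *: u); split; first exact: memvZ.
exists k; first exact: Kk.
by rewrite E; congr (_ * expmx _); rewrite scalerA mulfV ?gt_eqF// scale1r.
Qed.

Lemma kpolarP (t : R) z w : 0 < t -> K z -> w \in p ->
  K (kpolar t z w) /\
  expmx (t *: w) * z * expmx (- (t *: w)) = kpolar t z w * expmx (t *: upolar t z w).
Proof.
move=> t0 Kz wp; have [up [k Kk E]] := upolarP t0 Kz wp.
have cancel (a c d : M) : c * d = 1 -> a * c * d = a.
  by move=> h; rewrite -mulrA h mulr1.
have -> : kpolar t z w = k by rewrite /kpolar E; apply: cancel; exact: expmxNr.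
by split.
Qed.

Lemma upolar_p (t : R) z w : 0 < t -> K z -> w \in p -> upolar t z w \in p.
Proof. by move=> t0 Kz wp; case: (upolarP t0 Kz wp). Qed.

(* The Gram matrix of e^(tw) z e^(-tw) eliminates k. *)
Lemma upolar_gram (t : R) z w : 0 < t -> K z -> w \in p ->
  expmx ((2 * t) *: upolar t z w) =
  expmx (- (t *: w)) * expmx ((2 * t) *: (z^T * w * z)) * expmx (- (t *: w)).
Proof.
move=> t0 Kz wp; have [Kk E] := kpolarP t0 Kz wp.
set k := kpolar t z w in Kk E; set u := upolar t z w in E *.
have su : symmx (t *: u) by apply: symmxZ; apply: p_sym; exact: upolar_p.
have sw : symmx (t *: w) by apply: symmxZ; exact: (p_sym wp).
have double X : expmx ((2 * t) *: X) = expmx (t *: X) * expmx (t *: X).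
  by rewrite (expmxD X t t) mulr2n mulrDl mul1r.
have -> : expmx ((2 * t) *: (z^T * w * z)) = z^T * (expmx (t *: w) * expmx (t *: w)) * z.
  have := exp_conjK hG ((2 * t) *: w) (K_tr hG Kz); rewrite trmxK -double => <-.
  by rewrite -scalerAr -scalerAl.
rewrite double.
have gram1 (a b : M) : a^T = a -> b^T * b = 1 -> a * a = (b * a)^T * (b * a).
  by move=> ha hb; rewrite trmxM ha mulrA -(mulrA a) hb mulr1.
have gram2 (a c d : M) : a^T = a -> d^T = d ->
    (a * c * d)^T * (a * c * d) = d * (c^T * (a * a) * c) * d.
  by move=> ha hd; rewrite !trmxM ha hd !mulrA.
rewrite (gram1 (expmx (t *: u)) k (symmx_exp su) (K_trl Kk)) -E.
by apply: gram2; apply: symmx_exp => //; exact: symmxN.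
Qed.

(** By [upolar_gram] the matrix e^(2tu) depends continuously on (z, w), and the symmetric logarithm
    is continuous. The pairs must stay in K x p, the domain on which [upolar] is known to satisfy
    its defining relation. *)
Lemma cvg_upolar {T : Type} {F : set_system T} {FF : Filter F} (t : R) (zf wf : T -> M) z w :
  0 < t -> K z -> w \in p -> (\forall s \near F, K (zf s) /\ wf s \in p) ->
  zf @ F --> z -> wf @ F --> w -> (fun s => upolar t (zf s) (wf s)) @ F --> upolar t z w.
Proof.
move=> t0 Kz wp Kf zfz wfw.
have transport (f : T -> M) (a b : M) : a = b -> f @ F --> a -> f @ F --> b by move=> ->.
have t2 : 2 * t != 0 by rewrite mulf_neq0// gt_eqF.
have h : (fun s => (2 * t) *: upolar t (zf s) (wf s)) @ F --> (2 * t) *: upolar t z w.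
  apply: cvg_symm_exp.
  - apply: filterS Kf => s [Ks ps]; apply: symmxZ; apply: p_sym.
    exact: upolar_p.
  - by apply: symmxZ; apply: p_sym; exact: upolar_p.
  - apply: (transport _ _ _ (esym (upolar_gram t0 Kz wp))).
    have hE : (fun s => expmx (- (t *: wf s)) * expmx ((2 * t) *: ((zf s)^T * wf s * zf s)) *
        expmx (- (t *: wf s))) @ F -->
      expmx (- (t *: w)) * expmx ((2 * t) *: (z^T * w * z)) * expmx (- (t *: w)).
      have cE (f : T -> M) X : f @ F --> X -> (fun s => expmx (f s)) @ F --> expmx X.
        exact: cvg_expmx_comp.
      have c1 : (fun s => - (t *: wf s)) @ F --> - (t *: w) by apply: cvgN; exact: cvgZr.
      apply: cvg_mulmx; last exact: cE.
      apply: cvg_mulmx; first exact: cE.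
      apply: cE; apply: cvgZr.
      exact: (cvg_mulmx (cvg_mulmx (cvg_trmx zfz) wfw) zfz).
    apply: cvg_trans hE; apply: near_eq_cvg; apply: filterS Kf => s [Ks ps].
    by rewrite (upolar_gram t0 Ks ps).
have h' : (fun s => (2 * t)^-1 *: ((2 * t) *: upolar t (zf s) (wf s))) @ F -->
    (2 * t)^-1 *: ((2 * t) *: upolar t z w) by exact: cvgZr.
have sc (X : M) : (2 * t)^-1 *: ((2 * t) *: X) = X by rewrite scalerA mulVf// scale1r.
apply: (transport _ _ _ (sc _)).
by apply: cvg_trans h'; apply: near_eq_cvg; apply: nearW => s; rewrite sc.
Qed.

Lemma cvg_kpolar {T : Type} {F : set_system T} {FF : Filter F} (t : R) (zf wf : T -> M) z w :
  0 < t -> K z -> w \in p -> (\forall s \near F, K (zf s) /\ wf s \in p) ->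
  zf @ F --> z -> wf @ F --> w -> (fun s => kpolar t (zf s) (wf s)) @ F --> kpolar t z w.
Proof.
move=> t0 Kz wp Kf zfz wfw.
have cE (f : T -> M) X : f @ F --> X -> (fun s => expmx (f s)) @ F --> expmx X.
  exact: cvg_expmx_comp.
have cu : (fun s => upolar t (zf s) (wf s)) @ F --> upolar t z w by exact: cvg_upolar.
apply: cvg_mulmx; last by apply: cE; apply: cvgN; exact: cvgZr.
apply: cvg_mulmx; last by apply: cE; apply: cvgN; exact: cvgZr.
apply: cvg_mulmx; last exact: zfz.
apply: cE; exact: cvgZr.
Qed.

Lemma upolar_bound (t : R) z w : 0 < t -> K z -> w \in p ->
  fnorm (upolar t z w) <= 2 * fnorm w * fnorm (1 : M).
Proof.
move=> t0 Kz wp; have [Kk E] := kpolarP t0 Kz wp.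
have := polar_radial_bound hG Kz (memvZ t wp) Kk (memvZ t (upolar_p t0 Kz wp)) E.
rewrite (fnormZ t (upolar _ _ _)) (fnormZ t w) (gtr0_norm t0).
have -> : 2 * (t * fnorm w) * fnorm (1 : M) = t * (2 * fnorm w * fnorm (1 : M)) by ring.
by rewrite (ler_pM2l t0).
Qed.

(** A product rule: a b a - 1 = (a - 1) b a + (b - 1) a + (a - 1). The two terms in a each carry
    half of A because of the divisor 2h. *)
Lemma cvg_aba_diff {T : Type} {F : set_system T} {FF : Filter F} (h : T -> R)
    (a b : T -> M) (A B : M) : a @ F --> (1 : M) -> b @ F --> (1 : M) ->
  (fun s => (h s)^-1 *: (a s - 1)) @ F --> A ->
  (fun s => (2 * h s)^-1 *: (b s - 1)) @ F --> B ->
  (fun s => (2 * h s)^-1 *: (a s * b s * a s - 1)) @ F --> A + B.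
Proof.
move=> a1 b1 hA hB.
have hA2 : (fun s => 2^-1 *: ((h s)^-1 *: (a s - 1))) @ F --> 2^-1 *: A by exact: cvgZr.
have l1 : (fun s => 2^-1 *: ((h s)^-1 *: (a s - 1)) * b s * a s) @ F --> 2^-1 *: A * 1 * 1.
  exact: (cvg_mulmx (cvg_mulmx hA2 b1) a1).
have l2 : (fun s => (2 * h s)^-1 *: (b s - 1) * a s) @ F --> B * 1 by exact: cvg_mulmx.
have : (fun s => 2^-1 *: ((h s)^-1 *: (a s - 1)) * b s * a s + (2 * h s)^-1 *: (b s - 1) * a s +
    2^-1 *: ((h s)^-1 *: (a s - 1))) @ F --> 2^-1 *: A * 1 * 1 + B * 1 + 2^-1 *: A.
  exact: (cvgD (cvgD l1 l2) hA2).
rewrite !mulr1 (_ : 2^-1 *: A + B + 2^-1 *: A = A + B); last first.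
  by rewrite addrAC -scalerDl -[2^-1]mul1r -splitr scale1r.
apply: cvg_trans; apply: near_eq_cvg; apply: nearW => s.
rewrite [RHS](_ : _ = (2 * h s)^-1 *: ((a s - 1) * b s * a s + (b s - 1) * a s + (a s - 1))).
  have scal (k l m : R) (D E a' b' : M) : m = k * l ->
      k *: (l *: D) * b' * a' + m *: E * a' + k *: (l *: D) = m *: (D * b' * a' + E * a' + D).
    by move=> ->; rewrite !scalerDr !scalerAl !scalerA.
  by apply: scal; rewrite invfM.
congr (_ *: _).
by rewrite !mulrBl !mul1r !addrA subrK subrK.
Qed.

(** The product rule applied to the Gram matrix gives (e^(2hu) - 1) / (2h) -> w' - w. Since u stays
    bounded by [upolar_bound], this quotient differs from u by O(h). The factor k converges because
    all exponents tend to 0. *)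
Lemma upolar_kpolar_lim {T : Type} {F : set_system T} {FF : Filter F} (h : T -> R) z w :
  K z -> w \in p -> h @ F --> 0 -> (\forall s \near F, 0 < h s) ->
  ((fun s => upolar (h s) z w) @ F --> z^T * w * z - w) /\
  ((fun s => kpolar (h s) z w) @ F --> z).
Proof.
move=> Kz wp h0 hpos.
pose C := 2 * fnorm w * fnorm (1 : M).
have hC : (fun s => C * h s) @ F --> 0.
  by rewrite -(mulr0 C); apply: cvgM => //; exact: cvg_cst.
have cE (f : T -> M) X : f @ F --> X -> (fun s => expmx (f s)) @ F --> expmx X.
  exact: cvg_expmx_comp.
have hw : (fun s => - (h s *: w)) @ F --> (0 : M).
  by rewrite -oppr0 -(scale0r w); apply: cvgN; exact: cvgZl.
have hu : (fun s => - (h s *: upolar (h s) z w)) @ F --> (0 : M).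
  apply: cvg_fnorm0; apply: (squeeze_cvgr _ (cvg_cst 0) hC).
  apply: filterS hpos => s hs; rewrite fnorm_ge0/= subr0 fnormN fnormZ gtr0_norm//.
  by rewrite mulrC ler_wpM2r ?(ltW hs)//; exact: upolar_bound.
split; last first.
  have e1 : (fun s => kpolar (h s) z w) @ F --> expmx 0 * z * expmx 0 * expmx 0.
    apply: cvg_mulmx; last exact: cE.
    apply: cvg_mulmx; last exact: cE.
    apply: cvg_mulmx; last exact: cvg_cst.
    by apply: cE; rewrite -(scale0r w); exact: cvgZl.
  by rewrite !expmx0 mul1r !mulr1 in e1.
pose w' := z^T * w * z.
have h2 : (fun s => 2 * h s) @ F --> 0.
  by rewrite -(mulr0 2); apply: cvgM => //; exact: cvg_cst.
have h2pos : \forall s \near F, 0 < 2 * h s.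
  by apply: filterS hpos => s hs; rewrite mulr_gt0.
have d1 : (fun s => (h s)^-1 *: (expmx (h s *: - w) - 1)) @ F --> - w.
  exact: cvg_expmx_diff.
have d2 : (fun s => (2 * h s)^-1 *: (expmx ((2 * h s) *: w') - 1)) @ F --> w'.
  exact: cvg_expmx_diff.
pose a s := expmx (h s *: - w); pose b s := expmx ((2 * h s) *: w').
pose A s := a s * b s * a s.
have limA : (fun s => (2 * h s)^-1 *: (A s - 1)) @ F --> w' - w.
  have a1 : a @ F --> (1 : M).
    by rewrite -(@expmx0 R n); apply: cE; rewrite -(scale0r (- w)); exact: cvgZl.
  have b1 : b @ F --> (1 : M).
    by rewrite -(@expmx0 R n); apply: cE; rewrite -(scale0r w'); exact: cvgZl.
  by rewrite addrC; exact: (cvg_aba_diff a1 b1 d1 d2).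
have diff0 : (fun s => (2 * h s)^-1 *: (expmx ((2 * h s) *: upolar (h s) z w) - 1) - upolar (h s) z w)
    @ F --> (0 : M).
  have lim0 : (fun s => 2 * fnorm (1 : M) * C ^+ 2 * (2 * h s)) @ F --> 0.
    by rewrite -(mulr0 (2 * fnorm (1 : M) * C ^+ 2)); apply: cvgM => //; exact: cvg_cst.
  have small : \forall s \near F, C * (2 * h s) < 2^-1.
    have e : 0 < 2^-1 :> R by [].
    have hh : (fun s => C * (2 * h s)) @ F --> 0.
      by rewrite -(mulr0 C); apply: cvgM => //; exact: cvg_cst.
    have /cvgrPdist_lt/(_ _ e) := hh; apply: filterS => s.
    by rewrite sub0r normrN => /(le_lt_trans (ler_norm _)).
  apply: cvg_fnorm0; apply: (squeeze_cvgr _ (cvg_cst 0) lim0).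
  near=> s; rewrite fnorm_ge0/= subr0.
  have hs : 0 < h s by near: s.
  have s2 : 0 < 2 * h s by rewrite mulr_gt0.
  set u := upolar (h s) z w.
  have uC : fnorm u <= C by exact: upolar_bound.
  have C0 : 0 <= C by rewrite !mulr_ge0// fnorm_ge0.
  have -> : (2 * h s)^-1 *: (expmx ((2 * h s) *: u) - 1) - u =
      (2 * h s)^-1 *: (expmx ((2 * h s) *: u) - 1 - (2 * h s) *: u).
    by rewrite [RHS]scalerBr scalerA mulVf ?gt_eqF// scale1r.
  have us : fnorm ((2 * h s) *: u) <= C * (2 * h s).
    by rewrite fnormZ gtr0_norm// mulrC ler_pM2r.
  have us2 : C * (2 * h s) <= 2^-1 by apply: ltW; near: s.
  rewrite fnormZ gtr0_norm ?invr_gt0// mulrC ler_pdivrMr//.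
  apply: (le_trans (fnorm_expmx_sub1_le (le_trans us us2))).
  apply: (@le_trans _ _ (2 * fnorm (1 : M) * (C * (2 * h s)) ^+ 2)).
    apply: ler_wpM2l; first by rewrite mulr_ge0// fnorm_ge0.
    by rewrite ler_pXn2r ?nnegrE ?fnorm_ge0// mulr_ge0// ltW.
  by rewrite le_eqVlt; apply/orP; left; apply/eqP; ring.
have : (fun s => (2 * h s)^-1 *: (A s - 1) - ((2 * h s)^-1 *: (expmx ((2 * h s) *: upolar (h s) z w) - 1) -
    upolar (h s) z w)) @ F --> w' - w - 0 by exact: (cvgB limA diff0).
rewrite subr0; apply: cvg_trans; apply: near_eq_cvg.
near=> s; have hs : 0 < h s by near: s.
rewrite (upolar_gram hs Kz wp) /A /a /b scalerN.
by rewrite -/w' opprB addrCA subrr addr0.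
Unshelve. all: by end_near. Qed.

End PolarFamily.

(** * Bounded measurable functions and Borel sets of matrices *)

Section BoundedMeasurable.
Context {R : realType}.

(** Over finite measures this class is integrable and stable under products and partial integrals,
    so Fubini and dominated convergence can be used without further side conditions. *)
Definition bounded_meas {d} {T : measurableType d} (f : T -> R) :=
  measurable_fun setT f /\ exists C : R, forall x, `|f x| <= C.

Section one.
Context {d} {T : measurableType d}.
Variable m : {finite_measure set T -> \bar R}.
Implicit Types f h : T -> R.

Lemma bounded_meas_integrable f : bounded_meas f -> m.-integrable setT (EFin \o f).
Proof.
move=> [mf [C fC]]; apply: measurable_bounded_integrable => //.
  by rewrite -ge0_fin_numE// fin_num_measure.
exists C; split; first exact: num_real.
by move=> y Cy x _; exact: le_trans (fC x) (ltW Cy).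
Qed.

Lemma Rintegral_le_bound f (C : R) : measurable_fun setT f -> (forall x, `|f x| <= C) ->
  `|Rintegral m setT f| <= C * fine (m setT).
Proof.
move=> mf fC.
have bf : bounded_meas f by split => //; exists C.
apply: (le_trans (le_normr_Rintegral _ (bounded_meas_integrable bf))) => //.
rewrite -Rintegral_cst//; apply: le_Rintegral => //.
  apply: (@bounded_meas_integrable (fun x => `|f x|)); split.
    exact: measurableT_comp.
  by exists C => x; rewrite normr_id.
by apply: (@bounded_meas_integrable (cst C)); split => //; exists `|C|.
Qed.

Lemma cvg_Rintegral_bounded (fn : nat -> T -> R) f (C : R) :
  (forall k, measurable_fun setT (fn k)) -> measurable_fun setT f ->
  (forall k x, `|fn k x| <= C) -> (forall x, fn k x @[k --> \oo] --> f x) ->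
  Rintegral m setT (fn k) @[k --> \oo] --> Rintegral m setT f.
Proof.
move=> mfn mf fnC fnf.
have fC x : `|f x| <= C.
  have h : (fun k => `|fn k x|) @ \oo --> `|f x| by apply: cvg_norm; exact: fnf.
  by apply: (ler_cvg_to h (cvg_cst C)); apply: nearW => k; exact: fnC.
have bf : bounded_meas f by split => //; exists C.
have [|||||_ _] := @dominated_convergence _ _ _ m setT measurableT (fun k => EFin \o fn k)
  (EFin \o f) (EFin \o cst C).
- by move=> k; apply/measurable_EFinP.
- exact/measurable_EFinP.
- apply: aeW => x _; apply/fine_cvgP; split; [exact: nearW|exact: fnf].
- by apply: bounded_meas_integrable; split => //; exists `|C|.
- by apply: aeW => x k _; rewrite /= lee_fin; exact: fnC.
have fin h : bounded_meas h -> (\int[m]_x (h x)%:E)%E \is a fin_num.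
  by move=> bh; apply: integrable_fin_num => //; exact: bounded_meas_integrable.
rewrite -[X in _ --> X -> _]fineK; last exact: fin.
exact: fine_cvg.
Qed.

Lemma RintegralB_bounded f h : bounded_meas f -> bounded_meas h ->
  Rintegral m setT (fun x => f x - h x) = Rintegral m setT f - Rintegral m setT h.
Proof. by move=> bf bh; rewrite RintegralB//; exact: bounded_meas_integrable. Qed.

Lemma Rintegral_preserving f (phi : T -> T) : bounded_meas f -> measurable_fun setT phi ->
  (forall A, measurable A -> m (phi @^-1` A) = m A) ->
  Rintegral m setT (f \o phi) = Rintegral m setT f.
Proof.
move=> bf mphi hphi; rewrite /Rintegral; congr fine.
have := @integral_pushforward _ _ _ _ R phi mphi m setT (EFin \o f).
rewrite preimage_setT /= => <- //.
- by apply: eq_measure_integral => A mA _; exact: hphi.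
- by apply/measurable_EFinP; case: bf.
- apply: (@bounded_meas_integrable (f \o phi)); case: bf => mf [C fC]; split.
    exact: measurableT_comp.
  by exists C => x; exact: fC.
Qed.

Lemma bounded_meas_comp {d'} {T' : measurableType d'} (f : T -> R) (phi : T' -> T) :
  bounded_meas f -> measurable_fun setT phi -> bounded_meas (f \o phi).
Proof.
move=> [mf [C fC]] mphi; split; first exact: measurableT_comp.
by exists C => x; exact: fC.
Qed.

Lemma bounded_measM f h : bounded_meas f -> bounded_meas h -> bounded_meas (fun x => f x * h x).
Proof.
move=> [mf [C fC]] [mh [D hD]]; split; first exact: measurable_funM.
by exists (C * D) => x; rewrite normrM ler_pM.
Qed.

End one.

Section two.
Context {d1 d2} {T1 : measurableType d1} {T2 : measurableType d2}.
Variables (m1 : {finite_measure set T1 -> \bar R}) (m2 : {finite_measure set T2 -> \bar R}).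
Implicit Types f : T1 * T2 -> R.

Lemma bounded_meas_pair1 f x : bounded_meas f -> bounded_meas (fun y => f (x, y)).
Proof. by move=> bf; exact: (bounded_meas_comp bf (pair1_measurable x)). Qed.

Lemma bounded_meas_pair2 f y : bounded_meas f -> bounded_meas (fun x => f (x, y)).
Proof. by move=> bf; exact: (bounded_meas_comp bf (pair2_measurable y)). Qed.

Lemma bounded_meas_integrable_prod f : bounded_meas f ->
  (m1 \x m2)%E.-integrable setT (EFin \o f).
Proof.
move=> [mf [C fC]]; apply: measurable_bounded_integrable => //.
  rewrite (_ : [set: T1 * T2] = [set: T1] `*` [set: T2]); last by rewrite setXTT.
  rewrite [ltLHS]product_measure1E//; apply: lte_mul_pinfty => //.
    exact: fin_num_measure.
  by rewrite -ge0_fin_numE// fin_num_measure.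
exists C; split; first exact: num_real.
by move=> y Cy x _; exact: le_trans (fC x) (ltW Cy).
Qed.

Lemma bounded_meas_Rintegral2 f : bounded_meas f ->
  bounded_meas (fun x => Rintegral m2 setT (fun y => f (x, y))).
Proof.
move=> bf; case: (bf) => mf [C fC]; have C0 (x : T1) (y : T2) : 0 <= C by exact: le_trans (normr_ge0 _) (fC (x, y)).
have bx x : bounded_meas (fun y => f (x, y)) by exact: bounded_meas_pair1.
split; last first.
  exists (C * fine (m2 setT)) => x.
  by apply: Rintegral_le_bound => [|y]; [case: (bx x)|exact: fC].
(* Adding the bound C makes the integrand nonnegative, so that Tonelli gives measurability of the
   partial integral; the constant is then subtracted. *)
rewrite (_ : (fun x => _) = (fun x => fine (\int[m2]_y (f (x, y) + C)%:E)%E - C * fine (m2 setT))).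
  apply: measurable_funB => //; apply: measurableT_comp => //.
  apply: (@measurable_fun_fubini_tonelli_F _ _ T1 T2 R m2 (fun q => (f q + C)%:E)).
    by apply/measurable_EFinP; exact: measurable_funD.
  move=> q; rewrite lee_fin -lerBlDr sub0r.
  by have := fC q; rewrite ler_norml => /andP[].
apply/funext => x; rewrite -[X in X - _]/(Rintegral m2 setT (fun y => f (x, y) + C)).
rewrite RintegralD//; last 2 first.
- exact: bounded_meas_integrable (bx x).
- by apply: (@bounded_meas_integrable _ T2 m2 (cst C)); split => //; exists `|C|.
by rewrite (Rintegral_cst m2 measurableT C) addrK.
Qed.

Lemma Rintegral_swap f : bounded_meas f ->
  Rintegral m1 setT (fun x => Rintegral m2 setT (fun y => f (x, y))) =
  Rintegral m2 setT (fun y => Rintegral m1 setT (fun x => f (x, y))).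
Proof.
move=> bf; rewrite /Rintegral; congr fine.
have := Fubini (bounded_meas_integrable_prod bf) => /= h.
transitivity (\int[m1]_x \int[m2]_y (f (x, y))%:E)%E.
  apply: eq_integral => x _; rewrite fineK//; apply: integrable_fin_num => //.
  apply: (@bounded_meas_integrable _ _ m2 (fun y => f (x, y))).
  exact: bounded_meas_pair1.
rewrite h; apply: eq_integral => y _; rewrite fineK//; apply: integrable_fin_num => //.
apply: (@bounded_meas_integrable _ _ m1 (fun x => f (x, y))).
exact: bounded_meas_pair2.
Qed.

End two.
End BoundedMeasurable.

(** * Borel measurability on products of matrix spaces *)

Section BorelProduct.
Context {R : realType} {n : nat}.
Local Notation M := 'M[R]_n.+1.
Local Notation T := (borel_matrix R n).

Lemma borel_open (U : set M) : open U -> measurable (U : set T).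
Proof. by move=> oU; exact: sub_sigma_algebra. Qed.

Lemma borel_closed (U : set M) : closed U -> measurable (U : set T).
Proof.
move=> cU; rewrite -[U]setCK; apply: (@measurableC _ T); apply: borel_open.
exact: closed_openC.
Qed.

(** A countable base of the topology. Open subsets of products are countable unions of products of
    such balls and therefore lie in the product of the Borel sigma-algebras. *)
Definition rat_ball (q : 'M[rat]_n.+1 * rat) : set M :=
  [set X : M | `|X - map_mx (ratr : rat -> R) q.1| < ratr q.2].

Lemma rat_ball_open q : open (rat_ball q).
Proof.
have -> : rat_ball q = ball (map_mx (ratr : rat -> R) q.1 : M) (ratr q.2).
  by apply/seteqP; split => X; rewrite -ball_normE /rat_ball /= distrC.
have [q0|q0] := ltP 0 (ratr q.2 : R); first exact: ball_open.
rewrite [X in open X](_ : _ = set0); first exact: open0.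
apply/seteqP; split => // X; rewrite -ball_normE /= => /lt_le_trans /(_ q0).
by rewrite normr_lt0.
Qed.

Lemma rat_ball_base (X : M) (U : set M) : nbhs X U ->
  exists2 q, rat_ball q X & rat_ball q `<=` U.
Proof.
move=> /nbhs_ballP[e /= e0 eU].
have e4 : 0 < e / 4 by rewrite divr_gt0.
have e2 : e / 4 < e / 2 by rewrite ltr_pM2l// ltf_pV2 ?posrE// ltr_nat.
have [r] := rat_in_itvoo e2; rewrite in_itv /= => /andP[r1 r2].
have qij (ij : 'I_n.+1 * 'I_n.+1) : exists q : rat,
    ratr q \in `](X ij.1 ij.2 - e / 4), (X ij.1 ij.2 + e / 4)[.
  by apply: rat_in_itvoo; rewrite ltrD2l; lra.
have [q hq] := choice qij.
pose Q : 'M[rat]_n.+1 := \matrix_(i, j) q (i, j).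
have XQ : `|X - map_mx (ratr : rat -> R) Q| < e / 4.
  rewrite [ltLHS]/Num.norm /= mx_normrE; apply/bigmax_ltP; split => // -[i j] _ /=.
  rewrite !mxE; have := hq (i, j); rewrite in_itv /= => /andP[h1 h2].
  by rewrite ltr_norml; apply/andP; split; lra.
exists (Q, r); first exact: lt_trans XQ r1.
move=> Y; rewrite /rat_ball /= => YQ; apply: eU; rewrite -ball_normE /=.
have -> : X - Y = (X - map_mx (ratr : rat -> R) Q) - (Y - map_mx (ratr : rat -> R) Q).
  by rewrite opprB addrA subrK.
by rewrite (le_lt_trans (ler_normB _ _))//; lra.
Qed.

Lemma countable_cover_measurable d (X : measurableType d) (I : countType) (A : I -> set X)
    (W : set X) : (forall i, measurable (A i)) ->
  (forall x, W x -> exists2 i, A i x & A i `<=` W) -> measurable W.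
Proof.
move=> mA cov.
have -> : W = \bigcup_(i in [set i | A i `<=` W]) A i.
  by apply/seteqP; split => [x /cov[i Ax AW]|x [i AW /AW]//]; exists i.
rewrite bigcup_mkcond; apply: countable_bigcupT_measurable => // i.
by case: ifP.
Qed.

Lemma borel_open2 (U : set (M * M)) : open U -> measurable (U : set (T * T)).
Proof.
move=> oU; pose A (q : ('M[rat]_n.+1 * rat) * ('M[rat]_n.+1 * rat)) : set (T * T) :=
  rat_ball q.1 `*` rat_ball q.2.
apply: (@countable_cover_measurable _ _ _ A).
  by move=> q; apply: measurableX; apply: borel_open; exact: rat_ball_open.
move=> [x y] Uxy; have := oU; rewrite openE => /(_ _ Uxy)[[V W] /= [/= Vx Wy] VW].
have [q1 q1x q1V] := rat_ball_base Vx; have [q2 q2y q2W] := rat_ball_base Wy.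
exists (q1, q2) => // -[x' y'] [/= /q1V h1 /q2W h2]; exact: VW.
Qed.

Lemma borel_open3 (U : set (M * (M * M))) : open U -> measurable (U : set (T * (T * T))).
Proof.
move=> oU; pose A (q : ('M[rat]_n.+1 * rat) * (('M[rat]_n.+1 * rat) * ('M[rat]_n.+1 * rat))) :
    set (T * (T * T)) := rat_ball q.1 `*` (rat_ball q.2.1 `*` rat_ball q.2.2).
apply: (@countable_cover_measurable _ _ _ A).
  move=> q; apply: measurableX; first by apply: borel_open; exact: rat_ball_open.
  by apply: measurableX; apply: borel_open; exact: rat_ball_open.
move=> [x [y z]] Uxy; have := oU; rewrite openE => /(_ _ Uxy)[[V W] /= [/= Vx Wyz] VW].
have [[W1 W2] /= [/= W1y W2z] W12] := Wyz.
have [q1 q1x q1V] := rat_ball_base Vx; have [q2 q2y q2W] := rat_ball_base W1y.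
have [q3 q3z q3W] := rat_ball_base W2z.
exists (q1, (q2, q3)) => // -[x' [y' z']] [/= /q1V h1 [/q2W h2 /q3W h3]].
by apply: VW; split => //=; exact: (W12 (y', z')).
Qed.

Lemma borel_continuous (f : M -> M) : continuous f -> measurable_fun setT (f : T -> T).
Proof.
move=> cf; apply: (@measurability _ _ T T setT _ (@open M)) => // _ [U oU <-]; rewrite setTI.
by apply: borel_open; apply: open_comp => // X _; exact: cf.
Qed.

Lemma borel_continuous2 (f : M * M -> M) : continuous f -> measurable_fun setT (f : T * T -> T).
Proof.
move=> cf; apply: (@measurability _ _ (T * T)%type T setT _ (@open M)) => // _ [U oU <-].
rewrite setTI; apply: (@borel_open2 (f @^-1` U)); apply: open_comp => // q _; exact: cf.
Qed.

(** The map j is used as the identity from the measurable space to the underlying topological space.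
    A superlevel set of f inside the closed set D is closed; extending by 0 adds the complement of D
    exactly for levels r <= 0. *)
Lemma restrict_measurable d (X : topologicalType) (Y : measurableType d) (j : Y -> X)
    (D : set X) (f : X -> R) :
  (forall U, open U -> measurable (j @^-1` U)) -> closed D ->
  (forall x, D x -> f @ within D (nbhs x) --> f x) ->
  measurable_fun setT (fun y => (f \_ D) (j y)).
Proof.
move=> mj cD cf.
have mjc U : closed U -> measurable (j @^-1` U).
  move=> cU; have -> : j @^-1` U = ~` (j @^-1` (~` U)) by rewrite preimage_setC setCK.
  by apply: measurableC; apply: mj; exact: closed_openC.
have clp (r : R) : closed (D `&` [set x | r <= f x]).
  move=> x clx.
  have Dx : D x by apply: cD; apply: closure_subset clx; exact: subIsetl.
  split => //=; rewrite leNgt; apply/negP => fxr.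
  have : nbhs (f x) [set y | y < r] by exact: lt_nbhsl.
  move=> /(cf _ Dx); rewrite /fmap /= /within /= => nb.
  have [y [[Dy /= ry] /(_ Dy) fy]] := clx _ nb.
  by move: ry; rewrite leNgt; apply/negP; rewrite negbK.
apply: (measurability (@RGenCInfty.G R)) => [|/= _ [_] [r] -> <-].
  exact: RGenCInfty.measurableE.
rewrite setTI.
have -> : (fun y => (f \_ D) (j y)) @^-1` `[r, +oo[ =
    j @^-1` (D `&` [set x | r <= f x]) `|` (if r <= 0 then j @^-1` (~` D) else set0).
  apply/seteqP; split => y /=; rewrite /patch in_itv /= andbT.
    by case: ifPn => [/set_mem Dy fy|/negP Dy r0]; [left|right; rewrite r0 => Dy'; apply: Dy; exact/mem_set].
  move=> [[Dy ry]|]; first by rewrite mem_set.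
  by case: ifPn => // r0 /= nD; rewrite memNset.
apply: measurableU; first exact: mjc.
case: ifP => // _; apply: mj; exact: closed_openC.
Qed.

End BorelProduct.

(** * Roots and the dimension formula *)

Section Roots.
Context {R : realType} {n : nat}.
Local Notation M := 'M[R]_n.+1.
Implicit Types (X Y Z v w : M).

Definition linear_form (l : M -> R) := forall (c : R) X Y, l (c *: X + Y) = c * l X + l Y.

Section LinearForm.
Variables (l : M -> R) (ll : linear_form l).

Lemma linear_form0 : l 0 = 0.
Proof.
have h := ll 1 0 0; rewrite scale1r addr0 mul1r in h.
have gen (c : R) : c = c + c -> c = 0 by move=> hc; lra.
exact: gen.
Qed.

Lemma linear_formD X Y : l (X + Y) = l X + l Y.
Proof. by have := ll 1 X Y; rewrite scale1r mul1r. Qed.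

Lemma linear_formZ c X : l (c *: X) = c * l X.
Proof. by have := ll c X 0; rewrite addr0 linear_form0 addr0. Qed.

Lemma linear_form_sum (I : Type) (s : seq I) (P : pred I) (F : I -> M) :
  l (\sum_(i <- s | P i) F i) = \sum_(i <- s | P i) l (F i).
Proof. exact: (big_morph l linear_formD linear_form0). Qed.

Lemma linear_formE X : l X = \sum_(i < n.+1) \sum_(j < n.+1) X i j * l (delta_mx i j).
Proof.
rewrite [in LHS](matrix_sum_delta X) linear_form_sum; apply: eq_bigr => i _.
by rewrite linear_form_sum; apply: eq_bigr => j _; rewrite linear_formZ.
Qed.

Lemma linear_form_bound : exists2 L : R, 0 < L & forall X, `|l X| <= L * fnorm X.
Proof.
pose S := \sum_(i < n.+1) \sum_(j < n.+1) `|l (delta_mx i j)|.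
have S0 : 0 <= S by apply: sumr_ge0 => i _; apply: sumr_ge0.
exists (S + 1) => [|X]; first exact: ltr_wpDl.
rewrite mulrDl mul1r; apply: (@le_trans _ _ (S * fnorm X)); last first.
  by rewrite lerDl -(fnorm0 (R := R) (n := n)) ; rewrite fnorm0; exact: sqrtr_ge0.
rewrite linear_formE /S mulr_suml; apply: (le_trans (ler_norm_sum _ _ _)).
apply: ler_sum => i _; rewrite mulr_suml; apply: (le_trans (ler_norm_sum _ _ _)).
apply: ler_sum => j _; rewrite normrM mulrC ler_wpM2l//.
exact: le_trans (entry_le_normr _ _ _) (ler_normr_fnorm _).
Qed.

Lemma linear_form_cvg T (F : set_system T) (FF : Filter F) (f : T -> M) X :
  f @ F --> X -> (fun t => l (f t)) @ F --> l X.
Proof.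
move=> fX; rewrite linear_formE.
rewrite (_ : (fun t => l (f t)) = (fun t => \sum_(i < n.+1) \sum_(j < n.+1) f t i j * l (delta_mx i j))).
  apply: cvg_bigsum => i _; apply: cvg_bigsum => j _.
  by apply: cvgM; [exact: cvg_entry|exact: cvg_cst].
by apply/funext => t; exact: linear_formE.
Qed.

Lemma linear_form_continuous : continuous l.
Proof. by move=> X; apply: (@linear_form_cvg M (nbhs X) _ id); exact: cvg_id. Qed.

End LinearForm.

Variables (g a : {vspace M}).
Local Notation dual := 'Hom(subvs_of a, R^o).
Implicit Types (alpha beta : dual).

Lemma ev_linear alpha : linear_form (ev alpha).
Proof. by move=> c X Y; rewrite /ev linearP /= linearP. Qed.

Lemma ev_inj alpha beta : (forall H, H \in a -> ev alpha H = ev beta H) -> alpha = beta.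
Proof.
move=> ab; apply/lfunP => u; have := ab (vsval u) (subvsP u).
by rewrite /ev vsvalK.
Qed.

Lemma root_spaceP alpha X : (X \in root_space g alpha) <->
  (X \in g /\ forall H, H \in a -> H * X - X * H = ev alpha H *: X).
Proof.
rewrite /root_space; apply: subspace_ofP.
  by split; [exact: mem0v|move=> H _; rewrite mulr0 mul0r subr0 scaler0].
move=> c Y Z [Yg hY] [Zg hZ]; split; first by rewrite rpredD// rpredZ.
move=> H Ha; rewrite mulrDr mulrDl -scalerAr -scalerAl scalerDr scalerA.
rewrite (mulrC _ c) -scalerA -hY// -hZ// scalerBr.
by rewrite opprD addrACA.
Qed.

Hypothesis ap : (a <= cartan_p g)%VS.

(** For symmetric H the operator ad H is self-adjoint for the Frobenius product, so eigenvectors for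
    different eigenvalues are orthogonal. *)
Lemma root_space_orth alpha beta X Y : alpha <> beta ->
  X \in root_space g alpha -> Y \in root_space g beta -> mxdot X Y = 0.
Proof.
move=> ab /root_spaceP[_ hX] /root_spaceP[_ hY].
have [H Ha Hab] : exists2 H, H \in a & ev alpha H <> ev beta H.
  apply: contrapT => h; apply: ab; apply: ev_inj => H Ha.
  by apply: contrapT => hab; apply: h; exists H.
have HT : H^T = H by exact: p_sym (subvP ap _ Ha).
have E : mxdot (H * X - X * H) Y = mxdot X (H * Y - Y * H).
  rewrite /mxdot !linearB /= mulrBl mulrBr !linearB /= !trmxM HT.
  rewrite (mxtrMC (H * X^T) Y) -!mulrA; congr (_ - _).
  by rewrite mulrA mxtrMC.
move: E; rewrite hX// hY// /mxdot linearZ /= -scalerAl -scalerAr !linearZ /= => E.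
have gen (p q c : R) : p <> q -> p * c = q * c -> c = 0.
  move=> pq pc; have : (p - q) * c == 0 by rewrite mulrBl pc subrr.
  by rewrite mulf_eq0 => /orP[|/eqP//]; rewrite subr_eq0 => /eqP.
exact: (gen _ _ _ Hab E).
Qed.

(** One nonzero vector is taken from each root space, and pairwise orthogonal nonzero vectors are
    independent. This bounds the number of roots by the dimension of the matrix space. *)
Lemma root_vectors_free (s : seq dual) : uniq s ->
  (forall alpha, alpha \in s -> restricted_root g alpha) ->
  free [seq vpick (root_space g alpha) | alpha <- s].
Proof.
move=> us sr; pose X := [tuple of [seq vpick (root_space g alpha) | alpha <- in_tuple s]].
apply/(@freeP _ _ _ X) => k kX i.
have nthX (j : 'I_(size s)) : X`_j = vpick (root_space g (tnth (in_tuple s) j)).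
  by rewrite (nth_map (tnth (in_tuple s) j))// -tnth_nth.
have := congr1 (mxdot X`_i) kX.
have dot0 Y : mxdot Y 0 = 0 by rewrite /mxdot mulr0 linear0.
rewrite dot0 (big_morph (mxdot X`_i) (id1 := 0) (op1 := +%R)); last 2 first.
- by move=> Y Z; rewrite /mxdot mulrDr linearD.
- exact: dot0.
rewrite (bigD1 i)//= big1 => [|j ji]; last first.
  rewrite /mxdot -scalerAr linearZ /= -/(mxdot _ _) !nthX.
  rewrite (@root_space_orth (tnth (in_tuple s) i) (tnth (in_tuple s) j)) ?mulr0 ?memv_pick//.
  by move=> /(elimT (tuple_uniqP (in_tuple s)) us) ij; rewrite ij eqxx in ji.
rewrite addr0 /mxdot -scalerAr linearZ /= -/(mxdot _ _) => /eqP; rewrite mulf_eq0 => /orP[/eqP//|].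
rewrite -fnorm_sqr sqrf_eq0 fnorm_eq0 nthX vpick0 => /eqP r0.
by have [_] := sr _ (mem_tnth i (in_tuple s)); rewrite r0 eqxx.
Qed.

Lemma positive_roots_finite (H0 : M) : finite_set (positive_roots g (a:=a) H0).
Proof.
apply: contrapT => inf.
have [B BS sB] := infinite_set_fset (\dim {:M}).+1 inf.
have fr : free [seq vpick (root_space g alpha) | alpha <- finmap.enum_fset B].
  apply: root_vectors_free => [|alpha aB]; first exact: finmap.fset_uniq.
  by have [] := BS _ aB.
have := dimvS (subvf (<<[seq vpick (root_space g alpha) | alpha <- finmap.enum_fset B]>>%VS)).
by rewrite (eqnP fr) size_map leqNgt sB.
Qed.

(** Finiteness turns the product over a set in [root_product] into a product over a list, on which
    induction is possible. The later sections work with such a list only. *)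
Lemma positive_roots_seq (H0 : M) : exists s : seq dual,
  [/\ forall alpha, alpha \in s <-> positive_roots g (a:=a) H0 alpha,
      forall v, weyl_chamber g a H0 v <-> v \in a /\ {in s, forall alpha, 0 < ev alpha v} &
      forall c v, root_product g a H0 c v = \prod_(alpha <- s) (c (ev alpha v)) ^+ multiplicity g alpha].
Proof.
have fS := positive_roots_finite H0.
have [s sE sp] : exists2 s : seq dual, forall alpha, alpha \in s <-> positive_roots g (a:=a) H0 alpha &
    forall c v, root_product g a H0 c v = \prod_(alpha <- s) (c (ev alpha v)) ^+ multiplicity g alpha.
  exists (finmap.enum_fset (fset_set (positive_roots g (a:=a) H0))) => [alpha|c v].
    have := in_fset_set fS alpha; rewrite -topredE /= => E.
    by split => [|/mem_set]; [move=> h; apply/set_mem; rewrite -E|rewrite -E].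
  by rewrite /root_product fsbig_finite.
exists s; split => // v; split => -[va h]; split => // alpha.
  by move=> /sE; exact: h.
by move=> /sE; exact: h.
Qed.

End Roots.

(** * Lebesgue volume of boxes and balls in a subspace *)

Section Boxes.
Context {R : realType} {n : nat}.
Local Notation M := 'M[R]_n.+1.
Local Notation T := (borel_matrix R n).
Implicit Types (X Y Z v w : M).

Lemma measurable_forall_seq d (S : measurableType d) (I : eqType) (s : seq I) (A : I -> set S) :
  (forall i, measurable (A i)) -> measurable [set v | forall i, i \in s -> A i v].
Proof.
move=> mA; elim: s => [|i s IH].
  by rewrite (_ : [set _ | _] = setT)//; apply/seteqP; split.
rewrite (_ : [set _ | _] = A i `&` [set v | forall i, i \in s -> A i v]).
  exact: measurableI.
apply/seteqP; split => v /= => [h|[h1 h2] j].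
  split => [|j js]; apply: h; first exact: mem_head.
  by rewrite inE js orbT.
by rewrite inE => /predU1P[->//|]; exact: h2.
Qed.

Lemma measure_disjoint_copies d (S : measurableType d) (m : {measure set S -> \bar R})
    (I : choiceType) (s : seq I) (F : I -> set S) (q : R) : uniq s ->
  (forall i, measurable (F i)) -> (forall i j x, F i x -> F j x -> i = j) ->
  (forall i, m (F i) = q%:E) ->
  m (\bigcup_(i in [set` s]) F i) = ((size s)%:R * q)%:E.
Proof.
move=> us mF dF Fq; rewrite bigcup_seq; elim: s us => [_|i s IH /= /andP[is_ us]].
  by rewrite big_nil measure0 mul0r.
rewrite big_cons measureU//.
- have -> : (size s).+1%:R * q = q + (size s)%:R * q by rewrite -natr1 mulrDl mul1r addrC.
  exact: (congr2 adde (Fq i) (IH us)).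
- exact: bigsetU_measurable.
- rewrite -bigcup_seq -subset0 => x [/= Fx [j /= js Fjx]].
  by move: is_; rewrite (dF _ _ _ Fx Fjx) js.
Qed.

Lemma linear_form_measurable (l : M -> R) : linear_form l -> measurable_fun setT (l : T -> R).
Proof.
move=> ll; apply: (measurability (@RGenOpens.G R)) => [|/= _ [_] [a [b ->]] <-].
  exact: RGenOpens.measurableE.
rewrite setTI; apply: borel_open; apply: open_comp; last exact: interval_open.
by move=> X _; exact: linear_form_continuous.
Qed.

Variables (V : {vspace M}) (nu : {measure set T -> \bar R}).
Local Notation e := (vbasis V).
Local Notation co := (coord (vbasis V)).

(** Half-open in the coordinates of a basis of V, so that integer translates of the unit box tile V
    without overlap. *)
Definition box (s : R) : set M := [set v | v \in V /\ forall i, 0 <= co i v < s].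

Lemma coord_linear i : linear_form (co i).
Proof. by move=> c X Y; rewrite linearP. Qed.

Lemma box_measurable s : measurable (box s : set T).
Proof.
rewrite (_ : box s = [set` V] `&` [set v : T | forall i, i \in enum 'I_(\dim V) -> co i v \in `[0, s[]).
  apply: measurableI; first by apply: borel_closed; exact: vspace_closed.
  apply: (@measurable_forall_seq _ T _ _ (fun i => [set v | co i v \in `[0, s[])) => i.
  rewrite -[X in measurable X]setTI.
  exact: (linear_form_measurable (coord_linear i) measurableT (measurable_itv `[0, s[)).
apply/seteqP; split => v /= [vV h]; split => // i; first by rewrite in_itv /= h.
by have := h i (mem_enum _ i); rewrite in_itv.
Qed.

Lemma box_bound : exists2 c : R, 0 < c & forall s v, 0 <= s -> box s v -> fnorm v <= c * s.
Proof.
exists (1 + \sum_(i < \dim V) fnorm e`_i).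
  by rewrite ltr_wpDr//; apply: sumr_ge0 => i _; exact: fnorm_ge0.
move=> s v s0 [vV h]; rewrite {1}(coord_vbasis vV) mulrDl mul1r mulr_suml.
apply: (le_trans (ler_fnorm_sum _ _ _)); apply: ler_wpDl => //; apply: ler_sum => i _.
rewrite fnormZ mulrC ler_wpM2l ?fnorm_ge0//.
by have /andP[h1 h2] := h i; rewrite ger0_norm// ltW.
Qed.

Lemma coord_bound : exists2 L : nat, (0 < L)%N & forall i v, `|co i v| <= L%:R * fnorm v.
Proof.
have /choice[L hL] : forall i, exists L : R, 0 < L /\ forall v, `|co i v| <= L * fnorm v.
  by move=> i; have [L L0 h] := linear_form_bound (coord_linear i); exists L.
exists (Num.trunc (\sum_i L i)).+1 => // i v.
have [Li h] := hL i; apply: (le_trans (h v)); rewrite ler_wpM2r ?fnorm_ge0//.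
apply: (@le_trans _ _ (\sum_i L i)); last exact/ltW/truncnS_gt.
rewrite (bigD1 i)//= lerDl; apply: sumr_ge0 => j _.
by have [/ltW] := hL j.
Qed.

Definition lattice_vector (k : 'I_(\dim V) -> R) : M := \sum_i k i *: e`_i.

Lemma lattice_vector_mem k : lattice_vector k \in V.
Proof. by apply: memv_suml => i _; rewrite rpredZ// vbasis_mem// mem_nth// size_tuple. Qed.

Lemma coord_lattice_vector k v i : co i (- lattice_vector k + v) = co i v - k i.
Proof.
have li := coord_linear i.
have fe : free e by have := vbasisP V; rewrite /basis_of => /andP[].
rewrite (linear_formD li) -scaleN1r (linear_formZ li) mulN1r addrC; congr (_ - _).
exact: coord_sum_free.
Qed.

Hypothesis hnu : lebesgue_on V nu.

Lemma lebesgue_translate u (A : set T) : u \in V -> measurable A ->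
  nu [set v : M | A (- u + v)] = nu A.
Proof. by case: hnu => _ _ _ h uV mA; apply: h => //; rewrite rpredN. Qed.

Lemma translate_measurable u (A : set T) : measurable A -> measurable ([set v : M | A (- u + v)] : set T).
Proof.
move=> mA; rewrite -[X in measurable X]setTI.
have mt : measurable_fun setT ((fun v : M => - u + v) : T -> T).
  apply: (borel_continuous (f := fun v => - u + v)) => X.
  suff : (fun Y : M => - u + Y) @ nbhs X --> - u + X by [].
  by apply: cvgD; [exact: cvg_cst|exact: cvg_id].
exact: mt.
Qed.

(** Finite because the box lies in a compact ball. Positive because countably many translates by
    integer vectors cover V, which is not a null set. *)
Lemma lebesgue_box1 : exists2 q : R, 0 < q & nu (box 1) = q%:E.
Proof.
have [nuC nuV nucpt _] := hnu.
have fin : (nu (box 1) < +oo)%E.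
  have [c c0 hc] := box_bound.
  apply: (le_lt_trans (le_measure nu _ _ _) (nucpt _ (@vspace_ball_compact _ _ V c 0))); rewrite ?inE.
  - exact: box_measurable.
  - apply: borel_closed; apply: compact_closed; last exact: vspace_ball_compact.
    exact: norm_hausdorff.
  - move=> v bv /=; split; first by case: bv.
    by rewrite subr0; have := hc _ _ ler01 bv; rewrite mulr1.
have : (0 <= nu (box 1))%E by [].
move: fin; case E : (nu (box 1)) => [q| |]// _; rewrite lee_fin le_eqVlt => /predU1P[q0|q0]; last by exists q.
exfalso; apply: nuV.
pose F (k : {ffun 'I_(\dim V) -> int}) : set T := [set v | box 1 (- lattice_vector (fun i => (k i)%:~R) + v)].
apply: (@measure_negligible _ _ _ nu); first by apply: borel_closed; exact: vspace_closed.
pose F' m := if unpickle m is Some k then F k else set0.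
apply: (@negligibleS _ _ _ nu (\bigcup_m F' m)).
  move=> v vV; exists (pickle [ffun i => Num.floor (co i v)]) => //.
  rewrite /F' pickleK; split; first by rewrite rpredD// rpredN lattice_vector_mem.
  move=> i; rewrite coord_lattice_vector ffunE.
  have /andP[h1 h2] := floor_itv (co i v); rewrite subr_ge0 h1 ltrBlDl.
  by move: h2; rewrite intrD.
apply: negligible_bigcup => m; rewrite /F'; case: (unpickle m) => [k|]; last exact: negligible_set0.
apply/negligibleP; first by apply: translate_measurable; exact: box_measurable.
rewrite /F; have := lebesgue_translate (lattice_vector_mem (fun i => (k i)%:~R)) (box_measurable 1).
by rewrite E -q0.
Qed.

(** A box of integer side s is the disjoint union of s^(dim V) translates of the unit box, indexed
    by the integer parts of the coordinates. *)
Lemma lebesgue_box : exists2 q : R, 0 < q &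
  forall s : nat, nu (box s%:R) = (s%:R ^+ \dim V * q)%:E.
Proof.
have [q q0 E] := lebesgue_box1; exists q => // s.
pose F (k : {ffun 'I_(\dim V) -> 'I_s}) : set T :=
  [set v | box 1 (- lattice_vector (fun i => (nat_of_ord (k i))%:R) + v)].
have mF k : measurable (F k) by apply: translate_measurable; exact: box_measurable.
have -> : box s%:R = \bigcup_(k in [set` enum {ffun 'I_(\dim V) -> 'I_s}]) F k.
  apply/seteqP; split => v.
    move=> [vV h].
    have hs i : (Num.trunc (co i v) < s)%N.
      by have /andP[h1 h2] := h i; rewrite truncn_lt_nat.
    exists [ffun i => Ordinal (hs i)]; first by rewrite /= mem_enum.
    split; first by rewrite rpredD// rpredN lattice_vector_mem.
    move=> i; rewrite coord_lattice_vector ffunE /=.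
    have /andP[h1 _] := h i; have /andP[h2 h3] := truncn_itv h1.
    by rewrite subr_ge0 h2 ltrBlDl natr1.
  move=> [k _ [kV h]]; split.
    have := rpredD kV (lattice_vector_mem (fun i => (nat_of_ord (k i))%:R)).
    by rewrite addrAC addNr add0r.
  move=> i; have := h i; rewrite coord_lattice_vector subr_ge0 => /andP[h1 h2].
  rewrite (le_trans _ h1)//=; move: h2; rewrite ltrBlDl => /lt_le_trans; apply.
  by rewrite natr1 ler_nat.
rewrite (@measure_disjoint_copies _ _ _ _ _ _ q)//; last 3 first.
- exact: enum_uniq.
- move=> k1 k2 v [_ h1] [_ h2]; apply/ffunP => i; apply/ord_inj.
  have := h1 i; have := h2 i; rewrite !coord_lattice_vector !subr_ge0 !ltrBlDl !natr1 => h3 h4.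
  by rewrite -(truncn_def h3) -(truncn_def h4).
- move=> k; rewrite lebesgue_translate//; [exact: lattice_vector_mem|exact: box_measurable].
by rewrite -cardE card_ffun !card_ord natrX.
Qed.

Lemma lebesgue_ball_growth : exists2 C : R, 0 <= C & forall s : nat, (0 < s)%N ->
  (nu [set v : M | v \in V /\ (fnorm v <= s%:R)%R] <= (C * s%:R ^+ \dim V)%:E)%E.
Proof.
have [L L0 hL] := coord_bound; have [q q0 hq] := lebesgue_box.
exists (((L + L + 2)%N)%:R ^+ \dim V * q) => [|s s0].
  by rewrite mulr_ge0 ?ltW// exprn_ge0.
(* On the ball all coordinates are at most L s in absolute value; the shift by L s + 1 puts them
   between 0 and N, and N <= (2L + 2) s. *)
pose u := lattice_vector (fun=> - ((L * s).+1)%:R).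
pose N := ((L * s).+1 + (L * s).+1)%N.
have mB : measurable ([set v | box N%:R (- u + v)] : set T).
  by apply: translate_measurable; exact: box_measurable.
apply: (@le_trans _ _ (nu [set v | box N%:R (- u + v)])).
  apply: le_measure; rewrite ?inE//.
    apply: borel_closed; apply: compact_closed; first exact: norm_hausdorff.
    have := @vspace_ball_compact _ _ V s%:R 0.
    by under eq_fun do rewrite subr0.
  move=> v /= [vV vs]; split; first by rewrite rpredD// rpredN lattice_vector_mem.
  move=> i; rewrite coord_lattice_vector opprK.
  have h : `|co i v| <= (L * s)%:R.
    by apply: (le_trans (hL i v)); rewrite natrM ler_wpM2l.
  have gen (p r : R) : `|p| <= r -> 0 <= p + (r + 1) < (r + 1) + (r + 1).
    by rewrite ler_norml => /andP[h1 h2]; apply/andP; split; lra.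
  by have := gen _ _ h; rewrite natr1 -natrD.
rewrite lebesgue_translate ?lattice_vector_mem//; last exact: box_measurable.
rewrite hq lee_fin mulrAC; apply: ler_wpM2r; first exact: ltW.
rewrite -exprMn; apply: lerXn2r; rewrite ?nnegrE ?mulr_ge0//.
have ar (p r : nat) : (0 < r)%N -> ((p * r).+1 + (p * r).+1 <= (p + p + 2) * r)%N.
  by move=> r0; rewrite addSn addnS -addn2 !mulnDl leq_add2l leq_pmulr.
by rewrite -natrM ler_nat; exact: ar.
Qed.

End Boxes.

Section ChamberGeometry.
Context {R : realType} {n : nat}.
Local Notation M := 'M[R]_n.+1.
Local Notation T := (borel_matrix R n).
Implicit Types (X Y Z v w : M).

Lemma prod_exp_bound (I : eqType) (s : seq I) (m : I -> nat) (c : I -> R) (B : R) :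
  (forall i, i \in s -> `|c i| <= B) ->
  `|\prod_(i <- s) c i ^+ m i| <= B ^+ (\sum_(i <- s) m i).
Proof.
elim: s => [|i s IH] h; first by rewrite !big_nil expr0 normr1.
rewrite !big_cons normrM exprD; apply: ler_pM => //; last by apply: IH => j js; apply: h; rewrite inE js orbT.
rewrite normrX; apply: lerXn2r; rewrite ?nnegrE ?h ?mem_head//.
by apply: (le_trans (normr_ge0 (c i))); rewrite h ?mem_head.
Qed.

Lemma cvg_prod_exp (I : Type) (s : seq I) (m : I -> nat) S (F : set_system S) (FF : Filter F)
    (f : I -> S -> R) (l : I -> R) : (forall i, f i @ F --> l i) ->
  (fun t => \prod_(i <- s) f i t ^+ m i) @ F --> \prod_(i <- s) l i ^+ m i.
Proof.
move=> fl; elim: s => [|i s IH].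
  by rewrite big_nil; under eq_fun do rewrite big_nil; exact: cvg_cst.
rewrite big_cons; under eq_fun do rewrite big_cons.
apply: cvgM => //; elim: (m i) => [|k IHk].
  by rewrite expr0; under eq_fun do rewrite expr0; exact: cvg_cst.
by rewrite exprS; under eq_fun do rewrite exprS; exact: cvgM.
Qed.

Variables (g a : {vspace M}) (H0 : M).
Local Notation dual := 'Hom(subvs_of a, R^o).
Variable s : seq dual.
Hypothesis H0a : H0 \in a.
Hypothesis H0s : {in s, forall alpha, 0 < ev alpha H0}.
Hypothesis hC : forall v, weyl_chamber g a H0 v <-> v \in a /\ {in s, forall alpha, 0 < ev alpha v}.
Hypothesis hrp : forall c v, root_product g a H0 c v = \prod_(alpha <- s) (c (ev alpha v)) ^+ multiplicity g alpha.

Lemma ev_bound : exists2 L : R, 0 < L & forall alpha v, alpha \in s -> `|ev alpha v| <= L * fnorm v.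
Proof.
elim: (s) => [|alpha s' [L L0 h]]; first by exists 1.
have [L' L'0 h'] := linear_form_bound (ev_linear alpha).
exists (L + L') => [|beta v]; first exact: addr_gt0.
rewrite inE mulrDl => /predU1P[->|bs].
  by apply: (le_trans (h' v)); rewrite lerDr mulr_ge0 ?fnorm_ge0// ltW.
by apply: (le_trans (h _ v bs)); rewrite lerDl mulr_ge0 ?fnorm_ge0// ltW.
Qed.

Lemma chamber_measurable : measurable (weyl_chamber g a H0 : set T).
Proof.
rewrite (_ : weyl_chamber _ _ _ = [set` a] `&` [set v : T | forall alpha, alpha \in s -> ev alpha v \in `]0, +oo[]).
  apply: measurableI; first by apply: borel_closed; exact: vspace_closed.
  apply: (@measurable_forall_seq _ T _ _ (fun alpha => [set v | ev alpha v \in `]0, +oo[])) => alpha.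
  rewrite -[X in measurable X]setTI.
  exact: (linear_form_measurable (ev_linear alpha) measurableT (measurable_itv `]0, +oo[)).
apply/seteqP; split => v /=.
  by move=> /hC[va h]; split => // alpha /h; rewrite in_itv /= andbT.
by move=> [va h]; apply/hC; split => // alpha /h; rewrite in_itv /= andbT.
Qed.

Lemma root_product_ge0 v : weyl_chamber g a H0 v -> 0 <= root_product g a H0 id v.
Proof.
move=> /hC[_ h]; rewrite hrp big_seq; apply: prodr_ge0 => alpha /h h0.
by rewrite exprn_ge0// ltW.
Qed.

Lemma root_product_cvg S (F : set_system S) (FF : Filter F) (f : S -> M) v :
  f @ F --> v -> (fun t => root_product g a H0 id (f t)) @ F --> root_product g a H0 id v.
Proof.
move=> fv; rewrite hrp; under eq_fun do rewrite hrp.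
by apply: cvg_prod_exp => alpha; apply: linear_form_cvg => //; exact: ev_linear.
Qed.

Lemma root_product_measurable : measurable_fun setT (root_product g a H0 id : T -> R).
Proof.
apply: (measurability (@RGenOpens.G R)) => [|/= _ [_] [p [q ->]] <-].
  exact: RGenOpens.measurableE.
rewrite setTI; apply: borel_open; apply: open_comp; last exact: interval_open.
by move=> v _; apply: (@root_product_cvg M (nbhs v) _ id); exact: cvg_id.
Qed.

End ChamberGeometry.

(** * Comparison of volume growth in p and in the chamber *)

Section Dimension.
Context {R : realType} {n : nat}.
Local Notation M := 'M[R]_n.+1.
Local Notation T := (borel_matrix R n).
Implicit Types (X Y Z v w : M).
Variables (G : set M) (g a : {vspace M}) (H0 : M).
Variables (dk da dp : {measure set T -> \bar R}).
Hypothesis hdk : haar_probability (maximal_compact G) dk.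
Hypothesis hda : lebesgue_on a da.
Hypothesis hdp : lebesgue_on (cartan_p g) dp.
Hypothesis hcompat : compatible_lebesgue G g a H0 dk da dp.
Hypothesis ap : (a <= cartan_p g)%VS.
Hypothesis hH0 : chamber_point g a H0.
Hypothesis hG : linear_reductive G.
Hypothesis mK : measurable (maximal_compact G : set T).
Let C := weyl_chamber g a H0.
Let rp := root_product g a H0 id.

Lemma ball_measurable (r : R) : measurable ([set v : M | fnorm v <= r] : set T).
Proof.
apply: borel_closed; apply: (@closed_comp M R fnorm [set x | x <= r]); last exact: closed_le.
by move=> v _; exact: fnorm_continuous.
Qed.

(** The compatibility formula for the indicator of a ball: K preserves [fnorm] and has mass 1, so
    the integral over K disappears. *)
Lemma chamber_ball_measure (r : R) :
  dp [set w : M | w \in cartan_p g /\ fnorm w <= r] =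
  (\int[da]_(v in C `&` [set v : M | (fnorm v <= r)%R]) (rp v)%:E)%E.
Proof.
pose B : set T := [set v : M | fnorm v <= r].
have := hcompat (h := EFin \o \1_B) _ _.
move=> /(_ _ _)/esym E; transitivity (\int[dp]_(w in [set w : M | w \in cartan_p g]) (\1_B w)%:E)%E.
  rewrite integral_indic//; first by rewrite setIC.
    by apply: borel_closed; exact: vspace_closed.
  exact: ball_measurable.
rewrite -[LHS]E; last 2 first.
- by apply/measurable_EFinP; apply: measurable_indic; exact: ball_measurable.
- by move=> w; rewrite lee_fin.
have [_ K1 _] := hdk.
transitivity (\int[dk]_(k in maximal_compact G)
  cst (\int[da]_(v in C `&` [set v : M | (fnorm v <= r)%R]) (rp v)%:E) k)%E; last first.
  by rewrite integral_cst// K1 mule1.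
apply: eq_integral => k /set_mem Kk /=.
rewrite [RHS]integral_mkcondr; apply: eq_integral => v _.
rewrite patchE /= /Ad (K_inv hG Kk) indicE.
rewrite (_ : (_ \in B) = (v \in [set v : M | (fnorm v <= r)%R])).
  by case: ifP; rewrite ?mul1e ?mul0e.
by apply/idP/idP => /set_mem h; apply/mem_set; move: h; rewrite /B /= (fnorm_conjK _ Kk).
Qed.

Local Notation dual := 'Hom(subvs_of a, R^o).
Variable s : seq dual.
Hypothesis H0s : {in s, forall alpha, 0 < ev alpha H0}.
Hypothesis hC : forall v, weyl_chamber g a H0 v <-> v \in a /\ {in s, forall alpha, 0 < ev alpha v}.
Hypothesis hrp : forall c v, root_product g a H0 c v = \prod_(alpha <- s) (c (ev alpha v)) ^+ multiplicity g alpha.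
Local Notation N := (\sum_(alpha <- s) multiplicity g alpha)%N.

Lemma growth_compare (c1 c2 : R) (p q : nat) : 0 < c1 ->
  (forall k : nat, (0 < k)%N -> c1 * k%:R ^+ p <= c2 * k%:R ^+ q) -> (p <= q)%N.
Proof.
move=> c10 h; rewrite leqNgt; apply/negP => qp.
pose k := (Num.trunc (`|c2| / c1)).+1.
have k0 : 0 < k%:R :> R by rewrite ltr0n.
have kc : `|c2| < c1 * k%:R by rewrite mulrC -ltr_pdivrMr// truncnS_gt.
have := h k isT; apply/negP; rewrite -ltNge.
apply: (@lt_le_trans _ _ (c1 * k%:R ^+ q.+1)).
  rewrite exprS mulrA ltr_pM2r ?exprn_gt0//.
  exact: le_lt_trans (ler_norm _) kc.
by rewrite ler_pM2l// ler_weXn2l// ler1n.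
Qed.

Lemma root_product_lower (v : M) (B : R) : 0 <= B -> {in s, forall alpha, B <= ev alpha v} ->
  B ^+ N <= rp v.
Proof.
move=> B0; rewrite /rp hrp; elim: (s) => [|alpha s' IH] h; first by rewrite !big_nil expr0.
rewrite !big_cons exprD; apply: ler_pM; rewrite ?exprn_ge0//; last first.
  by apply: IH => beta bs; apply: h; rewrite inE bs orbT.
by apply: lerXn2r; rewrite ?nnegrE//; [apply: (le_trans B0)|]; rewrite ?h ?mem_head.
Qed.

(** A multiple of H0 lies deep enough in the chamber for all positive roots at once; the required
    multiples are added over the list. *)
Lemma chamber_direction (K : R) : 0 < K ->
  exists2 m : R, 0 < m & {in s, forall alpha, K <= m * ev alpha H0}.
Proof.
move=> K0; elim: (s) H0s => [|alpha s' IH] h; first by exists 1.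
have [|m m0 hm] := IH; first by move=> beta bs; apply: h; rewrite inE bs orbT.
have a0 := h _ (mem_head alpha s').
exists (m + K / ev alpha H0) => [|beta]; first by rewrite addr_gt0// divr_gt0.
rewrite inE mulrDl => /predU1P[->|bs].
  by rewrite divfK ?gt_eqF// lerDr mulr_ge0// ltW.
apply: (le_trans (hm _ bs)); rewrite lerDl mulr_ge0//; first by rewrite divr_ge0// ltW.
by rewrite ltW// h// inE bs orbT.
Qed.

Let mC : measurable (C : set T). Proof. exact: chamber_measurable hC. Qed.

Let mrp : measurable_fun setT (rp : T -> R).
Proof. exact: root_product_measurable hrp. Qed.

(* The volume of the ball of radius r in p grows like r^(dim p); by compatibility
   it also grows like r^(N + dim a). *)
Lemma dimension_upper : (\dim (cartan_p g) <= N + \dim a)%N.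
Proof.
have [c c0 hc] := box_bound (cartan_p g).
have [q q0 hq] := lebesgue_box hdp.
have [C' C0 hC'] := lebesgue_ball_growth hda.
have [L L0 hL] := ev_bound s.
(* A box of side r in p fits into the ball of radius c r <= k r; an integer radius is what
   [lebesgue_ball_growth] accepts. *)
pose k := (Num.trunc c).+1.
have k0 : 0 < k%:R :> R by rewrite ltr0n.
apply: (@growth_compare q ((L * k%:R) ^+ N * (C' * k%:R ^+ \dim a))) => // r r0.
rewrite -lee_fin mulrC -hq.
pose B := [set v : M | fnorm v <= (k * r)%:R].
have mB : measurable (B : set T) by exact: ball_measurable.
apply: (@le_trans _ _ (dp [set w : M | w \in cartan_p g /\ fnorm w <= (k * r)%:R])).
  apply: le_measure; rewrite ?inE.
  - exact: box_measurable.
  - apply: (@measurableI _ T); last exact: mB.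
    by apply: borel_closed; exact: vspace_closed.
  - move=> v bv; split; first by case: bv.
    apply: (le_trans (hc _ _ _ bv)) => //; rewrite natrM ler_wpM2r//.
    exact/ltW/truncnS_gt.
rewrite chamber_ball_measure.
apply: (@le_trans _ _ (\int[da]_(v in C `&` B) (cst (((L * (k * r)%:R) ^+ N)%:E)) v)%E).
  apply: ge0_le_integral => //=.
  - exact: measurableI.
  - by move=> v [/(root_product_ge0 hC hrp) h _]; rewrite lee_fin.
  - by apply/measurable_EFinP; exact: measurable_funTS.
  - move=> v [Cv Bv]; rewrite lee_fin; apply: (le_trans (ler_norm _)).
    rewrite /rp hrp; apply: prod_exp_bound => alpha hs.
    by apply: (le_trans (hL _ _ hs)); rewrite ler_wpM2l// ltW.
rewrite integral_cst; last exact: measurableI.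
have : (da (C `&` B) <= (C' * (k * r)%:R ^+ \dim a)%:E)%E.
  apply: le_trans (hC' _ _); last by rewrite muln_gt0.
  apply: le_measure; rewrite ?inE; first exact: measurableI.
    apply: (@measurableI _ T); last exact: mB.
    by apply: borel_closed; exact: vspace_closed.
  by move=> v [/hC[va _] Bv].
move=> /(lee_wpmul2l (x := ((L * (k * r)%:R) ^+ N)%:E)) => h.
apply: (le_trans (h _)); first by rewrite lee_fin exprn_ge0// mulr_ge0// ltW.
have gen (l kk rr c' : R) (p d : nat) :
    (l * (kk * rr)) ^+ p * (c' * (kk * rr) ^+ d) = (l * kk) ^+ p * (c' * kk ^+ d) * rr ^+ (p + d).
  by rewrite !exprMn exprD; ring.
by rewrite -EFinM lee_fin natrM gen.
Qed.

(** A box of side r in a, pushed by m r H0, lies in the chamber and in a ball of radius k r, and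
    every positive root is at least r on it. Its contribution is of order r^(N + dim a), below the
    volume of that ball in p. *)
Lemma dimension_lower : (N + \dim a <= \dim (cartan_p g))%N.
Proof.
have [c c0 hc] := box_bound a.
have [q q0 hq] := lebesgue_box hda.
have [C' C0 hC'] := lebesgue_ball_growth hdp.
have [L L0 hL] := ev_bound s.
(* On a box of side r a root is at most L c r in absolute value, so (1 + L c) r at the shift leaves
   at least r everywhere on the translate. *)
have K0 : 0 < 1 + L * c by rewrite addr_gt0// mulr_gt0.
have [m m0 hm] := chamber_direction K0.
have [H0a _] := hH0.
pose k := (Num.trunc (m * fnorm H0 + c)).+1.
have k0 : 0 < k%:R :> R by rewrite ltr0n.
apply: (@growth_compare q (C' * k%:R ^+ \dim (cartan_p g))) => // r r0.
pose B := [set v : M | fnorm v <= (k * r)%:R].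
have mB : measurable (B : set T) by exact: ball_measurable.
pose u := (m * r%:R) *: H0.
have ua : u \in a by rewrite rpredZ.
pose E : set T := [set v : M | box a r%:R (- u + v)].
have mE : measurable E by apply: translate_measurable; exact: box_measurable.
have EC v : E v -> [/\ v \in a, {in s, forall alpha, r%:R <= ev alpha v} & fnorm v <= (k * r)%:R].
  move=> bv; have va : v \in a.
    by case: bv => /(rpredD ua); rewrite addrA subrr add0r.
  have bn := hc _ _ (ler0n _ r) bv.
  have vE : v = u + (- u + v) by rewrite addrA subrr add0r.
  split => // [alpha hs|].
    have le := ev_linear alpha.
    have h1 := hL _ (- u + v) hs; have h2 := hm _ hs.
    rewrite vE (linear_formD le) (linear_formZ le).
    have gen (e0 e1 nu' rr : R) : 1 + L * c <= m * e0 -> 0 <= rr -> `|e1| <= L * nu' ->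
        nu' <= c * rr -> rr <= m * rr * e0 + e1.
      move=> g1 g2 g3 g4; have g5 : L * nu' <= L * (c * rr) by rewrite ler_wpM2l// ltW.
      have g6 : (1 + L * c) * rr <= (m * e0) * rr by rewrite ler_wpM2r.
      move: g3; rewrite ler_norml => /andP[g3 _]; lra.
    exact: (gen _ _ _ _ h2 _ h1 bn).
  rewrite vE; apply: (le_trans (ler_fnormD _ _)); rewrite fnormZ.
  rewrite ger0_norm; last by rewrite mulr_ge0// ltW.
  have h3 : m * fnorm H0 + c <= k%:R by exact/ltW/truncnS_gt.
  have gen (f0 f1 rr kk : R) : m * f0 + c <= kk -> 0 <= rr -> f1 <= c * rr -> m * rr * f0 + f1 <= kk * rr.
    move=> g1 g2 g3; have g4 : (m * f0 + c) * rr <= kk * rr by rewrite ler_wpM2r.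
    lra.
  by rewrite natrM; exact: gen.
have ECB : E `<=` C `&` B.
  move=> v /EC[va h nv]; split => //; apply/hC; split => // alpha hs.
  by apply: lt_le_trans (h _ hs); rewrite ltr0n.
rewrite -lee_fin.
apply: (@le_trans _ _ (dp [set w : M | w \in cartan_p g /\ fnorm w <= (k * r)%:R])); last first.
  by apply: (le_trans (hC' _ _)); rewrite ?muln_gt0// lee_fin natrM exprMn mulrA.
rewrite chamber_ball_measure.
apply: (@le_trans _ _ (\int[da]_(v in E) (rp v)%:E)%E); last first.
  apply: ge0_subset_integral => //.
  - exact: measurableI.
  - by apply/measurable_EFinP; exact: measurable_funTS.
  - by move=> v [/(root_product_ge0 hC hrp) h _]; rewrite lee_fin.
apply: (@le_trans _ _ (\int[da]_(v in E) (cst (r%:R ^+ N)%:E) v)%E); last first.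
  apply: ge0_le_integral => //=.
  - by apply/measurable_EFinP; exact: measurable_funTS.
  - by move=> v /EC[_ h _]; rewrite lee_fin root_product_lower.
rewrite integral_cst// (lebesgue_translate hda ua (box_measurable a r%:R)) hq -EFinM lee_fin.
by rewrite exprD mulrC -mulrA.
Qed.

Lemma dim_cartan_p : \dim (cartan_p g) = (N + \dim a)%N.
Proof. by apply/eqP; rewrite eqn_leq dimension_upper dimension_lower. Qed.

End Dimension.

(** * The integrals over K x a x K *)

Section Sinh.
Context {R : realType}.

Lemma sinhN (y : R) : sinh (- y) = - sinh y.
Proof. by rewrite /sinh opprK -mulNr opprB. Qed.

(** For y >= 0, sinh y = e^y (1 - e^(-2y)) / 2 and 1 - 2y <= e^(-2y). *)
Lemma normr_sinh_le (y : R) : `|sinh y| <= `|y| * expR `|y|.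
Proof.
wlog y0 : y / 0 <= y => [H|].
  have [y0|/ltW y0] := leP 0 y; first exact: H.
  by have := H (- y); rewrite sinhN !normrN; apply; rewrite oppr_ge0.
have e1 : 0 <= expR y by exact: expR_ge0.
have e2 : 1 - y - y <= expR (- y) * expR (- y).
  have := expR_ge1Dx (- y - y); rewrite expRD; lra.
have e3 : expR y * expR (- y) = 1 by exact: expRxMexpNx_1.
have e4 : expR (- y) <= expR y by rewrite ler_expR; lra.
rewrite ger0_norm; last by rewrite /sinh divr_ge0// subr_ge0.
rewrite ger0_norm// /sinh.
have gen (a b : R) : 0 <= a -> a * b = 1 -> 1 - y - y <= b * b -> (a - b) / 2 <= y * a.
  move=> a0 ab h; have := ler_wpM2l a0 h.
  have -> : a * (b * b) = b by rewrite mulrA ab mul1r.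
  lra.
exact: gen.
Qed.

Lemma sinh_scale_bound (t s B : R) : 0 < t <= 1 -> `|s| <= B -> `|t^-1 * sinh (t * s)| <= B * expR B.
Proof.
move=> /andP[t0 t1] sB.
have B0 : 0 <= B by exact: le_trans (normr_ge0 s) sB.
rewrite normrM gtr0_norm ?invr_gt0//.
apply: (@le_trans _ _ (t^-1 * (`|t * s| * expR `|t * s|))).
  by rewrite ler_wpM2l ?invr_ge0 ?(ltW t0)// normr_sinh_le.
rewrite normrM (gtr0_norm t0) !mulrA mulVf ?gt_eqF// mul1r.
apply: ler_pM; rewrite ?expR_ge0// ler_expR.
by apply: le_trans sB; rewrite ler_piMl.
Qed.

(** The limit is the derivative at 0 of y -> sinh (y s). *)
Lemma sinh_scale_cvg (t : nat -> R) (s : R) : t @ \oo --> 0 -> (forall k, 0 < t k) ->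
  (fun k => (t k)^-1 * sinh (t k * s)) @ \oo --> s.
Proof.
move=> t0 tpos.
pose f (y : R) := sinh (y * s).
have df : is_derive (0 : R) (1 : R) f s.
  rewrite /f /sinh; apply: is_derive_eq.
  by rewrite !mul0r oppr0 expR0 /GRing.scale /=; lra.
have [df1 df2] := df.
have /cvg_ex[l hl] := df1.
have ls : l = s by rewrite -df2; apply/esym/cvg_lim.
have f0 : f 0 = 0 by rewrite /f mul0r /sinh oppr0 subrr mul0r.
have t0' : t @ \oo --> 0^'.
  move=> U h; have := t0 _ h; rewrite /nbhs /= /nbhs /=; apply: filterS => k /= hk.
  by apply: hk; rewrite gt_eqF.
have := cvg_comp _ _ t0' hl; rewrite ls; apply: cvg_trans; apply: near_eq_cvg.
apply: nearW => k /=; rewrite f0 subr0 addr0 /GRing.scale /= mulr1.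
by rewrite /f.
Qed.

End Sinh.

(** * Iterated integrals and passage to finite measures *)

Section TripleIntegral.
Context {R : realType} {d1 d2 d3} {T1 : measurableType d1} {T2 : measurableType d2}
  {T3 : measurableType d3}.
Variables (m1 : {finite_measure set T1 -> \bar R}) (m2 : {finite_measure set T2 -> \bar R})
  (m3 : {finite_measure set T3 -> \bar R}).
Implicit Types (f : T1 * (T2 * T3) -> R).

Definition Rintegral3 f :=
  Rintegral m1 setT (fun x => Rintegral m2 setT (fun y => Rintegral m3 setT (fun z => f (x, (y, z))))).

Lemma bounded_meas_inner f : bounded_meas f ->
  bounded_meas (fun q : T1 * T2 => Rintegral m3 setT (fun z => f (q.1, (q.2, z)))).
Proof.
move=> bf.
apply: (@bounded_meas_Rintegral2 _ _ _ (T1 * T2)%type T3 m3 (fun q => f (q.1.1, (q.1.2, q.2)))).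
apply: (bounded_meas_comp bf (phi := fun q : (T1 * T2) * T3 => (q.1.1, (q.1.2, q.2)))).
by apply: measurable_fun_pair; [|apply: measurable_fun_pair] => //; exact: measurableT_comp.
Qed.

(** Dominated convergence is applied to the three integrals in turn; each inner integral multiplies
    the constant bound by a total mass. *)
Lemma cvg_Rintegral3 (fn : nat -> T1 * (T2 * T3) -> R) f (C : R) :
  (forall k, measurable_fun setT (fn k)) -> measurable_fun setT f ->
  (forall k q, `|fn k q| <= C) -> (forall q, fn k q @[k --> \oo] --> f q) ->
  Rintegral3 (fn k) @[k --> \oo] --> Rintegral3 f.
Proof.
move=> mfn mf fnC fnf.
have fC q : `|f q| <= C.
  have h : (fun k => `|fn k q|) @ \oo --> `|f q| by apply: cvg_norm; exact: fnf.
  by apply: (ler_cvg_to h (cvg_cst C)); apply: nearW => k; exact: fnC.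
have bf : bounded_meas f by split => //; exists C.
have bfn k : bounded_meas (fn k) by split => //; exists C.
have in3 (h : T1 * (T2 * T3) -> R) : bounded_meas h -> (forall q, `|h q| <= C) -> forall x y,
    `|Rintegral m3 setT (fun z => h (x, (y, z)))| <= C * fine (m3 setT).
  move=> bh hC x y; apply: Rintegral_le_bound => //.
  by have [] := bounded_meas_pair1 y (bounded_meas_pair1 x bh).
have in2 (h : T1 * (T2 * T3) -> R) : bounded_meas h -> (forall q, `|h q| <= C) -> forall x,
    `|Rintegral m2 setT (fun y => Rintegral m3 setT (fun z => h (x, (y, z))))|
    <= C * fine (m3 setT) * fine (m2 setT).
  move=> bh hC x; apply: Rintegral_le_bound => [|y]; last exact: in3.
  by have [] := bounded_meas_pair1 x (bounded_meas_inner bh).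
rewrite /Rintegral3; apply: (@cvg_Rintegral_bounded _ _ _ m1 _ _ (C * fine (m3 setT) * fine (m2 setT))).
- by move=> k; have [] := bounded_meas_Rintegral2 m2 (bounded_meas_inner (bfn k)).
- by have [] := bounded_meas_Rintegral2 m2 (bounded_meas_inner bf).
- by move=> k x; exact: in2.
move=> x; apply: (@cvg_Rintegral_bounded _ _ _ m2 _ _ (C * fine (m3 setT))).
- by move=> k; have [] := bounded_meas_pair1 x (bounded_meas_inner (bfn k)).
- by have [] := bounded_meas_pair1 x (bounded_meas_inner bf).
- by move=> k y; exact: in3.
move=> y; apply: (@cvg_Rintegral_bounded _ _ _ m3 _ _ C) => //.
- by move=> k; have [] := bounded_meas_pair1 y (bounded_meas_pair1 x (bfn k)).
- by have [] := bounded_meas_pair1 y (bounded_meas_pair1 x bf).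
Qed.

Lemma Rintegral3Z f (c : R) : bounded_meas f ->
  Rintegral3 (fun q => c * f q) = c * Rintegral3 f.
Proof.
move=> bf; have Z d (S : measurableType d) (m : {finite_measure set S -> \bar R}) (h : S -> R) :
    bounded_meas h -> Rintegral m setT (fun y => c * h y) = c * Rintegral m setT h.
  by move=> bh; rewrite RintegralZl//; exact: bounded_meas_integrable.
rewrite /Rintegral3 -Z; last exact: bounded_meas_Rintegral2 (bounded_meas_inner bf).
apply: eq_Rintegral => y _.
rewrite -Z; last exact: bounded_meas_pair1 (bounded_meas_inner bf).
apply: eq_Rintegral => z _.
rewrite Z//; exact: bounded_meas_pair1 (bounded_meas_pair1 y bf).
Qed.

End TripleIntegral.

Section RestrictedIntegral.
Context {R : realType} {d} {T : measurableType d} (mu : {measure set T -> \bar R}).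
Variables (D : set T) (mD : measurable D) (moo : (mu D < +oo)%E).

(** Replaces a possibly infinite measure by its finite restriction to a set outside which the
    integrand vanishes. *)
Lemma integral_mfrestr_supp (A : set T) (f : T -> \bar R) : D `<=` A ->
  (forall x, ~ D x -> f x = 0%E) ->
  (\int[mu]_(x in A) f x = \int[mfrestr mD moo]_x f x)%E.
Proof.
move=> DA f0.
have fD : f \_ D = f by apply/funext => x; rewrite patchE; case: ifPn => // /negP xD; rewrite f0// => Dx; apply: xD; exact/mem_set.
have fA : f \_ A = f.
  apply/funext => x; rewrite patchE; case: ifPn => // /negP xA; rewrite f0// => Dx.
  by apply: xA; apply/mem_set; exact: DA.
rewrite integral_mkcond fA -[in LHS]fD -integral_mkcond -[in RHS]fD -integral_mkcond.
by apply: eq_measure_integral => U mU UD; rewrite /= /mfrestr /mrestr setIidl.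
Qed.

Lemma Rintegral_mfrestr_supp (A : set T) (f : T -> R) : D `<=` A ->
  (forall x, ~ D x -> f x = 0) ->
  Rintegral mu A f = Rintegral (mfrestr mD moo) setT f.
Proof.
move=> DA f0; rewrite /Rintegral (integral_mfrestr_supp (f := EFin \o f) DA)//= => x xD.
by rewrite /= f0.
Qed.

End RestrictedIntegral.

(** * Integrals over K, the chamber and p for a fixed radius of the supports *)

Section HaarIntegration.
Context {R : realType} {n : nat}.
Local Notation M := 'M[R]_n.+1.
Local Notation T := (borel_matrix R n).
Implicit Types (X Y Z v w k z : M).
Variables (G : set M) (g a : {vspace M}) (H0 : M).
Variables (dk da dp : {measure set T -> \bar R}).
Hypotheses (hG : linear_reductive G) (hg : is_lie_algebra G g).
Hypothesis hdk : haar_probability (maximal_compact G) dk.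
Hypothesis hda : lebesgue_on a da.
Hypothesis hdp : lebesgue_on (cartan_p g) dp.
Hypothesis hcompat : compatible_lebesgue G g a H0 dk da dp.
Hypothesis ap : (a <= cartan_p g)%VS.
Local Notation dual := 'Hom(subvs_of a, R^o).
Variable s : seq dual.
Hypothesis hC : forall v, weyl_chamber g a H0 v <-> v \in a /\ {in s, forall alpha, 0 < ev alpha v}.
Hypothesis hrp : forall c v, root_product g a H0 c v = \prod_(alpha <- s) (c (ev alpha v)) ^+ multiplicity g alpha.
Local Notation K := (maximal_compact G).
Local Notation p := (cartan_p g).
Local Notation C := (weyl_chamber g a H0).
Local Notation rp := (root_product g a H0 id).

Lemma K_closed : closed K.
Proof.
move=> k clk.
have kk : k^T * k = 1.
  have cl : closed [set k : M | k^T * k = 1].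
    apply: (@closed_comp M M (fun k => k^T * k) [set 1]); last first.
      by apply: accessible_closed_set1; apply: hausdorff_accessible; exact: norm_hausdorff.
    move=> X _; suff : (fun Y : M => Y^T * Y) @ nbhs X --> X^T * X by [].
    by apply: cvg_mulmx; [apply: cvg_trmx|]; exact: cvg_id.
  by apply: cl; apply: closure_subset clk => y [].
have uk : k \is a GRing.unit by apply/unitrP; exists k^T; split => //; apply/mulmx1C.
split => //; case: hG => _ clG _ _; apply: clG; split => //.
by apply: closure_subset clk => y [].
Qed.

Lemma K_measurable : measurable (K : set T).
Proof. by apply: borel_closed; exact: K_closed. Qed.

Variable R0 : R.
Let B : set M := [set v | fnorm v <= R0].
Let E : set T := C `&` B.

Let mB : measurable (B : set T). Proof. exact: ball_measurable. Qed.
Let mC : measurable (C : set T). Proof. exact: chamber_measurable hC. Qed.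
Let mE : measurable E. Proof. exact: measurableI. Qed.
Let mP : measurable ([set w : M | w \in p] `&` B : set T).
Proof. by apply: (@measurableI _ T) => //; apply: borel_closed; exact: vspace_closed. Qed.

Let lt_ball (V : {vspace M}) (nu : {measure set T -> \bar R}) (A : set T) : lebesgue_on V nu ->
  measurable A -> (forall v, A v -> v \in V /\ fnorm v <= R0) -> (nu A < +oo)%E.
Proof.
move=> [_ _ hc _] mA AV; have cV := @vspace_ball_compact _ _ V R0 0.
apply: le_lt_trans (hc _ cV); apply: le_measure; rewrite ?inE//.
  by apply: borel_closed; apply: compact_closed => //; exact: norm_hausdorff.
by move=> v /AV /=; rewrite subr0.
Qed.

Lemma chamber_ball_finite : (da E < +oo)%E.
Proof. by apply: (lt_ball hda) => // v [/hC[]]. Qed.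

Lemma cartan_ball_finite : (dp ([set w : M | w \in p] `&` B) < +oo)%E.
Proof. by apply: (lt_ball hdp) => // v []. Qed.

Lemma K_finite : (dk K < +oo)%E.
Proof. by case: hdk => _ -> _; exact: ltry. Qed.

(** [mK] and [mA] are the finite measures that replace dk and da; the chamber is cut at the radius
    R0, outside which the integrands will vanish. *)
Definition mK := mfrestr K_measurable K_finite.
Definition mA := mfrestr mE chamber_ball_finite.

Lemma mK_translate k (A : set T) : K k -> measurable A -> mK ((fun y : M => k * y) @^-1` A) = mK A.
Proof.
move=> Kk mA'; case: hdk => _ _ inv.
have -> : mK A = dk (A `&` K) by [].
have -> : mK ((fun y : M => k * y) @^-1` A) = dk (((fun y : M => k * y) @^-1` A) `&` K) by [].
rewrite -(inv k (A `&` K) Kk); last by apply: measurableI => //; exact: K_measurable.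
congr (dk _); apply/seteqP; split => y [h1 h2]; split => //; first exact: K_mul.
have -> : y = k^T * (k * y) by rewrite mulrA (K_trl Kk) mul1r.
by apply: K_mul => //; exact: K_tr.
Qed.

Lemma mulmx_measurable k : measurable_fun setT ((fun y : M => k * y) : T -> T).
Proof.
apply: (borel_continuous (f := fun y => k * y)) => X.
suff : (fun Y : M => k * Y) @ nbhs X --> k * X by [].
by apply: cvg_mulmx; [exact: cvg_cst|exact: cvg_id].
Qed.

Lemma Rintegral_mK_translate (f : T -> R) k : K k -> bounded_meas f ->
  Rintegral mK setT (fun y : T => f (k * (y : M))) = Rintegral mK setT f.
Proof.
move=> Kk bf; apply: (@Rintegral_preserving _ _ _ mK f (fun y : M => k * y)) => //.
  exact: mulmx_measurable.
by move=> A mA'; exact: mK_translate.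
Qed.

(** The integrand of the compatibility formula with the domains K and E built in as indicators, so
    that it can be integrated over the whole space. *)
Definition polar_weight (h : M -> R) (q : T * T) : R :=
  h (q.1 * q.2 * q.1^T) * (\1_(K : set T) q.1 * \1_E q.2 * rp q.2).

Lemma rp_ball_bound : exists A : R, forall v, E v -> `|rp v| <= A.
Proof.
have [L L0 hL] := ev_bound s.
exists ((L * R0) ^+ (\sum_(alpha <- s) multiplicity g alpha)) => v [Cv Bv].
rewrite hrp; apply: prod_exp_bound => alpha hs.
by apply: (le_trans (hL _ v hs)); rewrite ler_wpM2l// ltW.
Qed.

Lemma bounded_rp : bounded_meas (fun v : T => \1_E v * rp v).
Proof.
split.
  apply: measurable_funM; first exact: measurable_indic.
  exact: root_product_measurable hrp.
have [A hA] := rp_ball_bound; exists `|A| => v; rewrite indicE.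
case: (boolP (v \in E)) => [/set_mem Ev|_]; last by rewrite mul0r normr0.
by rewrite mul1r; apply: (le_trans (hA _ Ev)); exact: ler_norm.
Qed.

Lemma conj_measurable : measurable_fun setT ((fun q : T * T => q.1 * q.2 * q.1^T) : T * T -> T).
Proof.
apply: (borel_continuous2 (f := fun q => q.1 * q.2 * q.1^T)) => q.
suff : (fun q : M * M => q.1 * q.2 * q.1^T) @ nbhs q --> q.1 * q.2 * q.1^T by [].
apply: cvg_mulmx; last by apply: cvg_trmx; exact: cvg_fst.
by apply: cvg_mulmx; [exact: cvg_fst|exact: cvg_snd].
Qed.

Lemma bounded_polar_weight (h : T -> R) : bounded_meas h -> bounded_meas (polar_weight h).
Proof.
move=> bh; apply: bounded_measM; first exact: (bounded_meas_comp bh conj_measurable).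
rewrite (_ : (fun q => _) = (fun q : T * T => \1_(K : set T) q.1 * (\1_E q.2 * rp q.2))); last first.
  by apply/funext => q; rewrite mulrA.
apply: bounded_measM; last exact: (bounded_meas_comp bounded_rp measurable_snd).
apply: (@bounded_meas_comp _ _ T _ _ (\1_(K : set T)) fst _ measurable_fst); split.
  by apply: measurable_indic; exact: K_measurable.
by exists 1 => y; rewrite indicE; case: (y \in _); rewrite ?normr1 ?normr0.
Qed.

Let PB : set T := [set w : M | w \in p] `&` B.

Lemma polar_weight_supp (h : T -> R) k v : ~ E v -> polar_weight h (k, v) = 0.
Proof.
by move=> nE; rewrite /polar_weight /= [X in _ * (_ * X * _)]indicE memNset// mulr0 mul0r mulr0.
Qed.

Lemma polar_weight_suppK (h : T -> R) k v : ~ K k -> polar_weight h (k, v) = 0.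
Proof.
by move=> nE; rewrite /polar_weight /= [X in _ * (X * _ * _)]indicE memNset// !mul0r mulr0.
Qed.

Lemma bounded_meas_fin (mu : {finite_measure set T -> \bar R}) (h : T -> R) : bounded_meas h ->
  (\int[mu]_y (h y)%:E = (Rintegral mu setT h)%:E)%E.
Proof.
by move=> bh; rewrite fineK//; apply: integrable_fin_num => //; exact: bounded_meas_integrable.
Qed.

Lemma Rintegral0 (mu : {measure set T -> \bar R}) (A : set T) (h : T -> R) :
  (forall y, A y -> h y = 0) -> Rintegral mu A h = 0.
Proof.
move=> h0; rewrite /Rintegral (_ : integral _ _ _ = 0%E)//.
by apply: integral0_eq => y /h0 /= ->.
Qed.

Lemma compat_nonneg (h : T -> R) : bounded_meas h -> (forall w, 0 <= h w) ->
  Rintegral dp PB h =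
  Rintegral mK setT (fun k => Rintegral mA setT (fun v => polar_weight h (k, v))).
Proof.
move=> bh h0.
have bw := bounded_polar_weight bh.
have := hcompat (h := fun w => (h w * \1_(B : set T) w)%:E).
move=> /(_ _ _)/esym eqc.
have L : (\int[dp]_(w in PB) (h w)%:E = \int[dp]_(w in [set w : M | w \in p]) (h w * \1_(B : set T) w)%:E)%E.
  rewrite integral_mkcondr; apply: eq_integral => w _; rewrite patchE indicE.
  by case: (w \in _); rewrite ?mulr1 ?mulr0.
rewrite {1}/Rintegral L -eqc; last 2 first.
- apply/measurable_EFinP; apply: measurable_funM; first by case: bh.
  exact: measurable_indic.
- by move=> w; rewrite lee_fin mulr_ge0// indicE.
have EC : E `<=` C by move=> v [].
have in1 k : K k -> (\int[da]_(v in C) ((h (Ad k v) * \1_(B : set T) (Ad k v))%:E * (rp v)%:E) =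
    (Rintegral mA setT (fun v => polar_weight h (k, v)))%:E)%E.
  move=> Kk; rewrite -bounded_meas_fin; last exact: (bounded_meas_pair1 (k : T) bw).
  rewrite /mA -(integral_mfrestr_supp mE chamber_ball_finite (A := C))//; last first.
    by move=> v nE; rewrite polar_weight_supp.
  apply: eq_integral => v /set_mem Cv; rewrite -EFinM /polar_weight /= (K_Ad hG)//.
  have iK : \1_(K : set T) k = 1 :> R by rewrite indicE mem_set.
  have -> : \1_(B : set T) (k * (v : M) * k^T) = \1_E v :> R.
    rewrite !indicE; congr (_%:R); congr nat_of_bool.
    apply/idP/idP => /set_mem h1; apply/mem_set; move: h1; rewrite /E /B /= (fnorm_conjK _ Kk).
      by split.
    by case.
  by rewrite iK mul1r mulrA.
transitivity (Rintegral dk K (fun k => Rintegral mA setT (fun v => polar_weight h (k, v)))).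
  by congr fine; apply: eq_integral => k /set_mem Kk; exact: in1.
apply: Rintegral_mfrestr_supp => // k nK; apply: Rintegral0 => v _.
exact: polar_weight_suppK.
Qed.

(** The compatibility formula is given for nonnegative functions. A bounded h is written as (h + b)
    - b, and both integrals are finite on the ball. *)
Lemma compat_bounded (h : T -> R) : bounded_meas h ->
  Rintegral dp PB h =
  Rintegral mK setT (fun k => Rintegral mA setT (fun v => polar_weight h (k, v))).
Proof.
move=> bh; case: (bh) => mh [b hb].
pose hp (w : T) : R := h w + b.
have b0 (w : T) : 0 <= hp w by rewrite /hp -lerBlDr sub0r; have := hb w; rewrite ler_norml => /andP[].
have bc : bounded_meas (fun=> `|b| : R) (T := T) by split => //; exists `|b| => w; rewrite normr_id.
have babs (w : T) : b = `|b| by rewrite ger0_norm//; exact: le_trans (normr_ge0 _) (hb w).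
have bhp : bounded_meas hp.
  split; first exact: measurable_funD.
  by exists (b + b) => w; apply: (le_trans (ler_normD _ _)); rewrite lerD// -babs.
have hE : h = (fun w => hp w - `|b|) by apply/funext => w; rewrite /hp -babs// addrK.
have bw := bounded_polar_weight bhp; have bwc := bounded_polar_weight bc.
have int (f : T -> R) : bounded_meas f -> dp.-integrable PB (EFin \o f).
  move=> [mf [bf fb]]; apply: measurable_bounded_integrable => //.
  - exact: cartan_ball_finite.
  - exact: measurable_funTS.
  - exists bf; split; first exact: num_real.
    by move=> y Cy w _; exact: le_trans (fb w) (ltW Cy).
rewrite [in LHS]hE RintegralB//; [|exact: int|exact: int].
rewrite (compat_nonneg bhp)// (compat_nonneg bc)//.
rewrite -RintegralB_bounded; [|exact: bounded_meas_Rintegral2|exact: bounded_meas_Rintegral2].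
congr Rintegral; apply/funext => k.
rewrite -RintegralB_bounded; [|exact: (bounded_meas_pair1 k bw)|exact: (bounded_meas_pair1 k bwc)].
by congr Rintegral; apply/funext => v; rewrite /polar_weight [in RHS]hE mulrBl.
Qed.

Lemma within_cvg_comp {X : topologicalType} {S : Type} {F : set_system S} {FF : Filter F}
    (f : X -> R) (D : set X) (q : X) (c : S -> X) :
  f @ within D (nbhs q) --> f q -> c @ F --> q -> (\forall y \near F, D (c y)) ->
  (fun y => f (c y)) @ F --> f q.
Proof.
move=> fq cq cD U Uf.
have h : nbhs q [set y | D y -> U (f y)] by exact: (fq U Uf).
have h' : F (c @^-1` [set y | D y -> U (f y)]) by exact: cq.
by rewrite /nbhs /=; apply: filterS2 h' cD => y /= hy; exact: hy.
Qed.

Lemma cvg_pair_pt {X Y : topologicalType} {S : Type} {F : set_system S} {FF : Filter F}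
    (f1 : S -> X) (f2 : S -> Y) (x1 : X) (x2 : Y) :
  f1 @ F --> x1 -> f2 @ F --> x2 -> (fun y => (f1 y, f2 y)) @ F --> (x1, x2).
Proof.
move=> h1 h2 U [[V W] /= [Vx Wx] VW].
have hV : F (f1 @^-1` V) by exact: h1.
have hW : F (f2 @^-1` W) by exact: h2.
rewrite /nbhs /=; apply: filterS2 hV hW => y /= Vy Wy.
by apply: VW; split.
Qed.

Variable x : M.
Hypothesis hxK : K x.
Let D : set (M * M * R) := [set q | [/\ K q.1.1, q.1.2 \in p & 0 <= q.2 <= 1]].
Variables (phi : M * M * R -> R) (b rho : R).
Hypothesis phic : forall q, D q -> phi @ within D (nbhs q) --> phi q.
Hypothesis phib : forall q, D q -> `|phi q| <= b.
Hypothesis phir : forall q, D q -> phi q != 0 -> fnorm q.1.2 <= rho.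
Hypothesis R0_polar : forall y w k u (t : R), K y -> w \in p -> K k -> u \in p -> 0 < t ->
  expmx (t *: w) * (y * x * y^T) * expmx (- (t *: w)) = k * expmx (t *: u) ->
  fnorm u <= rho -> fnorm w <= R0.
Hypothesis R0_reg : forall y w, K y -> w \in p ->
  fnorm (w - (y * x * y^T) * w * (y * x * y^T)^T) <= rho -> fnorm w <= R0.

Implicit Types (q : M * (M * M)).

(* A point (k', (v, k)) carries the three integration variables of
   haar_integral. *)
Definition conj_pt q : M := (q.2.2 * q.1) * x * (q.2.2 * q.1)^T.
Definition radial_pt q : M := q.2.2 * q.2.1 * q.2.2^T.

(** One factor 1/t has been moved into each sinh, so that the density stays bounded and converges.
    The first factor is [phi] at the polar coordinates of y x y^-1 for y = k e^(tv) k'. *)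
Definition integrand (t : R) q : R :=
  phi (kpolar G g t (conj_pt q) (radial_pt q), upolar G g t (conj_pt q) (radial_pt q), t) *
  root_product g a H0 (fun r => t^-1 * sinh r) (t *: q.2.1).

Definition integrand0 q : R :=
  phi (conj_pt q, (conj_pt q)^T * radial_pt q * conj_pt q - radial_pt q, 0) * rp q.2.1.

(** D1 and D0 admit all v in a instead of the chamber: D0 is then closed, and continuity within it
    is what yields measurability. *)
Let D1 : set (M * (M * M)) := [set q | [/\ K q.1, q.2.1 \in a & K q.2.2]].
Let D0 : set (M * (M * M)) := [set q | D1 q /\ fnorm q.2.1 <= R0].

Lemma conj_pt_K q : D1 q -> K (conj_pt q).
Proof. by move=> [h1 _ h2]; apply: K_conj => //; exact: K_mul. Qed.

Lemma radial_pt_p q : D1 q -> radial_pt q \in p.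
Proof. by move=> [_ h1 h2]; apply: (p_conj hG hg) => //; exact: (subvP ap). Qed.

Lemma cvg_q1 {S} {F : set_system S} {FF : Filter F} (f : S -> M * (M * M)) q :
  f @ F --> q -> (fun y => (f y).1) @ F --> q.1.
Proof. by move=> fq; apply: (cvg_comp _ _ fq); exact: cvg_fst. Qed.

Lemma cvg_q21 {S} {F : set_system S} {FF : Filter F} (f : S -> M * (M * M)) q :
  f @ F --> q -> (fun y => (f y).2.1) @ F --> q.2.1.
Proof.
move=> fq; have h : (fun y => (f y).2) @ F --> q.2 by apply: (cvg_comp _ _ fq); exact: cvg_snd.
by apply: (cvg_comp _ _ h); exact: cvg_fst.
Qed.

Lemma cvg_q22 {S} {F : set_system S} {FF : Filter F} (f : S -> M * (M * M)) q :
  f @ F --> q -> (fun y => (f y).2.2) @ F --> q.2.2.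
Proof.
move=> fq; have h : (fun y => (f y).2) @ F --> q.2 by apply: (cvg_comp _ _ fq); exact: cvg_snd.
by apply: (cvg_comp _ _ h); exact: cvg_snd.
Qed.

Lemma cvg_conj_pt {S} {F : set_system S} {FF : Filter F} (f : S -> M * (M * M)) q :
  f @ F --> q -> (fun y => conj_pt (f y)) @ F --> conj_pt q.
Proof.
move=> fq; have h : (fun y => (f y).2.2 * (f y).1) @ F --> q.2.2 * q.1.
  by apply: cvg_mulmx; [exact: cvg_q22|exact: cvg_q1].
apply: cvg_mulmx; last exact: cvg_trmx.
by apply: cvg_mulmx => //; exact: cvg_cst.
Qed.

Lemma cvg_radial_pt {S} {F : set_system S} {FF : Filter F} (f : S -> M * (M * M)) q :
  f @ F --> q -> (fun y => radial_pt (f y)) @ F --> radial_pt q.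
Proof.
move=> fq; apply: cvg_mulmx; last by apply: cvg_trmx; exact: cvg_q22.
by apply: cvg_mulmx; [exact: cvg_q22|exact: cvg_q21].
Qed.

Let D0_closed : closed D0.
Proof.
have c1 (A : set M) (f : M * (M * M) -> M) : closed A -> (forall q, f @ nbhs q --> f q) -> closed (f @^-1` A).
  by move=> cA cf; apply: closed_comp => // q _; exact: cf.
have -> : D0 = ((fun q => q.1) @^-1` K `&` (fun q => q.2.1) @^-1` ([set v : M | v \in a] `&` B)) `&`
    (fun q => q.2.2) @^-1` K.
  apply/seteqP; split => q; first by move=> [[h1 h2 h3] h4]; split => //; split => //; split.
  by move=> [[h1 [h2 h3]] h4]; split => //; split.
apply: closedI; last first.
  by apply: c1; [exact: K_closed|move=> q; apply: cvg_q22; exact: cvg_id].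
apply: closedI.
  by apply: c1; [exact: K_closed|move=> q; apply: cvg_q1; exact: cvg_id].
apply: c1; last by move=> q; apply: cvg_q21; exact: cvg_id.
apply: closedI; first exact: vspace_closed.
apply: (@closed_comp M R fnorm [set r | r <= R0]); last exact: closed_le.
by move=> v _; exact: fnorm_continuous.
Qed.

Let polar_D t q : 0 < t <= 1 -> D1 q ->
  D (kpolar G g t (conj_pt q) (radial_pt q), upolar G g t (conj_pt q) (radial_pt q), t).
Proof.
move=> /andP[t0 t1] Dq; have Kz := conj_pt_K Dq; have wp := radial_pt_p Dq.
split => /=; [by case: (kpolarP hG hg t0 Kz wp)|exact: upolar_p|by rewrite ltW].
Qed.

Let limit_D q : D1 q -> D (conj_pt q, (conj_pt q)^T * radial_pt q * conj_pt q - radial_pt q, 0).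
Proof.
move=> Dq; have Kz := conj_pt_K Dq; have wp := radial_pt_p Dq.
split => //=; last by rewrite lexx ler01.
by rewrite rpredB// (p_conjT hG hg).
Qed.

Lemma integrand_continuous t q : 0 < t <= 1 -> D0 q ->
  integrand t @ within D0 (nbhs q) --> integrand t q.
Proof.
move=> t01 [Dq _]; have /andP[t0 t1] := t01.
pose F := within D0 (nbhs q).
have FF : Filter F by exact: within_filter.
have idF : id @ F --> q by exact: cvg_within.
have nD : \forall y \near F, D1 y by apply: filterS (withinT D0 (nbhs_filter q)) => y [].
have nKp : \forall y \near F, K (conj_pt y) /\ radial_pt y \in p.
  by apply: filterS nD => y Dy; split; [exact: conj_pt_K|exact: radial_pt_p].
have cz : (fun y => conj_pt y) @ F --> conj_pt q by exact: cvg_conj_pt idF.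
have cw : (fun y => radial_pt y) @ F --> radial_pt q by exact: cvg_radial_pt idF.
have ck : (fun y => kpolar G g t (conj_pt y) (radial_pt y)) @ F --> kpolar G g t (conj_pt q) (radial_pt q).
  by apply: cvg_kpolar nKp cz cw => //; [exact: conj_pt_K|exact: radial_pt_p].
have cu : (fun y => upolar G g t (conj_pt y) (radial_pt y)) @ F --> upolar G g t (conj_pt q) (radial_pt q).
  by apply: cvg_upolar nKp cz cw => //; [exact: conj_pt_K|exact: radial_pt_p].
apply: cvgM; last first.
  rewrite hrp; under eq_fun do rewrite hrp.
  apply: cvg_prod_exp => alpha; apply: cvgM; first exact: cvg_cst.
  have h : (fun y => ev alpha (t *: y.2.1)) @ F --> ev alpha (t *: q.2.1).
    apply: linear_form_cvg; first exact: ev_linear.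
    by apply: cvgZr; exact: cvg_q21 idF.
  apply: cvgM; last exact: cvg_cst.
  apply: cvgB; first by apply: continuous_cvg => //; exact: continuous_expR.
  by apply: continuous_cvg; [exact: continuous_expR|exact: cvgN].
apply: (within_cvg_comp (phic (polar_D t01 Dq))).
  apply: cvg_pair_pt; last exact: cvg_cst.
  apply: cvg_pair_pt.
    exact: ck.
  exact: cu.
by apply: filterS nD => y Dy; exact: polar_D.
Qed.

Lemma integrand0_continuous q : D0 q -> integrand0 @ within D0 (nbhs q) --> integrand0 q.
Proof.
move=> [Dq _].
pose F := within D0 (nbhs q).
have FF : Filter F by exact: within_filter.
have idF : id @ F --> q by exact: cvg_within.
have nD : \forall y \near F, D1 y by apply: filterS (withinT D0 (nbhs_filter q)) => y [].
have cz : (fun y => conj_pt y) @ F --> conj_pt q by exact: cvg_conj_pt idF.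
have cw : (fun y => radial_pt y) @ F --> radial_pt q by exact: cvg_radial_pt idF.
apply: cvgM; last by apply: (root_product_cvg hrp); exact: cvg_q21 idF.
apply: (within_cvg_comp (phic (limit_D Dq))).
  apply: cvg_pair_pt; last exact: cvg_cst.
  apply: cvg_pair_pt; first exact: cz.
  apply: cvgB; last exact: cw.
  apply: cvg_mulmx; last exact: cz.
  by apply: cvg_mulmx; [apply: cvg_trmx; exact: cz|exact: cw].
by apply: filterS nD => y Dy; exact: limit_D.
Qed.

Lemma integrand_bound : exists A : R,
  (forall t q, 0 < t <= 1 -> D0 q -> `|integrand t q| <= A) /\
  (forall q, D0 q -> `|integrand0 q| <= A).
Proof.
have [L L0 hL] := ev_bound s.
have [A hA] : exists A : R, forall v, v \in a -> fnorm v <= R0 -> `|rp v| <= A.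
  exists ((L * R0) ^+ (\sum_(alpha <- s) multiplicity g alpha)) => v va Bv.
  rewrite hrp; apply: prod_exp_bound => alpha hs.
  by apply: (le_trans (hL _ v hs)); rewrite ler_wpM2l// ltW.
pose A' := (L * R0 * expR (L * R0)) ^+ (\sum_(alpha <- s) multiplicity g alpha).
exists (b * `|A| + b * `|A'|); split.
  move=> t q t01 [Dq nq]; rewrite normrM; apply: ler_wpDl.
    by rewrite mulr_ge0//; exact: le_trans (normr_ge0 _) (phib (polar_D t01 Dq)).
  apply: ler_pM => //; first by apply: phib; exact: polar_D.
  apply: le_trans (ler_norm A'); rewrite hrp; apply: prod_exp_bound => alpha hs.
  rewrite (linear_formZ (ev_linear alpha)); apply: sinh_scale_bound => //.
  by apply: (le_trans (hL _ _ hs)); rewrite ler_wpM2l// ltW.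
move=> q [Dq nq]; rewrite normrM; apply: ler_wpDr.
  by rewrite mulr_ge0//; exact: le_trans (normr_ge0 _) (phib (limit_D Dq)).
apply: ler_pM => //; first by apply: phib; exact: limit_D.
by apply: le_trans (ler_norm A); case: Dq => _ h _; exact: hA.
Qed.

Lemma integrand_cvg (t : nat -> R) q : t @ \oo --> 0 -> (forall j, 0 < t j <= 1) -> D1 q ->
  (fun j => integrand (t j) q) @ \oo --> integrand0 q.
Proof.
move=> t0 t01 Dq; have Kz := conj_pt_K Dq; have wp := radial_pt_p Dq.
have tpos j : 0 < t j by have /andP[] := t01 j.
have [cu ck] := upolar_kpolar_lim hG hg Kz wp t0 (nearW _ tpos).
apply: cvgM.
  apply: (within_cvg_comp (phic (limit_D Dq))).
    exact: (cvg_pair_pt (cvg_pair_pt ck cu) t0).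
  by apply: nearW => j; exact: polar_D.
rewrite hrp; under eq_fun do rewrite hrp.
apply: cvg_prod_exp => alpha; under eq_fun do rewrite (linear_formZ (ev_linear alpha)).
exact: sinh_scale_cvg.
Qed.

(** [phi] vanishes where the radial part exceeds rho. By [R0_polar] a radial part at most rho forces
    |Ad_k v| = |v| <= R0. *)
Lemma integrand_supp t q : 0 < t <= 1 -> D1 q -> ~ fnorm q.2.1 <= R0 -> integrand t q = 0.
Proof.
move=> t01 Dq nq; apply/eqP/negP => /negP h; apply: nq.
have phi0 : phi (kpolar G g t (conj_pt q) (radial_pt q), upolar G g t (conj_pt q) (radial_pt q), t) != 0.
  by apply: contra h => /eqP h0; rewrite /integrand h0 mul0r.
have /andP[t0 t1] := t01; have Kz := conj_pt_K Dq; have wp := radial_pt_p Dq.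
have [Kk E'] := kpolarP hG hg t0 Kz wp.
have := R0_polar _ wp Kk (upolar_p hG hg t0 Kz wp) t0 E' (phir (polar_D t01 Dq) phi0).
have [h1 h2 h3] := Dq.
by rewrite /radial_pt (fnorm_conjK _ h3); apply; exact: K_mul.
Qed.

(** The cut is made in two stages: to the closed set D0, where [restrict_measurable] applies, and
    then by the indicator of the chamber, which is not assumed closed. *)
Definition cutoff (f : M * (M * M) -> R) (q : T * (T * T)) : R := (f \_ D0) q * \1_(C : set T) q.2.1.

Lemma cutoffE f (q : T * (T * T)) : D0 q -> C q.2.1 -> cutoff f q = f q.
Proof. by move=> Dq Cv; rewrite /cutoff patchE mem_set// indicE mem_set// mulr1. Qed.

Lemma cutoff0 f (q : T * (T * T)) : ~ (D0 q /\ C q.2.1) -> cutoff f q = 0.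
Proof.
move=> nD; rewrite /cutoff patchE indicE.
case: ifPn => [/set_mem Dq|_]; last by rewrite mul0r.
by rewrite memNset ?mulr0// => Cq; apply: nD.
Qed.

Lemma cutoff_bound f (A : R) : (forall q, D0 q -> `|f q| <= A) ->
  forall q : T * (T * T), `|cutoff f q| <= `|A|.
Proof.
move=> fA q; have [[Dq Cq]|nq] := pselect (D0 q /\ C q.2.1); last by rewrite cutoff0// normr0.
rewrite cutoffE//.
by apply: (le_trans (fA _ Dq)); exact: ler_norm.
Qed.

Lemma cutoff_measurable (f : M * (M * M) -> R) : (forall q, D0 q -> f @ within D0 (nbhs q) --> f q) ->
  measurable_fun setT (cutoff f).
Proof.
move=> fc; apply: measurable_funM.
  exact: (@restrict_measurable _ _ (M * (M * M))%type (T * (T * T))%type id D0 f (@borel_open3 _ _) D0_closed fc).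
apply: (measurableT_comp (f := \1_(C : set T) : T -> R)); first exact: measurable_indic.
by apply: measurableT_comp; [exact: measurable_fst|exact: measurable_snd].
Qed.

Lemma Rintegral3_cutoff f : (forall q, D1 q -> ~ fnorm q.2.1 <= R0 -> f q = 0) ->
  Rintegral dk K (fun k' => Rintegral da C (fun v => Rintegral dk K (fun k => f (k', (v, k))))) =
  Rintegral3 mK mA mK (cutoff f).
Proof.
move=> f0.
have in1 k' v : K k' -> C v -> Rintegral dk K (fun k => f (k', (v, k))) =
    Rintegral mK setT (fun k => cutoff f (k', (v, k))).
  move=> Kk' Cv; transitivity (Rintegral dk K (fun k => cutoff f (k', (v, k)))); last first.
    by apply: Rintegral_mfrestr_supp => // k nK; rewrite cutoff0//= => -[[[_ _ ?] _] _].
  apply: eq_Rintegral => k /set_mem Kk; have va : (v : M) \in a by case: ((hC v).1 Cv).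
  have [nv|nv] := pselect (fnorm v <= R0); first by rewrite cutoffE//; split => //; split.
  rewrite cutoff0; last by move=> [[_ ?]].
  by apply: f0 => //; split.
have in2 k' : K k' -> Rintegral da C (fun v => Rintegral dk K (fun k => f (k', (v, k)))) =
    Rintegral mA setT (fun v => Rintegral mK setT (fun k => cutoff f (k', (v, k)))).
  move=> Kk'; transitivity (Rintegral da C (fun v => Rintegral mK setT (fun k => cutoff f (k', (v, k))))).
    by apply: eq_Rintegral => v /set_mem Cv; exact: in1.
  apply: Rintegral_mfrestr_supp => [v []//|v nE]; apply: Rintegral0 => k _.
  by rewrite cutoff0//= => -[[_ ?] ?]; apply: nE; split.
transitivity (Rintegral dk K (fun k' => Rintegral mA setT (fun v =>
    Rintegral mK setT (fun k => cutoff f (k', (v, k)))))).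
  by apply: eq_Rintegral => k' /set_mem Kk'; exact: in2.
apply: Rintegral_mfrestr_supp => // k' nK.
by apply: Rintegral0 => v _; apply: Rintegral0 => k _; rewrite cutoff0// => -[[[]]].
Qed.

Lemma integrand_lim (t : nat -> R) : t @ \oo --> 0 -> (forall j, 0 < t j <= 1) ->
  (fun j => Rintegral dk K (fun k' => Rintegral da C (fun v => Rintegral dk K (fun k =>
     integrand (t j) (k', (v, k)))))) @ \oo -->
  Rintegral3 mK mA mK (cutoff integrand0).
Proof.
move=> t0 t01; have [A [A1 A2]] := integrand_bound.
rewrite (_ : (fun j => _) = (fun j => Rintegral3 mK mA mK (cutoff (integrand (t j))))); last first.
  by apply/funext => j; apply: Rintegral3_cutoff => q Dq nq; exact: integrand_supp.
apply: (@cvg_Rintegral3 _ _ _ _ _ _ _ mK mA mK _ _ `|A|).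
- by move=> j; apply: cutoff_measurable => q; exact: integrand_continuous.
- by apply: cutoff_measurable => q; exact: integrand0_continuous.
- by move=> j; apply: cutoff_bound => q; exact: A1.
move=> q; have [[Dq Cq]|nq] := pselect (D0 q /\ C q.2.1).
  rewrite cutoffE//; under eq_fun do rewrite cutoffE//.
  by apply: integrand_cvg => //; case: Dq.
by rewrite cutoff0//; under eq_fun do rewrite cutoff0//; exact: cvg_cst.
Qed.

Lemma cutoff0_bounded : bounded_meas (cutoff integrand0).
Proof.
have [A [_ A2]] := integrand_bound; split.
  by apply: cutoff_measurable => q; exact: integrand0_continuous.
by exists `|A|; exact: cutoff_bound.
Qed.

Definition limit_density (z : M) (w : M) : R := phi (z, w - z * w * z^T, 0).

Let limit_density_K z w : K z -> w \in p -> D (z, w - z * w * z^T, 0).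
Proof. by move=> Kz wp; split => //=; [rewrite rpredB// (p_conj hG hg)|rewrite lexx ler01]. Qed.

Let dens (z : M) : T -> R := limit_density z \_ [set w : M | w \in p].

Lemma dens_bounded z : K z -> bounded_meas (dens z).
Proof.
move=> Kz; split; last first.
  exists `|b| => w; rewrite /dens patchE; case: ifPn => [/set_mem wp|_]; last by rewrite normr0.
  by apply: (le_trans (phib (limit_density_K Kz wp))); exact: ler_norm.
apply: (@restrict_measurable _ _ M T id [set w : M | w \in p] (limit_density z) (@borel_open _ _)).
  exact: vspace_closed.
move=> w wp; apply: (within_cvg_comp (phic (limit_density_K Kz wp))).
  have idF : id @ within [set w : M | w \in p] (nbhs w) --> w by exact: cvg_within.
  apply: cvg_pair_pt; last exact: cvg_cst.
  apply: cvg_pair_pt; first exact: cvg_cst.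
  apply: cvgB => //; apply: cvg_mulmx; last exact: cvg_cst.
  by apply: cvg_mulmx => //; exact: cvg_cst.
apply: filterS (withinT _ (nbhs_filter w)) => y yp; exact: limit_density_K.
Qed.

(** Replacing k by z k changes the radial point w into Ad_z w, hence Ad_z^-1 w - w into w - Ad_z w.
    The group element z no longer depends on k, so the compatibility formula merges the integrals
    over k and v. *)
Lemma limit_inner k' : K k' -> let z := k' * x * k'^T in
  Rintegral mK setT (fun k => Rintegral mA setT (fun v => cutoff integrand0 (k^T * k', (v, k)))) =
  Rintegral dp [set w : M | w \in p] (limit_density z).
Proof.
move=> Kk' z; have Kz : K z by exact: K_conj.
pose h2 (k : T) := Rintegral mA setT (fun v => cutoff integrand0 ((k : M)^T * k', (v, k))).
have bh2 : bounded_meas h2.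
  apply: (@bounded_meas_Rintegral2 _ _ _ T T mA
    (fun q : T * T => cutoff integrand0 ((q.1 : M)^T * k', (q.2, q.1)))).
  apply: (bounded_meas_comp cutoff0_bounded
    (phi := fun q : T * T => ((q.1 : M)^T * k', (q.2, q.1)) : T * (T * T))).
  have mf : measurable_fun setT ((fun q : M * M => q.1^T * k') : T * T -> T).
    apply: borel_continuous2 => q.
    suff : (fun q : M * M => q.1^T * k') @ nbhs q --> q.1^T * k' by [].
    by apply: cvg_mulmx; [apply: cvg_trmx; exact: cvg_fst|exact: cvg_cst].
  by apply: measurable_fun_pair; [exact: mf|apply: measurable_fun_pair].
rewrite -(Rintegral_mK_translate Kz bh2).
transitivity (Rintegral dp PB (dens z)); last first.
  have wE (w : M) : [set w : M | w \in p] w -> ~ B w -> limit_density z w = 0.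
    move=> wp nB; apply/eqP/negP => /negP h; apply: nB.
    by apply: (R0_reg Kk' wp); exact: phir (limit_density_K Kz wp) h.
  rewrite [RHS]/Rintegral [LHS]/Rintegral integral_mkcondr; congr fine.
  apply: eq_integral => w wp; rewrite patchE /dens patchE wp.
  case: ifPn => // /negP nB; rewrite wE//; first exact/set_mem.
  by move=> Bw; apply: nB; exact/mem_set.
rewrite (compat_bounded (dens_bounded Kz)); apply: eq_Rintegral => k _.
have [Kk|nK] := pselect (K k); last first.
  rewrite [RHS]Rintegral0 => [|v _]; last exact: polar_weight_suppK.
  apply: Rintegral0 => v _; rewrite cutoff0//= => -[[[_ _ Kzk] _] _]; apply: nK.
  have -> : k = z^T * (z * k) by rewrite mulrA (K_trl Kz) mul1r.
  by apply: K_mul => //; exact: K_tr.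
apply: eq_Rintegral => v _.
have [Ev|nE] := pselect (E v); last first.
  rewrite polar_weight_supp// cutoff0//= => -[[_ Bv] Cv]; apply: nE; split => //.
have [Cv Bv] := Ev; have va : (v : M) \in a by case: ((hC v).1 Cv).
have vp : (v : M) \in p by exact: (subvP ap).
have Kzk : K (z * k) by exact: K_mul.
rewrite cutoffE//; last by split => //; split => //; apply: K_mul => //; exact: K_tr.
have cE : conj_pt ((z * k)^T * k', (v, z * k)) = z.
  rewrite /conj_pt /=.
  have -> : z * k * ((z * k)^T * k') = k' by rewrite mulrA (K_trr hG Kzk) mul1r.
  by [].
rewrite /integrand0 cE /radial_pt /polar_weight /= !indicE (mem_set Kk) (mem_set Ev) !mul1r.
congr (_ * _); rewrite /dens patchE mem_set; last exact: (p_conj hG hg).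
rewrite /limit_density; congr (phi (_, _, _)).
have tr : (z * k)^T = k^T * z^T by exact: trmxM.
rewrite tr.
have gen (A Bm : M) : A^T * A = 1 -> A^T * (A * Bm * A^T) * A = Bm.
  move=> AA; rewrite !mulrA AA mul1r -mulrA AA mulr1 //.
have -> : z * k * v * (k^T * z^T) = z * (k * v * k^T) * z^T by rewrite !mulrA.
by rewrite (gen _ _ (K_trl Kz)).
Qed.

(** The translation k' -> k^-1 k' makes Ad_(kk') x depend on k' alone. It is legitimate only for
    fixed k, so Fubini first brings the integral over k' inside those over k and v, and afterwards
    outside again. *)
Lemma limit_identity :
  Rintegral3 mK mA mK (cutoff integrand0) =
  Rintegral dk K (fun k => Rintegral dp [set w : M | w \in p] (limit_density (k * x * k^T))).
Proof.
have bc := cutoff0_bounded.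
pose psi (q : T * T) := Rintegral mA setT (fun v => cutoff integrand0 (q.1, (v, q.2))).
have bpsi : bounded_meas psi.
  apply: (@bounded_meas_Rintegral2 _ _ _ (T * T)%type T mA
    (fun q : (T * T) * T => cutoff integrand0 (q.1.1, (q.2, q.1.2)))).
  apply: (bounded_meas_comp bc (phi := fun q : (T * T) * T => (q.1.1, (q.2, q.1.2)))).
  by apply: measurable_fun_pair; [|apply: measurable_fun_pair] => //; exact: measurableT_comp.
have bpsi2 : bounded_meas (fun q : T * T => psi ((q.2 : M)^T * (q.1 : M), q.2)).
  apply: (bounded_meas_comp bpsi (phi := fun q : T * T => ((q.2 : M)^T * (q.1 : M), q.2) : T * T)).
  have mf : measurable_fun setT ((fun q : M * M => q.2^T * q.1) : T * T -> T).
    apply: borel_continuous2 => q.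
    suff : (fun q : M * M => q.2^T * q.1) @ nbhs q --> q.2^T * q.1 by [].
    by apply: cvg_mulmx; [apply: cvg_trmx; exact: cvg_snd|exact: cvg_fst].
  by apply: measurable_fun_pair; first exact: mf.
transitivity (Rintegral mK setT (fun k' => Rintegral mK setT (fun k => psi (k', k)))).
  rewrite /Rintegral3; apply: eq_Rintegral => k' _.
  exact: (Rintegral_swap mA mK (bounded_meas_pair1 k' bc)).
rewrite (Rintegral_swap mK mK bpsi).
transitivity (Rintegral mK setT (fun k => Rintegral mK setT (fun k' => psi ((k : M)^T * (k' : M), k)))).
  apply: eq_Rintegral => k _.
  have [Kk|nK] := pselect (K k).
    exact: (esym (Rintegral_mK_translate (K_tr hG Kk) (bounded_meas_pair2 k bpsi))).
  have z0 y : psi (y, k) = 0.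
    by apply: Rintegral0 => v _; rewrite cutoff0//= => -[[[_ _ ?] _] _].
  by apply: eq_Rintegral => y _; rewrite !z0.
rewrite -(Rintegral_swap mK mK bpsi2).
transitivity (Rintegral dk K (fun k' =>
    Rintegral mK setT (fun k => psi ((k : M)^T * (k' : M), k)))).
  apply: esym; apply: Rintegral_mfrestr_supp => // k' nK.
  apply: Rintegral0 => k _; apply: Rintegral0 => v _.
  rewrite cutoff0//= => -[[[Kkk _ Kk] _] _]; apply: nK.
  have -> : k' = k * (k^T * k') by rewrite mulrA (K_trr hG Kk) mul1r.
  exact: K_mul.
apply: eq_Rintegral => k' /set_mem Kk'.
exact: limit_inner.
Qed.

Definition raw_integrand (t : R) q : R :=
  phi (kpolar G g t (conj_pt q) (radial_pt q), upolar G g t (conj_pt q) (radial_pt q), t) *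
  root_product g a H0 sinh (t *: q.2.1).

Lemma raw_integrandE t q : 0 < t ->
  raw_integrand t q = t ^+ (\sum_(alpha <- s) multiplicity g alpha) * integrand t q.
Proof.
move=> t0; rewrite /raw_integrand /integrand mulrCA; congr (_ * _).
rewrite !hrp expr_sum -big_split /=; apply: eq_bigr => alpha _.
by rewrite -exprMn mulrA divff ?gt_eqF// mul1r.
Qed.

(** The power of t hidden in [integrand] is pulled out of the three integrals after they have been
    rewritten over finite measures. *)
Lemma raw_integral t : 0 < t <= 1 ->
  Rintegral dk K (fun k' => Rintegral da C (fun v => Rintegral dk K (fun k =>
    raw_integrand t (k', (v, k))))) =
  t ^+ (\sum_(alpha <- s) multiplicity g alpha) *
  Rintegral dk K (fun k' => Rintegral da C (fun v => Rintegral dk K (fun k =>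
    integrand t (k', (v, k))))).
Proof.
move=> t01; have /andP[t0 _] := t01.
have e1 := Rintegral3_cutoff (f := integrand t) (fun q => @integrand_supp t q t01).
have e2 : _ = Rintegral3 mK mA mK (cutoff (raw_integrand t)) := Rintegral3_cutoff
  (fun q Dq nq => etrans (raw_integrandE q t0) (etrans (congr1 _ (integrand_supp t01 Dq nq)) (mulr0 _))).
apply: (etrans e2); apply: (etrans _ (congr1 _ (esym e1))); rewrite -Rintegral3Z; last first.
  split; first by apply: cutoff_measurable => q; exact: integrand_continuous.
  have [A [A1 _]] := integrand_bound.
  by exists `|A|; apply: cutoff_bound => q; exact: A1.
congr (Rintegral3 _ _ _ _); apply/funext => q; rewrite /cutoff mulrA; congr (_ * _).
by rewrite !patchE; case: ifP => _; rewrite ?mulr0// raw_integrandE.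
Qed.

End HaarIntegration.

(** * The limit *)

Section ComplexLimit.
Context {R : realType}.

Lemma Re_mul_real (z : R[i]) (r : R) : complex.Re (z * real_complex R r) = complex.Re z * r.
Proof. by case: z => a b /=; rewrite mulr0 subr0. Qed.

Lemma Im_mul_real (z : R[i]) (r : R) : complex.Im (z * real_complex R r) = complex.Im z * r.
Proof. by case: z => a b /=; rewrite mulr0 add0r. Qed.

Lemma Re_real_mul (z : R[i]) (r : R) : complex.Re (real_complex R r * z) = r * complex.Re z.
Proof. by rewrite mulrC Re_mul_real mulrC. Qed.

Lemma Im_real_mul (z : R[i]) (r : R) : complex.Im (real_complex R r * z) = r * complex.Im z.
Proof. by rewrite mulrC Im_mul_real mulrC. Qed.

Lemma cvg_complex {S : Type} {F : set_system S} {FF : Filter F} (f : S -> R[i]) (l : R[i]) :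
  (fun y => complex.Re (f y)) @ F --> complex.Re l ->
  (fun y => complex.Im (f y)) @ F --> complex.Im l ->
  ((fun y => f y : R[i]^o) @ F --> (l : R[i]^o)).
Proof.
have E (z1 z2 : R[i]) : z1 - z2 =
    Complex (complex.Re z1 - complex.Re z2) (complex.Im z1 - complex.Im z2).
  by case: z1 z2 => [u v] [u' v'].
move=> hr hi; apply/cvgrPdist_lt => -[e e'].
(* A positive element of R[i] has imaginary part 0, so the radius is a real number. *)
rewrite ltcE /= => /andP[/eqP -> e0].
have e2 : 0 < e / 2 by rewrite divr_gt0.
suff : \forall y \near F, `|(l : R[i]^o) - f y| < Complex e 0 by [].
near=> y.
have h1 : `|complex.Re l - complex.Re (f y)| < e / 2.
  by near: y; exact: ((cvgrPdist_lt _ _).1 hr _ e2).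
have h2 : `|complex.Im l - complex.Im (f y)| < e / 2.
  by near: y; exact: ((cvgrPdist_lt _ _).1 hi _ e2).
rewrite [`|_|]normc_def ltcE /= eqxx /=.
rewrite E /=.
have gen (p q : R) : `|p| < e / 2 -> `|q| < e / 2 -> Num.sqrt (p ^+ 2 + q ^+ 2) < e.
  move=> hp hq; have -> : e = Num.sqrt (e ^+ 2) by rewrite sqrtr_sqr gtr0_norm.
  rewrite ltr_sqrt ?exprn_gt0// -(real_normK (num_real p)) -(real_normK (num_real q)).
  have p0 := normr_ge0 p; have q0 := normr_ge0 q.
  have h3 : `|p| ^+ 2 <= (e / 2) ^+ 2 by apply: lerXn2r; rewrite ?nnegrE//; [exact/ltW|exact: ltW].
  have h4 : `|q| ^+ 2 <= (e / 2) ^+ 2 by apply: lerXn2r; rewrite ?nnegrE//; [exact/ltW|exact: ltW].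
  have h5 : 0 < e ^+ 2 by rewrite exprn_gt0.
  have h6 : (e / 2) ^+ 2 = e ^+ 2 / 4 by rewrite expr_div_n; congr (_ / _); rewrite -natrX.
  lra.
exact: gen.
Unshelve. all: by end_near.
Qed.

End ComplexLimit.

(** * The limit for one real component of F *)

Section RealLimit.
Context {R : realType} {n : nat}.
Local Notation M := 'M[R]_n.+1.
Local Notation T := (borel_matrix R n).
Implicit Types (X Y Z v w k z : M).
Variables (G : set M) (g a : {vspace M}) (H0 : M).
Variables (dk da dp : {measure set T -> \bar R}).
Hypotheses (hG : linear_reductive G) (hg : is_lie_algebra G g).
Hypothesis hdk : haar_probability (maximal_compact G) dk.
Hypothesis hda : lebesgue_on a da.
Hypothesis hdp : lebesgue_on (cartan_p g) dp.
Hypothesis hcompat : compatible_lebesgue G g a H0 dk da dp.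
Hypothesis ap : (a <= cartan_p g)%VS.
Hypothesis hH0 : chamber_point g a H0.
Variable x : M.
Hypothesis hxK : maximal_compact G x.
Hypothesis hx : regular_element (maximal_compact G) g x.
Local Notation K := (maximal_compact G).
Local Notation p := (cartan_p g).
Local Notation C := (weyl_chamber g a H0).
Let D : set (M * M * R) := [set q | [/\ K q.1.1, q.1.2 \in p & 0 <= q.2 <= 1]].

Lemma family_domain_closed : closed D.
Proof.
have c1 (V : topologicalType) (A : set V) (f : M * M * R -> V) : closed A -> continuous f -> closed (f @^-1` A).
  by move=> cA cf; apply: closed_comp => // q _; exact: cf.
have f1 : continuous (fun q : M * M * R => q.1) by move=> q; exact: cvg_fst.
have -> : D = (((fun q => q.1.1) @^-1` K) `&` ((fun q => q.1.2) @^-1` [set v : M | v \in p])) `&`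
    ((fun q => q.2) @^-1` `[0, 1]).
  apply/seteqP; split => q; first by move=> [h1 h2 h3]; split => //=; rewrite in_itv.
  by move=> [[h1 h2]] /=; rewrite in_itv /= => h3; split.
apply: closedI; last by apply: c1; [exact: interval_closed|move=> q; exact: cvg_snd].
apply: closedI; apply: c1.
- exact: (K_closed hG).
- by move=> q; apply: (cvg_comp _ _ (f1 q)); exact: cvg_fst.
- exact: vspace_closed.
- by move=> q; apply: (cvg_comp _ _ (f1 q)); exact: cvg_snd.
Qed.

Variable phi : M * M * R -> R.
Hypothesis smooth_phi : smooth_on D phi.
Variable S : set (M * M * R).
Hypothesis compactS : compact (closure S).
Hypothesis SD : S `<=` D.
Hypothesis phi_supp : forall q, D q -> phi q != 0 -> S q.

Lemma smooth_on_continuous q : D q -> phi @ within D (nbhs q) --> phi q.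
Proof.
move=> Dq; have [h hC hn] := smooth_phi Dq.
have hq : phi q = h q by apply: nbhs_singleton hn Dq.
rewrite hq; have hc : h @ within D (nbhs q) --> h q.
  by apply: cvg_trans (hC 0%N q); apply: cvg_app; exact: cvg_within.
apply: cvg_trans hc; apply: near_eq_cvg; rewrite /within /=.
by apply: filterS hn => y hy Dy; rewrite hy.
Qed.

(** The closure of S is compact and stays inside the closed set D, where [phi] is continuous. Both
    [phi] and the norm of the p-component are therefore bounded on it. *)
Lemma phi_bounded : (exists b, forall q, D q -> `|phi q| <= b) /\
  (exists rho, forall q, D q -> phi q != 0 -> fnorm q.1.2 <= rho).
Proof.
have clD : closure S `<=` D.
  by move=> q cq; apply: family_domain_closed; exact: closure_subset cq.
have bnd (f : M * M * R -> R) : (forall q, closure S q -> f @ within (closure S) (nbhs q) --> f q) ->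
    exists b, forall q, closure S q -> `|f q| <= b.
  move=> fc; have cf : {within closure S, continuous f} by apply/subspace_continuousP.
  have := compact_bounded (continuous_compact cf compactS).
  move=> [b [_ hb]]; exists (b + 1) => q cq; apply: (hb (b + 1)); first by rewrite ltrDl.
  by exists q.
split.
  have [b hb] : exists b, forall q, closure S q -> `|phi q| <= b.
    apply: bnd => q cq; apply: cvg_trans (smooth_on_continuous (clD _ cq)).
    by apply: cvg_app; apply: within_subset.
  exists `|b| => q Dq; have [->|h] := eqVneq (phi q) 0; first by rewrite normr0.
  by apply: (le_trans (hb _ (subset_closure (phi_supp Dq h)))); exact: ler_norm.
have [rho hrho] : exists b, forall q, closure S q -> `|fnorm q.1.2| <= b.
  apply: (bnd (fun q => fnorm q.1.2)) => q cq; apply: cvg_fnorm.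
  have h0 : id @ within (closure S) (nbhs q) --> q by exact: cvg_within.
  have h1 : (fun q => q.1) @ within (closure S) (nbhs q) --> q.1.
    by apply: (cvg_comp _ _ h0); exact: cvg_fst.
  by apply: (cvg_comp _ _ h1); exact: cvg_snd.
exists rho => q Dq h; apply: le_trans (ler_norm _) _.
by apply: hrho; apply: subset_closure; exact: phi_supp.
Qed.

Lemma support_radius (rho : R) : exists R0 : R,
  (forall y w k u (t : R), K y -> w \in p -> K k -> u \in p -> 0 < t ->
    expmx (t *: w) * (y * x * y^T) * expmx (- (t *: w)) = k * expmx (t *: u) ->
    fnorm u <= rho -> fnorm w <= R0) /\
  (forall y w, K y -> w \in p ->
    fnorm (w - (y * x * y^T) * w * (y * x * y^T)^T) <= rho -> fnorm w <= R0).
Proof.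
have [c c0 hc] := polar_proper hG hg hxK hx.
have [d d0 hd] := regular_lower_bound hG hxK hx.
(* The first summand is the radius valid for all t > 0, the second the one for the limit; their sum
   serves both. *)
exists (c * `|rho| + d^-1 * `|rho|); split.
  move=> y w k u t Ky wp Kk up t0 E nu; apply: (le_trans (hc _ _ _ _ _ Ky wp Kk up t0 E)).
  apply: ler_wpDr; first by apply: mulr_ge0; [rewrite invr_ge0; exact: ltW|exact: normr_ge0].
  by apply: ler_wpM2l; [exact: ltW|apply: (le_trans nu); exact: ler_norm].
move=> y w Ky wp nw; apply: ler_wpDl; first by rewrite mulr_ge0// ltW.
have yw : y^T * w * y \in p by exact: (p_conjT hG hg).
have yy := K_trr hG Ky.
have E1 : y * (y^T * w * y) * y^T = w.
  have gen (A Bm X : M) : A * Bm = 1 -> A * (Bm * X * A) * Bm = X.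
    by move=> AB; rewrite !mulrA AB mul1r -mulrA AB mulr1.
  exact: gen.
have E2 : w - (y * x * y^T) * w * (y * x * y^T)^T =
    y * (y^T * w * y - x * (y^T * w * y) * x^T) * y^T.
  by rewrite mulrBr mulrBl E1 !trmxM trmxK !mulrA.
have nE2 := fnorm_conjK (y^T * w * y - x * (y^T * w * y) * x^T) Ky.
have nE1 := fnorm_conjK (y^T * w * y) Ky.
rewrite -ler_pdivrMl ?invr_gt0// invrK -E1 nE1.
by apply: (le_trans (hd _ yw)); rewrite -nE2 -E2; exact: le_trans nw (ler_norm _).
Qed.

Lemma real_limit (t : nat -> R) : t @ \oo --> 0 -> (forall j, 0 < t j <= 1) ->
  (fun j => (t j ^+ (\dim p - \dim a))^-1 *
    Rintegral dk K (fun k' => Rintegral da C (fun v => Rintegral dk K (fun k =>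
      raw_integrand G g a H0 x phi (t j) (k', (v, k)))))) @ \oo -->
  Rintegral dk K (fun k => Rintegral dp [set w : M | w \in p] (limit_density phi (k * x * k^T))).
Proof.
move=> t0 t01.
have [s [sP hC hrp]] := positive_roots_seq ap H0.
have H0s : {in s, forall alpha, 0 < ev alpha H0} by move=> alpha /sP[].
have hdim := dim_cartan_p hdk hda hdp hcompat hH0 hG (K_measurable hG) H0s hC hrp.
have phic := smooth_on_continuous.
have [[b phib] [rho phir]] := phi_bounded.
have [R0 [R0_polar R0_reg]] := support_radius rho.
(* The dimension formula identifies the exponent, a truncated difference of naturals, with the sum
   of the multiplicities, so the power of t from [raw_integral] cancels exactly. *)
rewrite hdim addnK -(limit_identity hG hg hdk hda hdp hcompat ap hC hrp hxK phic phib phir R0_reg).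
have := integrand_lim (hG := hG) hg (hdk := hdk) (hda := hda) ap (hC := hC) hrp hxK phic phib phir R0_polar t0 t01.
apply: cvg_trans; apply: near_eq_cvg; apply: nearW => j; have /andP[tj _] := t01 j.
apply: (etrans _ (congr1 ( *%R _)
  (esym (raw_integral hG hg hdk hda ap hC hrp hxK phic phib phir R0_polar (t01 j))))).
by rewrite mulrA mulVf ?mul1r// expf_neq0// gt_eqF.
Qed.

Lemma real_limit_at_right :
  (fun t : R => (t ^+ (\dim p - \dim a))^-1 *
    Rintegral dk K (fun k' => Rintegral da C (fun v => Rintegral dk K (fun k =>
      raw_integrand G g a H0 x phi t (k', (v, k)))))) @ 0^'+ -->
  Rintegral dk K (fun k => Rintegral dp [set w : M | w \in p] (limit_density phi (k * x * k^T))).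
Proof.
apply/cvg_at_rightP => u [u0 ulim].
have [N _ hN] : \forall j \near \oo, u j <= 1.
  have : u @ \oo --> (0 : R) by [].
  move=> /cvgrPdist_lt /(_ 1 ltr01); apply: filterS => j; rewrite sub0r normrN => h.
  by apply: (le_trans (ler_norm _)); exact: ltW.
(* The sequence is at most 1 only from N on, so its first N terms are dropped. *)
rewrite -(cvg_shiftn N); apply: (@real_limit (fun j => u (j + N)%N)).
  by rewrite cvg_shiftn.
by move=> j; rewrite u0 hN//= leq_addl.
Qed.

End RealLimit.

(** * From F in polar coordinates back to the functions f0 and f *)

Section ComponentLimit.
Context {R : realType} {n : nat}.
Local Notation M := 'M[R]_n.+1.
Local Notation T := (borel_matrix R n).
Variables (G : set M) (g a : {vspace M}) (H0 : M).
Variables (dk da dp : {measure set T -> \bar R}).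
Variables (f0 : M -> M -> R[i]) (f : R -> M -> R[i]) (x : M).
Hypotheses (hG : linear_reductive G) (hg : is_lie_algebra G g).
Hypothesis hdk : haar_probability (maximal_compact G) dk.
Hypothesis hda : lebesgue_on a da.
Hypothesis hdp : lebesgue_on (cartan_p g) dp.
Hypothesis hcompat : compatible_lebesgue G g a H0 dk da dp.
Hypothesis ap : (a <= cartan_p g)%VS.
Hypothesis hH0 : chamber_point g a H0.
Hypothesis hxK : maximal_compact G x.
Hypothesis hx : regular_element (maximal_compact G) g x.
Local Notation K := (maximal_compact G).
Local Notation p := (cartan_p g).
Local Notation C := (weyl_chamber g a H0).
Let D : set (M * M * R) := [set q | [/\ K q.1.1, q.1.2 \in p & 0 <= q.2 <= 1]].
Variable F : M * M * R -> R[i].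
Hypothesis F0 : forall k v, K k -> v \in p -> f0 k v = F (k, v, 0).
Hypothesis Ft : forall k v t, K k -> v \in p -> 0 < t <= 1 ->
  f t (k * expmx (t *: v)) = F (k, v, t).
Hypothesis cF : compactly_supported_on D F.

(** [f t] is known only at points written k e^(tv). With w = Ad_k v one has k e^(tv) k' = e^(tw) k
    k', so the argument is e^(tw) z e^(-tw), whose polar form is available. *)
Lemma family_conj (k' v k : M) (t : R) : K k' -> v \in a -> K k -> 0 < t <= 1 ->
  f t (k * expmx (t *: v) * k' * x * (k * expmx (t *: v) * k')^-1) =
  F (kpolar G g t (conj_pt x (k', (v, k))) (radial_pt (k', (v, k))),
     upolar G g t (conj_pt x (k', (v, k))) (radial_pt (k', (v, k))), t).
Proof.
move=> Kk' va Kk t01; have /andP[t0 _] := t01.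
set z := conj_pt x _; set w := radial_pt _.
have vp : v \in p by exact: (subvP ap).
have wp : w \in p by exact: (p_conj hG hg).
have Kkk : K (k * k') by exact: K_mul.
have Kz : K z by exact: K_conj.
have [Kp E] := kpolarP hG hg t0 Kz wp.
apply: etrans (Ft Kp (upolar_p hG hg t0 Kz wp) t01); apply: (congr1 (f t)); apply: (etrans _ E).
have ew (r : R) : expmx (r *: w) = k * expmx (r *: v) * k^T.
  rewrite -(exp_conjK hG _ Kk); congr expmx.
  by rewrite /w /radial_pt /= -scalerAr -scalerAl.
have yE : k * expmx (t *: v) * k' = expmx (t *: w) * (k * k').
  by rewrite ew mulrA -(mulrA _ k^T) (K_trl Kk) mulr1.
rewrite yE invrM; last 2 first.
- exact: expmx_unit.
- exact: (K_unit hG Kkk).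
rewrite expmxV (K_inv hG Kkk) /z /conj_pt /=.
by rewrite !mulrA.
Qed.

Variable c : R[i] -> R.
Hypothesis c0 : c 0 = 0.
Hypothesis smooth_c : smooth_on D (fun q => c (F q)).

(** Used with c = Re and c = Im. The condition c 0 = 0 keeps the nonvanishing set of c o F inside
    that of F, so one compact support serves both components. *)
Lemma component_limit :
  (fun t : R => (t ^+ (\dim p - \dim a))^-1 *
    Rintegral dk K (fun k' => Rintegral da C (fun v => Rintegral dk K (fun k =>
      c (f t ((k : M) * expmx (t *: (v : M)) * (k' : M) * x *
         ((k : M) * expmx (t *: (v : M)) * (k' : M))^-1)) *
      root_product g a H0 sinh (t *: (v : M)))))) @ 0^'+ -->
  Rintegral dk K (fun k => Rintegral dp [set w : M | w \in p] (fun w =>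
    c (f0 (Ad k x) ((w : M) - Ad (Ad k x) w)))).
Proof.
have lim := @real_limit_at_right _ _ G g a H0 dk da dp hG hg hdk hda hdp hcompat ap hH0 x hxK hx
  (fun q => c (F q)) smooth_c
  [set q | D q /\ F q != 0] cF (fun q => @proj1 _ _)
  (fun q Dq cq => conj Dq (contra_neq (fun e => etrans (congr1 c e) c0) cq)).
rewrite [X in _ --> X](_ : _ = Rintegral dk K (fun k => Rintegral dp [set w : M | w \in p]
  (limit_density (fun q => c (F q)) (k * x * k^T)))); last first.
  apply: eq_Rintegral => k /set_mem Kk; apply: eq_Rintegral => w /set_mem wp.
  have Kz : K (k * x * k^T) by exact: K_conj.
  rewrite (K_Ad hG x Kk) (K_Ad hG w Kz) F0//.
  by rewrite rpredB// (p_conj hG hg).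
apply: cvg_trans lim; apply: near_eq_cvg; near=> t.
have t01 : 0 < t <= 1.
  apply/andP; split; first by near: t; exact: nbhs_right_gt.
  by near: t; exact: nbhs_right_le.
apply: (congr1 ( *%R (t ^+ _)^-1)).
apply: eq_Rintegral => k' /set_mem Kk'; apply: eq_Rintegral => v /set_mem Cv.
apply: eq_Rintegral => k /set_mem Kk.
have va : (v : M) \in a by case: Cv.
by rewrite /raw_integrand (family_conj Kk' va Kk t01).
Unshelve. all: by end_near.
Qed.

End ComponentLimit.

Theorem theorem3p3 (R : realType) (n : nat)
    (G : set 'M[R]_n.+1) (g a : {vspace 'M[R]_n.+1}) (H0 : 'M[R]_n.+1)
    (dk da dp : {measure set (borel_matrix R n) -> \bar R})
    (f0 : 'M[R]_n.+1 -> 'M[R]_n.+1 -> R[i]) (f : R -> 'M[R]_n.+1 -> R[i])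
    (x : 'M[R]_n.+1)
    (hG : linear_reductive G)
    (hg : is_lie_algebra G g)
    (ha : maximal_abelian_in (cartan_p g) a)
    (hH0 : chamber_point g a H0)
    (hdk : haar_probability (maximal_compact G) dk)
    (hda : lebesgue_on a da)
    (hdp : lebesgue_on (cartan_p g) dp)
    (hcompat : compatible_lebesgue G g a H0 dk da dp)
    (hf : smooth_compact_on_family G g f0 f)
    (hxK : maximal_compact G x)
    (hx : regular_element (maximal_compact G) g x) :
  (haar_integral G g a H0 dk da t (fun y => f t (y * x * y^-1)) : R[i]^o)
    @[t --> 0^'+] -->
  (cintegral dk (maximal_compact G) (fun k =>
    cintegral dp [set w : 'M[R]_n.+1 | w \in cartan_p g] (fun w =>
      f0 (Ad k x) ((w : 'M[R]_n.+1) - Ad (Ad k x) w))) : R[i]^o).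
Proof.
have ap : (a <= cartan_p g)%VS by case: ha => -[].
have [F [[sRe sIm] cF F0 Ft]] := hf.
apply: cvg_complex.
  have := component_limit hG hg hdk hda hdp hcompat ap hH0 hxK hx F0 Ft cF (c := @complex.Re R) erefl sRe.
  apply: cvg_trans; apply: near_eq_cvg; apply: nearW => t.
  rewrite /haar_integral Re_real_mul; apply: (congr1 ( *%R (t ^+ _)^-1)).
  apply: eq_Rintegral => k' _; apply: eq_Rintegral => v _; apply: eq_Rintegral => k _.
  by rewrite Re_mul_real.
have := component_limit hG hg hdk hda hdp hcompat ap hH0 hxK hx F0 Ft cF (c := @complex.Im R) erefl sIm.
apply: cvg_trans; apply: near_eq_cvg; apply: nearW => t.
rewrite /haar_integral Im_real_mul; apply: (congr1 ( *%R (t ^+ _)^-1)).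
apply: eq_Rintegral => k' _; apply: eq_Rintegral => v _; apply: eq_Rintegral => k _.
by rewrite Im_mul_real.
Qed.
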